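(* For coprime positive integers $s$ and $t$, let $X_{st}$ be the total size (number of boxes) of a partition chosen uniformly at random among all $(s,t)$-core partitions. Then, as $s\to\infty$ and $t\to\infty$ (along coprime pairs, with no restriction on the relation between $s$ and $t$), $$\frac{X_{st}}{st(s+t)/2} \xrightarrow{D} U^2,\qquad U^2 \sim \sum_{k=1}^{\infty}\frac{Z_k^2+\tilde{Z}_k^2}{4\pi^2k^2},$$ where $Z_1,Z_2,\dots,\tilde Z_1,\tilde Z_2,\dots$ are mutually independent standard normal random variables and $\xrightarrow{D}$ denotes convergence in distribution.
   Context: A partition is identified with its Young diagram (a finite set of boxes stacked in the upper-left corner, with weakly decreasing row lengths). The hook of a box consists of the box itself together with all boxes directly to its right in its row and directly below it in its column; its size is the hook length. A partition is $p$-core if no box has hook length exactly $p$, and $(s,t)$-core if it is both $s$-core and $t$-core. For coprime $s,t$ there are only finitely many $(s,t)$-core partitions. The size of a partition is its number of boxes. *)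

(* Defs.v *)
From HB Require Import structures.
From mathcomp Require Import all_boot all_order all_algebra finmap.
From mathcomp Require Import all_classical all_reals all_analysis measurable_realfun.

Set Implicit Arguments.
Unset Strict Implicit.
Unset Printing Implicit Defensive.

Import Order.TTheory GRing.Theory Num.Theory.
Import numFieldNormedType.Exports.

Local Open Scope classical_set_scope.
Local Open Scope ring_scope.

Record int_partition := Partition {
  parts :> seq nat;
  partsP : sorted geq parts && (0%N \notin parts) }.

HB.instance Definition _ := [isSub for parts].
HB.instance Definition _ := [Countable of int_partition by <:].

Definition empty_partition : int_partition := @Partition [::] isT.

HB.instance Definition _ := isPointed.Build int_partition empty_partition.

(* The box (i, j) is the one in row i and column j, both counted from 0. *)
Definition young_diagram (l : int_partition) : seq (nat * nat) :=
  [seq (i, j) | i <- iota 0 (size l), j <- iota 0 (nth 0%N l i)].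

Definition hook (l : int_partition) (b : nat * nat) : seq (nat * nat) :=
  [seq c <- young_diagram l |
    ((c.1 == b.1) && (b.2 <= c.2)%N) || ((c.2 == b.2) && (b.1 <= c.1)%N)].

Definition hook_length (l : int_partition) (b : nat * nat) : nat :=
  size (hook l b).

Definition is_core (p : nat) (l : int_partition) : bool :=
  all (fun b => hook_length l b != p) (young_diagram l).

Definition simultaneous_cores (s t : nat) : set int_partition :=
  [set l | is_core s l /\ is_core t l].

Definition partition_size (l : int_partition) : nat := size (young_diagram l).

HB.instance Definition _ := @isMeasurable.Build default_measure_display
  int_partition (@discrete_measurable int_partition)
  (@discrete_measurable0 int_partition) (@discrete_measurableC int_partition)
  (@discrete_measurableU int_partition).

Lemma measurable_partition (A : set int_partition) : measurable A.
Proof. by []. Qed.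

(* Counting measure on A divided by its total mass.  [mnormalize] takes a
   fallback probability, here the Dirac mass at the empty partition, which is
   only used when A is empty or infinite. *)
Definition uniform_on (R : realType) (A : set int_partition) :
    probability int_partition R :=
  mnormalize (mrestr (@counting int_partition R) (measurable_partition A))
             (dirac empty_partition).

Lemma uniform_onE (R : realType) (A B : set int_partition) :
    finite_set A -> A !=set0 ->
  uniform_on R A B =
    ((#|` fset_set (B `&` A)|)%:R / (#|` fset_set A|)%:R)%:E.
Proof.
move=> finA [a Aa].
have A0 : (#|` fset_set A|)%:R != 0 :> R.
  rewrite pnatr_eq0 cardfs_eq0; apply/eqP => A0.
  by have := in_fset_set finA a; rewrite A0 inE mem_set.
have finBA : finite_set (B `&` A) by exact: finite_setIr.
have mE X : finite_set (X `&` A) ->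
    mrestr (@counting int_partition R) (measurable_partition A) X =
    (#|` fset_set (X `&` A)|)%:R%:E.
  by move=> finXA; rewrite /mrestr/= /counting asboolT.
rewrite /uniform_on /= /mnormalize/= mE ?setTI// orbF eqe (negbTE A0).
by rewrite mE// -EFinM.
Qed.

(* Uniformity is meant for coprime s and t, when there are finitely many
   cores; the empty partition is always one. *)
Definition random_core (R : realType) (s t : nat) : probability int_partition R :=
  uniform_on R (simultaneous_cores s t).

Definition scaled_size (R : realType) (s t : nat) (l : int_partition) : R :=
  (partition_size l)%:R / (s%:R * t%:R * (s%:R + t%:R) / 2).

Lemma measurable_scaled_size (R : realType) (s t : nat) :
  measurable_fun setT (scaled_size R s t).
Proof. by []. Qed.

HB.instance Definition _ (R : realType) (s t : nat) :=
  isMeasurableFun.Build _ _ int_partition R (scaled_size R s t)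
    (@measurable_scaled_size R s t).

Definition scaled_core_size (R : realType) (s t : nat) :
  {RV (random_core R s t) >-> R} := scaled_size R s t.

(* The variables X_ i may live on different probability spaces. *)
Definition cvg_in_distribution (R : realType) (I : Type) (F : set_system I)
    (d_ : I -> measure_display) (T_ : forall i, measurableType (d_ i))
    (P_ : forall i, probability (T_ i) R) (X_ : forall i, {RV (P_ i) >-> R})
    (d : measure_display) (T : measurableType d) (P : probability T R)
    (X : {RV P >-> R}) : Prop :=
  forall x : R, {for x, continuous (cdf X)} ->
    cdf (X_ i) x @[i --> F] --> cdf X x.

Definition mutually_independent (R : realType) (I : choiceType)
    (d : measure_display) (T : measurableType d) (P : probability T R)
    (X_ : I -> {RV P >-> R}) : Prop :=
  forall (J : {fset I}) (A_ : I -> set R), (forall i, measurable (A_ i)) ->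
    P (\bigcap_(i in [set` J]) X_ i @^-1` A_ i) =
    (\prod_(i <- J) P (X_ i @^-1` A_ i))%E.

Definition standard_normal (R : realType) (d : measure_display)
    (T : measurableType d) (P : probability T R) (X : {RV P >-> R}) : Prop :=
  forall A : set R, measurable A -> distribution P X A = normal_prob 0 1 A.

Section U_squared.
Context (R : realType) (d : measure_display) (T : measurableType d).
Context (P : probability T R).
Variables Z Zt : nat -> {RV P >-> R}.

(* Z k and Zt k stand for Z_(k+1) and \tilde Z_(k+1), whence k.+1. *)
Definition U_squared_term (k : nat) (w : T) : R :=
  ((Z k w) ^+ 2 + (Zt k w) ^+ 2) / (4 * pi ^+ 2 * k.+1%:R ^+ 2).

(* The sum of this nonnegative series, taken in \bar R.  For standard normal
   Z k and Zt k it has finite mean, so [fine] only alters it on a null set. *)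
Definition U_squared_fun (w : T) : R :=
  fine (\sum_(0 <= k <oo) (U_squared_term k w)%:E)%E.

Lemma measurable_U_squared_fun : measurable_fun setT U_squared_fun.
Proof.
apply: (measurableT_comp (@fine_measurable R _ measurableT)).
apply: (ge0_emeasurable_sum (P := xpredT)).
  move=> k w _ _; rewrite lee_fin /U_squared_term divr_ge0//.
    by rewrite addr_ge0// sqr_ge0.
  by rewrite !mulr_ge0 ?exprn_ge0 ?pi_ge0.
move=> k _; apply/measurable_EFinP; rewrite /U_squared_term.
apply: measurable_funM => //.
by apply: measurable_funD; apply: measurable_funX; exact: measurable_funPT.
Qed.

HB.instance Definition _ :=
  isMeasurableFun.Build _ _ T R U_squared_fun measurable_U_squared_fun.

Definition U_squared : {RV P >-> R} := U_squared_fun.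

End U_squared.

(* Main.v *)
Require Import Defs.
From HB Require Import structures.
From mathcomp Require Import all_boot all_order all_algebra perm finmap.
From mathcomp Require Import all_classical all_reals all_analysis measurable_realfun.
From mathcomp Require Import zify ring lra.

Set Implicit Arguments.
Unset Strict Implicit.
Unset Printing Implicit Defensive.

Import Order.TTheory GRing.Theory Num.Theory.
Import numFieldNormedType.Exports.

Local Open Scope classical_set_scope.
Local Open Scope ring_scope.

(* Walking through the largest beads of the residue classes modulo n = s + t of
   an (s,t)-core, with steps t and -s, encodes it as a cyclic word with s steps
   t and t steps -s; each core has exactly n words, and its size is an affine
   function of the empirical variance of the walk.  A uniform core is thus a
   uniform s-subset S of Z/n, and Parseval's identity turns the scaled size into
   a weighted sum over k of the power spectrum |S^(k)|^2, with weights
   proportional to 1/sin(pi k/n)^2.  The tail of this sum is small in mean.  For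
   the first K frequencies, exp(-m * quadratic form) is a Gaussian average of
   cosines of linear statistics of S, to which a central limit theorem proved
   by exchangeable pairs applies; this gives convergence of the Laplace
   transform at the integers m, and polynomials in exp(-u) approximate the
   indicators of half-lines. *)

(** * Simultaneous cores and cyclic words *)

(** No relation between [s] and [t] is available, so the error in the central limit theorem must be
    controlled by [n / (s t) = 1/s + 1/t] alone; this is [c ^+ 2] there, and the coefficients enter
    only through a bound on their size. The modulus [n = s + t] is natural because the bead set of
    an (s,t)-core is closed under subtracting [n], and because the steps [t] and [-s] agree modulo
    [n]: up to the starting point, all cores visit the residues in the same order. The limit is an
    infinite quadratic functional. The frequencies k and n - k carry equal power, which doubles each
    term, and the cosine and sine parts at frequency k correspond to Z_k and \tilde Z_k. The limit
    over pairs (s,t) is first taken along arbitrary sequences with [i < s_ i] and [i < t_ i], then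
    made uniform by contradiction. *)

Lemma partition_sorted (l : int_partition) : sorted geq l.
Proof. by case: l => l /= /andP[]. Qed.

Lemma partition_neq0 (l : int_partition) : 0%N \notin (l : seq nat).
Proof. by case: l => l /= /andP[]. Qed.

Lemma partition_nth_le (l : int_partition) i j :
  (i <= j)%N -> (nth 0%N l j <= nth 0%N l i)%N.
Proof.
move=> ij; case: (ltnP j (size l)) => [jl|lj]; last by rewrite (nth_default _ lj).
have geq_trans : transitive geq by move=> a b c /=; lia.
have geq_refl : reflexive geq by move=> a /=.
by have := sorted_leq_nth geq_trans geq_refl 0%N (partition_sorted l);
   apply=> //; rewrite inE; lia.
Qed.

Lemma partition_nth_gt0 (l : int_partition) i : (0 < nth 0%N l i)%N = (i < size l)%N.
Proof.
case: (ltnP i (size l)) => [il|li]; last by rewrite nth_default.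
rewrite lt0n; apply: contraNneq (partition_neq0 l) => <-; exact: mem_nth.
Qed.

Lemma partition_eqP (l1 l2 : int_partition) :
  (forall i, nth 0%N l1 i = nth 0%N l2 i) -> l1 = l2.
Proof.
move=> E; apply: val_inj; apply: (@eq_from_nth _ 0%N) => [|i _]; last exact: E.
have key i : (i < size l1)%N = (i < size l2)%N by rewrite -!partition_nth_gt0 E.
have := key (size l1); have := key (size l2); rewrite !ltnn.
by case: ltngtP.
Qed.

Lemma partition_sizeE (l : int_partition) :
  partition_size l = \sum_(0 <= i < size l) nth 0%N l i.
Proof.
rewrite /partition_size /young_diagram size_allpairs_dep sumnE big_map.
by rewrite /index_iota subn0; apply: eq_bigr => i _; rewrite size_iota.
Qed.

(** [count (ltn j) l] is the length of column [j], so both sides say that the box [(i, j)] lies in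
    the diagram. *)
Lemma ltn_count_partition (l : int_partition) i j :
  (i < count (ltn j) l)%N = (j < nth 0%N l i)%N.
Proof.
case: l => l /= /andP[+ _]; elim: l i => [|a l IH] i /=; first by rewrite nth_nil.
move=> al; have sl := path_sorted al.
have ha : all (fun b => (b <= a)%N) l.
  have geq_trans : transitive geq by move=> ? ? ? /=; lia.
  exact: order_path_min al.
case: (ltnP j a) => ja; case: i => [|i] /=; rewrite ?ja //.
  by rewrite add1n ltnS IH.
- suff -> : count (ltn j) l = 0%N by rewrite ltn0; lia.
  by apply/eqP; rewrite -leqn0 leqNgt -has_count; apply/hasPn => b bl /=;
     have := allP ha b bl; lia.
- rewrite add0n -IH //.
  suff -> : count (ltn j) l = 0%N by rewrite !ltn0.
  by apply/eqP; rewrite -leqn0 leqNgt -has_count; apply/hasPn => b bl /=;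
     have := allP ha b bl; lia.
Qed.

Lemma hook_lengthE (l : int_partition) i j : (j < nth 0%N l i)%N ->
  hook_length l (i, j) = (nth 0%N l i - j + (count (ltn j) l - i.+1))%N.
Proof.
move=> jli; have il : (i < size l)%N by rewrite -partition_nth_gt0; lia.
rewrite /hook_length /hook size_filter /young_diagram count_flatten.
rewrite -map_comp sumnE big_map.
(* [F a] is the number of hook boxes in row [a]: the box and its arm for [a = i], at most one box of
   column [j] in a lower row, none above. *)
pose F a := if a == i then (nth 0%N l i - j)%N else ((i < a) && (j < nth 0%N l a) : nat)%N.
rewrite (eq_bigr F) => [|a _]; last first.
  rewrite /= count_map /F.
  case: (eqVneq a i) => [->|ai].
    rewrite (eq_count (a2 := fun c => (j <= c)%N)); last first.
      by move=> c /=; rewrite eqxx /= leqnn andbT; case: (leqP j c) => //= cj;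
         apply/negbTE; rewrite neq_ltn cj.
    have -> : iota 0 (nth 0%N l i) = iota 0 j ++ iota j (nth 0%N l i - j).
      by rewrite -{2}(add0n j) -iotaD; congr iota; lia.
    rewrite count_cat (_ : count _ (iota 0 j) = 0%N) ?add0n; last first.
      apply/eqP; rewrite -leqn0 leqNgt -has_count; apply/hasPn => c.
      by rewrite mem_iota /=; lia.
    rewrite -[RHS](size_iota j); apply/eqP; rewrite -all_count; apply/allP => c.
    by rewrite mem_iota; lia.
  rewrite (eq_count (a2 := fun c => (i < a)%N && (c == j))); last first.
    by move=> c /=; lia.
  case: (i < a)%N => /=; last by rewrite count_pred0.
  by rewrite (count_uniq_mem _ (iota_uniq _ _)) mem_iota.
have -> : iota 0 (size l) = iota 0 i ++ i :: iota i.+1 (size l - i.+1).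
  have -> : iota 0 (size l) = iota 0 i ++ iota i (size l - i).
    by rewrite -{2}(add0n i) -iotaD; congr iota; lia.
  by have -> : (size l - i = (size l - i.+1).+1)%N by lia.
rewrite big_cat big_cons /= {2}/F eqxx big1_seq ?add0n; last first.
  move=> a /=; rewrite mem_iota add0n /F /= => ai.
  by rewrite ltn_eqF // ltnNge (ltnW ai).
congr addn.
have -> : count (ltn j) l = (i.+1 + count (ltn j) (drop i.+1 l))%N.
  rewrite -{1}(cat_take_drop i.+1 l) count_cat; congr addn.
  rewrite -[RHS](size_takel il); apply/eqP; rewrite -all_count; apply/allP => c.
  move=> /(nthP 0%N)[k]; rewrite size_takel // => ki <-; rewrite nth_take //=.
  by apply: leq_trans jli _; apply: partition_nth_le; lia.
rewrite addKn -sum1_count [RHS](big_nth 0%N) size_drop /index_iota subn0.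
have -> : iota i.+1 (size l - i.+1) = map (addn i.+1) (iota 0 (size l - i.+1)).
  by rewrite -iotaDl addn0.
rewrite [RHS]big_mkcond /= big_map; apply: eq_bigr => k _.
rewrite /F nth_drop addSn gtn_eqF ?ltnS ?leq_addr //=.
Qed.

(** The Maya diagram, normalised to charge zero: for the empty partition the beads are exactly the
    negative integers. *)
Definition bead (l : int_partition) (i : nat) : int := (nth 0%N l i)%:Z - i%:Z - 1.

Definition is_bead (l : int_partition) (x : int) : Prop := exists i, x = bead l i.

Lemma bead_lt (l : int_partition) i j : (i < j)%N -> bead l j < bead l i.
Proof.
move=> ij; rewrite /bead; have := partition_nth_le l (ltnW ij); lia.
Qed.

Lemma bead_inj (l : int_partition) : injective (bead l).
Proof.
move=> i j E; case: (ltngtP i j) => // /(bead_lt l); rewrite E ltxx //.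
Qed.

Lemma is_bead_small (l : int_partition) x : x < - (size l)%:Z -> is_bead l x.
Proof.
move=> xl; exists `|- x - 1|%N; rewrite /bead nth_default; lia.
Qed.

(** [bead l] is strictly decreasing, so [bead l i] is the largest bead once the first [i] are
    removed; strong induction recovers the parts. *)
Lemma is_bead_inj (l1 l2 : int_partition) :
  (forall x, is_bead l1 x <-> is_bead l2 x) -> l1 = l2.
Proof.
move=> E; apply: partition_eqP; elim/ltn_ind => i IH.
have le_bead a b : (forall x, is_bead a x -> is_bead b x) ->
    (forall m, (m < i)%N -> nth 0%N a m = nth 0%N b m) -> bead a i <= bead b i.
  move=> ab IHab; have [j ej] := ab _ (ex_intro _ i erefl).
  case: (ltnP j i) => [ji|ij].
    have : bead a i = bead a j by rewrite ej /bead IHab.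
    by move=> /bead_inj; lia.
  rewrite ej; case: (ltngtP i j) ij => // [ij _|-> _] //; exact: ltW (bead_lt b ij).
have := @le_bead l1 l2 (fun x => proj1 (E x)) IH.
have := @le_bead l2 l1 (fun x => proj2 (E x)) (fun m mi => esym (IH m mi)).
rewrite /bead; lia.
Qed.

(* Hook lengths are the differences [b - g > 0] between a bead [b] and a
   non-bead [g]: column [j] has the non-bead [j - count (ltn j) l]. *)
Lemma is_coreP (p : nat) (l : int_partition) : (0 < p)%N ->
  is_core p l <-> (forall x, is_bead l x -> is_bead l (x - p%:Z)).
Proof.
move=> p0; split; last first.
  move=> closed; apply/allP => -[i j] /allpairsPdep[a [b]].
  rewrite !mem_iota /= !add0n => -[ia jb [-> ->]] {i j}.
  apply/eqP; rewrite hook_lengthE //.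
  set k := count _ _ => hp.
  have ak : (a < k)%N by rewrite ltn_count_partition.
  have [i' /esym ei'] := closed _ (ex_intro _ a erefl).
  case: (ltnP i' k) (ltn_count_partition l i' b) => ik; rewrite ?ik.
    by move=> /esym/= h; move: ei'; rewrite /bead; lia.
  by move=> /esym h; move: ei'; rewrite /bead; lia.
move=> /allP core x [i ->{x}]; apply: contrapT => nb; set x := bead l i - p%:Z in nb.
have Pex : exists k, bead l k < x.
  exists (size l + `|x|)%N; rewrite /bead nth_default; lia.
pose k := ex_minn Pex.
have [bk kmin] : bead l k < x /\ forall m, bead l m < x -> (k <= m)%N.
  by rewrite /k; case: ex_minnP.
have ik : (i < k)%N.
  rewrite ltnNge; apply/negP; rewrite leq_eqVlt => /predU1P[ki|/(bead_lt l)].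
    by move: bk; rewrite ki /x; lia.
  by move: bk; rewrite /x; lia.
have bk' : x < bead l k.-1.
  rewrite ltNge; apply/negP; rewrite le_eqVlt => /predU1P[e|/kmin]; last lia.
  by apply: nb; exists k.-1.
(* Exactly [k] beads lie above the gap [x], which is therefore the gap of column [j = x + k]; this
   is nonnegative because [bead l k < x]. *)
pose j := `|(x + k%:Z : int)%R|%N.
have jE : j%:Z = x + k%:Z by move: bk; rewrite /j /bead; lia.
have jl m : (j < nth 0%N l m)%N = (m < k)%N.
  case: (ltnP m k) => mk.
    have := @partition_nth_le l m k.-1; move: bk'; rewrite /bead; lia.
  have := @partition_nth_le l k m mk; move: bk; rewrite /bead; lia.
have ck : count (ltn j) l = k.
  have key m : (m < count (ltn j) l)%N = (m < k)%N by rewrite ltn_count_partition jl.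
  by have := key k; have := key (count (ltn j) l); rewrite !ltnn; lia.
have : (i, j) \in young_diagram l.
  apply/allpairsPdep; exists i, j; split => //; rewrite mem_iota /= add0n.
    by rewrite -partition_nth_gt0; have := jl i; rewrite ik; lia.
  by rewrite jl.
move=> /core /eqP; apply; rewrite hook_lengthE ?jl // ck.
have := jl i; rewrite ik; move: jE; rewrite /x /bead; lia.
Qed.

Lemma nth_filter_gt0 (s : seq nat) i : sorted geq s ->
  nth 0%N [seq a <- s | (0 < a)%N] i = nth 0%N s i.
Proof.
elim: s i => [|a s IH] i //= as_; have ss := path_sorted as_.
have ha : all (fun b => (b <= a)%N) s.
  have geq_trans : transitive geq by move=> ? ? ? /=; lia.
  exact: order_path_min as_.
case: (posnP a) => [a0|a0] /=; last by case: i => [|i] //=; exact: IH.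
have s0 b : b \in s -> b = 0%N by move=> /(allP ha); rewrite a0 leqn0 => /eqP.
have -> : [seq b <- s | (0 < b)%N] = [::].
  by apply/eqP; rewrite -size_eq0 size_filter -leqn0 leqNgt -has_count;
     apply/hasPn => b /s0 ->.
rewrite nth_nil a0; case: i => [|i] //=; case: (ltnP i (size s)) => is_.
  by rewrite [RHS]s0 // mem_nth.
by rewrite nth_default.
Qed.

(** Shifting by [size Y] gives charge zero: as many beads at nonnegative positions as gaps at
    negative ones. *)
Lemma partition_of_beads (Y : seq nat) : sorted ltn Y ->
  exists l : int_partition, forall x : int, is_bead l x <->
    x < - (size Y)%:Z \/ exists2 y, y \in Y & x = y%:Z - (size Y)%:Z.
Proof.
move=> sY; set L := size Y.
(* A part is the number of gaps below its bead: the entry of [Y] with [L - i.+1] entries below it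
   has that many fewer gaps than its value. Zero parts are filtered out afterwards. *)
pose f i := if (i < L)%N then (nth 0%N Y (L - i.+1) - (L - i.+1))%N else 0%N.
have nthY k m : (k < L)%N -> (k + m < L)%N -> (nth 0%N Y k + m <= nth 0%N Y (k + m))%N.
  elim: m => [|m IH] kL kmL; first by rewrite !addn0.
  have step : (nth 0%N Y (k + m) < nth 0%N Y (k + m).+1)%N.
    by apply: (sorted_ltn_nth ltn_trans 0%N sY); rewrite ?inE -/L; lia.
  have := IH kL; move: step kmL; rewrite addnS; lia.
have geY k : (k < L)%N -> (k <= nth 0%N Y k)%N.
  by move=> kL; have := nthY 0%N k; rewrite add0n; lia.
have f_le i j : (i <= j)%N -> (f j <= f i)%N.
  rewrite /f => ij; case: (ltnP j L) => jL //; rewrite (leq_ltn_trans ij jL).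
  have e : (L - i.+1 = (L - j.+1) + (j - i))%N by lia.
  by have := nthY (L - j.+1)%N (j - i)%N; rewrite -e; lia.
have geq_trans : transitive geq by move=> ? ? ? /=; lia.
have sf : sorted geq [seq f i | i <- iota 0 L].
  rewrite sorted_map; apply: (sub_sorted _ (iota_ltn_sorted 0 L)) => i j /= /ltnW.
  exact: f_le.
pose s := [seq a <- [seq f i | i <- iota 0 L] | (0 < a)%N].
have sP : sorted geq s && (0%N \notin s).
  by rewrite sorted_filter //= mem_filter.
have lE i : nth 0%N (Partition sP) i = f i.
  rewrite /= nth_filter_gt0 //; case: (ltnP i L) => iL.
    by rewrite (nth_map 0%N) ?size_iota // nth_iota.
  by rewrite nth_default ?size_map ?size_iota // /f ltnNge iL.
exists (Partition sP) => x; split.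
  move=> [i ->]; rewrite /bead lE /f; case: (ltnP i L) => iL; last by left; lia.
  right; exists (nth 0%N Y (L - i.+1)); first by rewrite mem_nth // -/L; lia.
  by have := geY (L - i.+1)%N; lia.
move=> [xL|[y yY ->]].
  exists `|- x - 1|%N; rewrite /bead lE /f; case: ltnP => //; lia.
have iL : (index y Y < L)%N by rewrite index_mem.
exists (L - (index y Y).+1)%N; rewrite /bead lE /f.
have -> : (L - (index y Y).+1 < L)%N by lia.
have -> : (L - (L - (index y Y).+1).+1 = index y Y)%N by lia.
rewrite nth_index //; have := geY _ iL; rewrite nth_index //; lia.
Qed.

(** * Abacus with [n] runners, each filled without gaps below its top bead [H j] *)

Definition bead_columns (n : nat) (H : nat -> int) (x : int) : Prop :=
  exists j k : nat, (j < n)%N /\ x = H j - (k * n)%:Z.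

Definition distinct_mod (n : nat) (H : nat -> int) : Prop :=
  forall i j, (i < n)%N -> (j < n)%N -> (n%:Z %| H i - H j)%Z -> i = j.

Section Columns.
Variables (n : nat) (H : nat -> int).
Hypotheses (n0 : (0 < n)%N) (Hinj : distinct_mod n H).

Let a j := (H j %/ n%:Z)%Z.
Let r j := `|(H j %% n%:Z)%Z|%N.

Lemma columnE j : H j = a j * n%:Z + (r j)%:Z.
Proof. by rewrite /r gez0_abs ?modz_ge0 -?divz_eq //; lia. Qed.

Lemma column_mod_lt j : (r j < n)%N.
Proof. by have := @ltz_pmod (H j) n%:Z; have := @modz_ge0 (H j) n%:Z; rewrite /r; lia. Qed.

Lemma perm_column_mod : perm_eq [seq r j | j <- iota 0 n] (iota 0 n).
Proof.
have u : uniq [seq r j | j <- iota 0 n].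
  rewrite map_inj_in_uniq ?iota_uniq // => i j; rewrite !mem_iota !add0n /= => il jl rE.
  apply: Hinj => //; rewrite (columnE i) (columnE j) rE.
  by apply/dvdzP; exists (a i - a j); ring.
have sub : {subset [seq r j | j <- iota 0 n] <= iota 0 n}.
  by move=> x /mapP[j _ ->]; rewrite mem_iota add0n /= column_mod_lt.
have [//|_ e] := uniq_min_size u sub; first by rewrite size_map.
by apply: uniq_perm => //; exact: iota_uniq.
Qed.

(** Cutting all runners at the common level [- n * M] leaves [a j + 1 + M] beads on runner [j], and
    [M] makes this count nonnegative. The free lower bound [N] lets the cut also pass below all rows
    of a given partition. *)
Lemma exists_column_bound (N : nat) :
  exists M : nat, (N <= M)%N /\ forall j, (j < n)%N -> 0 <= a j + 1 + M%:Z.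
Proof.
exists (N + \max_(j < n) `|a j|%N)%N; split=> [|j jn]; first exact: leq_addr.
have := @leq_bigmax _ (fun j : 'I_n => `|a j|%N) (Ordinal jn); rewrite /=; lia.
Qed.

Variable M : nat.
Hypothesis hM : forall j, (j < n)%N -> 0 <= a j + 1 + M%:Z.

Let K j := `|(a j + 1 + M%:Z)%R|%N.

Definition truncated_columns : seq int :=
  [seq H j - (k * n)%:Z | j <- iota 0 n, k <- iota 0 (K j)].

Lemma mem_truncated_columns x :
  x \in truncated_columns <-> bead_columns n H x /\ - (n * M)%:Z <= x.
Proof.
split.
  move=> /allpairsPdep[j [k]]; rewrite !mem_iota !add0n /= => -[jn kK ->].
  split; first by exists j, k.
  rewrite columnE; have h : 0 <= a j - k%:Z + M%:Z by have := hM jn; rewrite /K in kK; lia.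
  have := mulr_ge0 h (ltac:(lia) : 0 <= n%:Z); rewrite !PoszM; lia.
move=> [[j [k [jn ->]]] h]; apply/allpairsPdep; exists j, k.
rewrite !mem_iota !add0n /=; split => //; rewrite /K.
have hMj := hM jn; suff : 0 <= a j - k%:Z + M%:Z by lia.
rewrite leNgt; apply/negP => neg.
have neg1 : a j - k%:Z + M%:Z + 1 <= 0 by lia.
have := mulr_le0_ge0 neg1 (ltac:(lia) : 0 <= n%:Z).
move: h; rewrite columnE !PoszM; have := column_mod_lt j; lia.
Qed.

Lemma uniq_truncated_columns : uniq truncated_columns.
Proof.
apply: allpairs_uniq_dep => [|j _|]; rewrite ?iota_uniq //.
move=> [? k] [? k'] /allpairsPdep[j [? [+ _ [-> _]]]] /allpairsPdep[j' [? [+ _ [-> _]]]] /=.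
rewrite !mem_iota !add0n /= => jn jn' E.
have jj : j = j'.
  apply: Hinj => //; apply/dvdzP; exists (k%:Z - k'%:Z); move: E; rewrite !PoszM => E.
  have -> : H j - H j' = k%:Z * n%:Z - k'%:Z * n%:Z by move: E; lia.
  ring.
rewrite jj in E *; congr existT; apply/eqP; rewrite -(eqn_pmul2r n0); apply/eqP; lia.
Qed.

Lemma sum_column_mod : 2 * (\sum_(0 <= j < n) (r j)%:Z) = n%:Z * (n%:Z - 1).
Proof.
have -> : \sum_(0 <= j < n) (r j)%:Z = \sum_(0 <= j < n) j%:Z.
  rewrite /index_iota subn0 -(big_map r xpredT (fun i => i%:Z)).
  exact: perm_big perm_column_mod.
elim: n => [|m IH]; first by rewrite big_geq // mul0r.
by rewrite big_nat_recr //= mulrDr IH; lia.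
Qed.

Lemma sum_column_mod_sqr :
  6 * (\sum_(0 <= j < n) (r j)%:Z ^+ 2) = n%:Z * (n%:Z - 1) * (2 * n%:Z - 1).
Proof.
have -> : \sum_(0 <= j < n) (r j)%:Z ^+ 2 = \sum_(0 <= j < n) j%:Z ^+ 2.
  rewrite /index_iota subn0 -(big_map r xpredT (fun i => i%:Z ^+ 2)).
  exact: perm_big perm_column_mod.
elim: n => [|m IH]; first by rewrite big_geq // !mul0r.
by rewrite big_nat_recr //= mulrDr IH -natr1; ring.
Qed.

Lemma size_truncated_columns : (size truncated_columns)%:Z =
  \sum_(0 <= j < n) (a j + 1) + n%:Z * M%:Z.
Proof.
rewrite size_allpairs_dep sumnE big_map.
have -> : n%:Z * M%:Z = \sum_(0 <= j < n) M%:Z.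
  by rewrite sumr_const_nat subn0 -mulr_natl; congr (_ * _); lia.
rewrite -big_split /= /index_iota subn0.
rewrite (big_morph Posz PoszD erefl); apply: eq_big_seq => j.
by rewrite mem_iota add0n /= => jn; rewrite size_iota /K; have := hM jn; lia.
Qed.

Lemma sum_truncated_columns : 2 * (\sum_(x <- truncated_columns) x) =
  \sum_(0 <= j < n) (2 * (a j + 1 + M%:Z) * H j -
     n%:Z * (a j + 1 + M%:Z) * (a j + M%:Z)).
Proof.
rewrite /truncated_columns big_allpairs_dep mulr_sumr /index_iota subn0.
apply: eq_big_seq => j; rewrite mem_iota add0n /= => jn.
have -> : a j + M%:Z = a j + 1 + M%:Z - 1 by ring.
have -> : a j + 1 + M%:Z = (K j)%:Z by rewrite /K; have := hM jn; lia.
elim: (K j) => [|k IH]; first by rewrite big_nil !(mulr0, mul0r) subr0.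
by rewrite -(addn1 k) iotaD big_cat /= big_seq1 mulrDr IH !PoszD PoszM; ring.
Qed.

End Columns.

(** The beads above the cut [- n * M] are those of the first [n * M] rows. Comparing their number
    and their sum, computed by rows and by runners, gives the two identities. *)
Lemma column_sums (l : int_partition) (n : nat) (H : nat -> int) :
    (0 < n)%N -> distinct_mod n H ->
    (forall x, is_bead l x <-> bead_columns n H x) ->
  2 * (\sum_(0 <= j < n) H j) = - (n%:Z * (n%:Z + 1)) /\
  12 * n%:Z * (partition_size l)%:Z =
    6 * (\sum_(0 <= j < n) H j ^+ 2) - n%:Z * (n%:Z + 1) * (2 * n%:Z + 1).
Proof.
move=> n0 Hinj Hl.
have [M [lM hM]] := exists_column_bound H n0 (size l).
pose a j := (H j %/ n%:Z)%Z; pose r j := `|(H j %% n%:Z)%Z|%N.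
have HE j : H j = a j * n%:Z + (r j)%:Z by exact: columnE.
pose L := (n * M)%N.
have lL : (size l <= L)%N by rewrite /L; nia.
pose b := [seq bead l i | i <- iota 0 L].
have ub : uniq b by rewrite map_inj_uniq ?iota_uniq //; exact: bead_inj.
have pE : perm_eq b (truncated_columns n H M).
  apply: uniq_perm => //; first exact: uniq_truncated_columns.
  move=> x; apply/idP/idP.
    move=> /mapP[i]; rewrite mem_iota add0n /= => iL ->.
    apply/mem_truncated_columns => //; split; first by apply/Hl; exists i.
    by rewrite /bead -/L; lia.
  move=> /(mem_truncated_columns n0 hM)[/Hl[i ->] h].
  apply/mapP; exists i => //; rewrite mem_iota add0n /= ltnNge; apply/negP => Li.
  by move: h; rewrite /bead nth_default ?(leq_trans lL) // -/L; lia.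
have sE : (L%:Z = \sum_(0 <= j < n) (a j + 1) + n%:Z * M%:Z).
  by rewrite -(size_truncated_columns n0 hM) -(perm_size pE) size_map size_iota.
(* Charge zero: exactly [L = n * M] beads lie above the cut, so the runners' deviations from [M]
   cancel. *)
have sb0 : \sum_(0 <= j < n) (a j + 1) = 0 by move: sE; rewrite /L; lia.
have sumb : 2 * (\sum_(x <- b) x) = 2 * (partition_size l)%:Z - L%:Z * (L%:Z + 1).
  rewrite big_map partition_sizeE.
  have -> : (\sum_(0 <= i < size l) nth 0%N l i = \sum_(0 <= i < L) nth 0%N l i)%N.
    rewrite [RHS](big_cat_nat (n := size l)) //= [X in (_ + X)%N]big_nat_cond.
    rewrite [X in (_ + X)%N]big1 ?addn0 // => i /andP[/andP[li _] _].
    exact: nth_default.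
  rewrite (big_morph Posz PoszD erefl) /index_iota subn0.
  elim: L {lL b ub pE sE} => [|L IH]; first by rewrite !big_nil.
  rewrite -(addn1 L) iotaD !big_cat !big_seq1 /= add0n !mulrDr IH /bead !PoszD; ring.
have := sum_truncated_columns n0 hM.
rewrite -(perm_big _ pE) /= sumb.
have sr := sum_column_mod n0 Hinj; have srr := sum_column_mod_sqr n0 Hinj.
rewrite -/(a _) in sr srr *.
pose B := \sum_(0 <= j < n) (a j + 1); pose BB := \sum_(0 <= j < n) (a j + 1) ^+ 2.
pose Br := \sum_(0 <= j < n) (a j + 1) * (r j)%:Z.
pose Rr := \sum_(0 <= j < n) (r j)%:Z; pose RR := \sum_(0 <= j < n) (r j)%:Z ^+ 2.
have cst (x : int) : n%:Z * x = \sum_(0 <= j < n) x.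
  by rewrite sumr_const_nat subn0 -mulr_natl; congr (_ * _); lia.
have -> : \sum_(0 <= j < n) (2 * (a j + 1 + M%:Z) * H j -
     n%:Z * (a j + 1 + M%:Z) * (a j + M%:Z)) =
    n%:Z * BB - n%:Z * (n%:Z * (M%:Z ^+ 2 + M%:Z)) - n%:Z * B + 2 * Br + 2 * M%:Z * Rr.
  rewrite (cst (n%:Z * _)) /BB /B /Br /Rr !mulr_sumr -!sumrB -!big_split /=.
  by apply: eq_bigr => j _; rewrite HE; ring.
have -> : \sum_(0 <= j < n) H j = n%:Z * B - n%:Z * n%:Z + Rr.
  rewrite (cst n%:Z) /B /Rr !mulr_sumr -!sumrB -!big_split /=.
  by apply: eq_bigr => j _; rewrite HE; ring.
have -> : \sum_(0 <= j < n) H j ^+ 2 = n%:Z ^+ 2 * BB - 2 * n%:Z ^+ 2 * B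
    + n%:Z * n%:Z ^+ 2 + 2 * n%:Z * Br - 2 * n%:Z * Rr + RR.
  rewrite (cst (n%:Z ^+ 2)) /BB /B /Br /Rr /RR !mulr_sumr -!sumrB -!big_split /=.
  rewrite -!sumrB -!big_split /=.
  by apply: eq_bigr => j _; rewrite HE; ring.
have {}sb0 : B = 0 by [].
have {}sr : 2 * Rr = n%:Z * (n%:Z - 1) by [].
have {}srr : 6 * RR = n%:Z * (n%:Z - 1) * (2 * n%:Z - 1) by [].
rewrite sb0 mulr0 /L PoszM => key; split.
  by rewrite mulrDr sr; ring.
have key2 : 2 * (partition_size l)%:Z = n%:Z * BB + 2 * Br.
  have : 2 * M%:Z * Rr = M%:Z * (n%:Z * (n%:Z - 1)) by rewrite -sr; ring.
  move=> e; rewrite e in key.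
  have -> : 2 * (partition_size l)%:Z = (2 * (partition_size l)%:Z -
    n%:Z * M%:Z * (n%:Z * M%:Z + 1)) + n%:Z * M%:Z * (n%:Z * M%:Z + 1) by ring.
  by rewrite key; ring.
have -> : 12 * n%:Z * (partition_size l)%:Z = 6 * n%:Z * (2 * (partition_size l)%:Z).
  by ring.
rewrite key2 mulr0 !mulrDr srr.
have -> : 6 * - (2 * n%:Z * Rr) = - (6 * n%:Z * (2 * Rr)) by ring.
by rewrite sr; ring.
Qed.

(** The condition on the sum of [H] is exactly charge zero. It makes the number of beads above the
    cut equal to [L], the shift required by [partition_of_beads]. *)
Lemma exists_column_partition (n : nat) (H : nat -> int) :
    (0 < n)%N -> distinct_mod n H ->
    2 * (\sum_(0 <= j < n) H j) = - (n%:Z * (n%:Z + 1)) ->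
  exists l, forall x, is_bead l x <-> bead_columns n H x.
Proof.
move=> n0 Hinj sH.
have [M [_ hM]] := exists_column_bound H n0 0.
pose a j := (H j %/ n%:Z)%Z; pose r j := `|(H j %% n%:Z)%Z|%N.
have HE j : H j = a j * n%:Z + (r j)%:Z by exact: columnE.
pose L := (n * M)%N.
pose E := truncated_columns n H M.
have ltE x : x \in E -> 0 <= x + L%:Z by move=> /(mem_truncated_columns n0 hM)[_]; lia.
have sE : size E = L.
  have := size_truncated_columns n0 hM; rewrite -/E -/(a _).
  suff -> : \sum_(0 <= j < n) (a j + 1) = 0 by rewrite add0r /L -PoszM => -[].
  have cst (x : int) : n%:Z * x = \sum_(0 <= j < n) x.
    by rewrite sumr_const_nat subn0 -mulr_natl; congr (_ * _); lia.
  have h : 2 * (\sum_(0 <= j < n) H j) = n%:Z * (2 * (\sum_(0 <= j < n) (a j + 1)) - 2 * n%:Z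
      + (n%:Z - 1)).
    rewrite mulrDr -(sum_column_mod n0 Hinj) mulrBr [n%:Z * (2 * n%:Z)]mulrCA (cst n%:Z).
    rewrite mulrCA (mulr_sumr _ _ _ n%:Z) -!mulrBr -mulrDr; congr (_ * _).
    rewrite -sumrB -big_split /=; apply: eq_bigr => j _; rewrite {1}HE -/(r _); ring.
  have nz : n%:Z != 0 by lia.
  have : n%:Z * (2 * (\sum_(0 <= j < n) (a j + 1)) - 2 * n%:Z + (n%:Z - 1)) =
      n%:Z * (- (n%:Z + 1)) by rewrite -h sH; ring.
  by move=> /(mulfI nz); lia.
pose Y := sort leq [seq `|(x + L%:Z)%R|%N | x <- E].
have sY : sorted ltn Y.
  rewrite ltn_sorted_uniq_leq sort_uniq sort_sorted ?andbT; last exact: leq_total.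
  rewrite map_inj_in_uniq ?uniq_truncated_columns // => x y xE yE.
  by have := ltE x xE; have := ltE y yE; lia.
have szY : size Y = L by rewrite size_sort size_map.
have [l hl] := partition_of_beads sY.
exists l => x; rewrite hl szY; split.
  move=> [xL|[y + ->]].
    (* Every position below the cut is a bead: the residue of [x] belongs to some runner [j], and
       the choice of [M] puts the top of that runner no lower than [x]. *)
    have : (x %% n%:Z)%Z \in [seq (z%:Z) | z <- [seq r j | j <- iota 0 n]].
      apply/mapP; exists `|(x %% n%:Z)%Z|%N; last first.
        by rewrite gez0_abs // modz_ge0; lia.
      rewrite (perm_mem (perm_column_mod n0 Hinj)) mem_iota add0n /=.
      by have := @ltz_pmod x n%:Z; have := @modz_ge0 x n%:Z; lia.
    rewrite -map_comp => /mapP[j]; rewrite mem_iota add0n /= => jn xj.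
    have := divz_eq x n%:Z; rewrite xj => xE.
    exists j, `|(a j - (x %/ n%:Z)%Z)%R|%N; split => //.
    rewrite PoszM gez0_abs; first by rewrite HE {1}xE; ring.
    have := hM _ jn; rewrite -/(a _) => aM.
    rewrite leNgt; apply/negP => neg.
    have h1 : 0 <= (x %/ n%:Z)%Z + M%:Z by lia.
    have := mulr_ge0 h1 (ltac:(lia) : 0 <= n%:Z).
    by move: xL xE; rewrite /L PoszM; lia.
  rewrite mem_sort => /mapP[z zE ->].
  have /(mem_truncated_columns n0 hM)[zc _] := zE.
  by have := ltE z zE => ?; rewrite gez0_abs // addrK.
move=> xc; case: (ltP x (- L%:Z)) => xL; first by left.
right; exists `|(x + L%:Z)%R|%N; last by lia.
rewrite mem_sort; apply/mapP; exists x => //; exact/(mem_truncated_columns n0 hM).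
Qed.

(** * Closed walks through the top beads of [s + t] runners *)

Section Words.
Variables s t : nat.
Hypotheses (s0 : (0 < s)%N) (t0 : (0 < t)%N) (cop : coprime s t).
Local Notation n := (s + t)%N.
Implicit Type S : {set 'I_(s + t)}.

Definition height S (j : nat) : int :=
  n%:Z * #|[set i in S | (i < j)%N]|%:Z - s%:Z * j%:Z.

Lemma height0 S : height S 0 = 0.
Proof.
rewrite /height mulr0 subr0 (_ : [set i in S | _] = finset.set0) ?cards0 ?mulr0 //.
by apply/setP => i; rewrite !inE ltn0 andbF.
Qed.

Lemma height_end S : #|S| = s -> height S n = 0.
Proof.
move=> cS; rewrite /height (_ : [set i in S | _] = S) ?cS; first by lia.
by apply/setP => i; rewrite !inE ltn_ord andbT.
Qed.

Lemma heightS S (j : 'I_(s + t)) :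
  height S j.+1 = height S j + (if j \in S then t%:Z else - s%:Z).
Proof.
rewrite /height.
have -> : #|[set i in S | (i < j.+1)%N]| = ((j \in S) + #|[set i in S | (i < j)%N]|)%N.
  rewrite (cardsD1 j) !inE ltnSn andbT; congr (_ + #|pred_of_set _|)%N.
  apply/setP => i; rewrite !inE ltnS [in RHS]ltn_neqAle andbCA; congr (_ && _).
by case: (j \in S) => /=; lia.
Qed.

(** Since [-s = t - n], both steps are congruent to [t] modulo [n]: the residue reached at time [j]
    does not depend on [S]. As [t] is prime to [n], the walk meets each residue once. *)
Lemma height_mod S j : (n%:Z %| height S j - t%:Z * j%:Z)%Z.
Proof. by apply/dvdzP; exists (#|[set i in S | (i < j)%N]|%:Z - j%:Z); rewrite /height; lia. Qed.

Lemma dvdz_mul_coprime (a : int) : (n%:Z %| t%:Z * a)%Z = (n%:Z %| a)%Z.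
Proof. by apply: Gauss_dvdzr; rewrite coprimezE /= /coprime gcdnC gcdnDr gcdnC. Qed.

Lemma distinct_mod_height S c : distinct_mod n (fun j => c + height S j).
Proof.
move=> i j ilt jlt d.
have : (n%:Z %| t%:Z * (i%:Z - j%:Z))%Z.
  have -> : t%:Z * (i%:Z - j%:Z) = (c + height S i - (c + height S j)) -
     ((height S i - t%:Z * i%:Z) - (height S j - t%:Z * j%:Z)) by ring.
  by rewrite rpredB // rpredB // height_mod.
rewrite dvdz_mul_coprime => /dvdzP[q] E.
have [q0|[q1|q1]] : q = 0 \/ (1 <= q \/ q <= -1) by lia.
- by move: E; rewrite q0 mul0r; lia.
- have : 0 <= (q - 1) * n%:Z by rewrite mulr_ge0 //; lia.
  by move: E ilt jlt; clear; lia.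
- have : 0 <= (- q - 1) * n%:Z by rewrite mulr_ge0 //; lia.
  by move: E ilt jlt; clear; lia.
Qed.


(** Subtracting [s] leads from the top bead at time [j] to the runner at time [j + 1]: to its top
    after a step [-s], to one bead below its top after a step [t]. Subtracting [t] leads to the
    runner at time [j - 1] in the same way; the ends wrap around because the walk is closed. *)
Lemma bead_columns_closed S c x : #|S| = s ->
  bead_columns n (fun j => c + height S j) x ->
  bead_columns n (fun j => c + height S j) (x - s%:Z) /\
  bead_columns n (fun j => c + height S j) (x - t%:Z).
Proof.
move=> cS [j [k [jn ->]]].
have hn := height_end cS; have h0 := height0 S.
split.
  have := heightS S (Ordinal jn); rewrite /=; case: ifP => _ step.
    case: (ltnP j.+1 n) => jn1; first by exists j.+1, k.+1; split=> //; lia.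
    have jE : j.+1 = n by lia.
    by exists 0%N, k.+1; split; [lia|rewrite h0; rewrite jE hn in step; lia].
  case: (ltnP j.+1 n) => jn1; first by exists j.+1, k; split=> //; lia.
  have jE : j.+1 = n by lia.
  by exists 0%N, k; split; [lia|rewrite h0; rewrite jE hn in step; lia].
have [i [iN iE]] : exists i, (i < n)%N /\ height S i.+1 = height S j.
  case: j jn => [|j] jn; last by exists j; split=> //; lia.
  exists n.-1; split; first lia.
  by rewrite prednK // hn h0.
have := heightS S (Ordinal iN); rewrite /=; case: ifP => _ step.
  by exists i, k; split=> //; lia.
by exists i, k.+1; split=> //; lia.
Qed.

(** Charge zero is a linear equation for [c], solvable in integers exactly when
    [s (n - 1) - (n + 1)] is even. This is clear for odd [n]; for even [n], coprimality makes [s]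
    odd. *)
Lemma exists_word_shift S : #|S| = s ->
  exists c : int, 2 * (\sum_(0 <= j < n) (c + height S j)) = - (n%:Z * (n%:Z + 1)).
Proof.
move=> cS.
have [e eE] : exists e : int, s%:Z * (n%:Z - 1) - (n%:Z + 1) = 2 * e.
  have [on|en] := boolP (odd n).
    exists ((s%:Z - 1) * (n./2)%:Z - 1); have := odd_double_half n; rewrite on => /esym.
    move: (n./2) => m ->; lia.
  have os : odd s.
    apply/negPn/negP => es; move: en; rewrite oddD (negbTE es) /= => et.
    have : (2 %| gcdn s t)%N by rewrite dvdn_gcd !dvdn2 es et.
    by rewrite (eqP cop).
  exists ((s./2)%:Z * (n%:Z - 1) - 1); have := odd_double_half s; rewrite os => /esym e.
  by rewrite {1}e; lia.
exists (e - \sum_(0 <= j < n) #|[set i in S | (i < j)%N]|%:Z).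
have cst (x : int) : \sum_(0 <= j < n) x = n%:Z * x.
  by rewrite sumr_const_nat subn0 -mulr_natl; congr (_ * _); lia.
rewrite big_split /= cst /height sumrB -!mulr_sumr.
have sj m : 2 * (\sum_(0 <= j < m) j%:Z) = m%:Z * (m%:Z - 1).
  elim: m => [|m IH]; first by rewrite big_geq // mul0r.
  by rewrite big_nat_recr //= mulrDr IH; lia.
have := sj n; move: (\sum_(0 <= j < n) j%:Z) => J JE.
move: (\sum_(0 <= j < n) #|_|%:Z) => C.
have -> : 2 * (n%:Z * (e - C) + (n%:Z * C - s%:Z * J)) =
  n%:Z * (2 * e) - s%:Z * (2 * J) by ring.
by rewrite JE -eE; ring.
Qed.

Definition encodes S (l : int_partition) (c : int) : Prop :=
  forall x, is_bead l x <-> bead_columns n (fun j => c + height S j) x.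

Lemma encodes_shift S l c : encodes S l c ->
  2 * (\sum_(0 <= j < n) (c + height S j)) = - (n%:Z * (n%:Z + 1)).
Proof.
have n0 : (0 < n)%N by lia.
by move=> E; have [] := column_sums n0 (distinct_mod_height (S := S) (c := c)) E.
Qed.

Lemma encodes_shift_inj S l c c' l' : encodes S l c -> encodes S l' c' -> c = c'.
Proof.
move=> /encodes_shift e /encodes_shift; rewrite -e => /eqP.
rewrite -subr_eq0 -mulrBr -sumrB (eq_bigr (fun=> c' - c)); last by move=> j _; ring.
rewrite sumr_const_nat subn0 !mulf_eq0 /= mulrn_eq0; lia.
Qed.

(** Charge zero fixes [n * c + \sum height], so completing the square eliminates [c]; what is left
    of the second moment is the variance of the heights. *)
Lemma encodes_size S l c : encodes S l c ->
  24 * n%:Z ^+ 2 * (partition_size l)%:Z =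
  12 * (n%:Z * (\sum_(0 <= j < n) height S j ^+ 2) - (\sum_(0 <= j < n) height S j) ^+ 2)
  - n%:Z ^+ 2 * (n%:Z ^+ 2 - 1).
Proof.
have n0 : (0 < n)%N by lia.
move=> E; have [] := column_sums n0 (distinct_mod_height (S := S) (c := c)) E.
have cst (x : int) : \sum_(0 <= j < n) x = n%:Z * x.
  by rewrite sumr_const_nat subn0 -mulr_natl; congr (_ * _); lia.
rewrite big_split /= cst.
have -> : \sum_(0 <= j < n) (c + height S j) ^+ 2 = n%:Z * c ^+ 2 +
    2 * c * (\sum_(0 <= j < n) height S j) + \sum_(0 <= j < n) height S j ^+ 2.
  rewrite -cst mulr_sumr -!big_split /=; apply: eq_bigr => j _; ring.
move: (\sum_(0 <= j < n) height S j) (\sum_(0 <= j < n) height S j ^+ 2) => A B eA eB.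
have -> : 24 * n%:Z ^+ 2 * (partition_size l)%:Z =
  2 * n%:Z * (12 * n%:Z * (partition_size l)%:Z) by ring.
rewrite eB.
have -> : 2 * n%:Z * (6 * (n%:Z * c ^+ 2 + 2 * c * A + B) - n%:Z * (n%:Z + 1) * (2 * n%:Z + 1)) =
  12 * (n%:Z * B - A ^+ 2) + 3 * (2 * (n%:Z * c + A)) ^+ 2 -
  2 * n%:Z * (n%:Z * (n%:Z + 1) * (2 * n%:Z + 1)) by ring.
by rewrite eA; ring.
Qed.

Lemma encodes_core S l c : #|S| = s -> encodes S l c -> simultaneous_cores s t l.
Proof.
by move=> cS E; split; apply/is_coreP => // x /E /(bead_columns_closed cS)[h1 h2]; apply/E.
Qed.

Lemma exists_encoding S : #|S| = s -> exists l c, encodes S l c.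
Proof.
move=> cS; have [c cE] := exists_word_shift cS.
have n0 : (0 < n)%N by lia.
have [l lE] := exists_column_partition n0 (distinct_mod_height (S := S) (c := c)) cE.
by exists l, c.
Qed.

(* A word is recovered from its core and a starting residue: [c + height S j]
   is the largest bead in its residue class modulo [n]. *)
Lemma encodes_inj S S' l c c' : #|S| = s -> #|S'| = s -> (n%:Z %| c - c')%Z ->
  encodes S l c -> encodes S' l c' -> S = S'.
Proof.
have half T T' d d' : (n%:Z %| d - d')%Z -> encodes T l d -> encodes T' l d' ->
    forall j, (j < n)%N -> d' + height T' j <= d + height T j.
  move=> dd E E' j jn.
  have /E'/E[i [k [iN e]]] : bead_columns n (fun j => d' + height T' j) (d' + height T' j).
    by exists j, 0%N; split => //; lia.
  have ij : j = i.
    apply: (distinct_mod_height (S := T) (c := d) jn iN).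
    have -> : d + height T j - (d + height T i) = (d - d') +
       ((height T j - t%:Z * j%:Z) - (height T' j - t%:Z * j%:Z)) - k%:Z * n%:Z.
      have -> : height T i = d' + height T' j - d + k%:Z * n%:Z by move: e; lia.
      by ring.
    apply: rpredB; last exact: dvdz_mull (dvdzz _).
    by apply: rpredD => //; apply: rpredB; exact: height_mod.
  by rewrite e ij; lia.
move=> cS cS' dd E E'.
have dd' : (n%:Z %| c' - c)%Z by rewrite -opprB rpredN.
have same j : (j < n)%N -> c + height S j = c' + height S' j.
  by move=> jn; apply/eqP; rewrite eq_le (half _ _ _ _ dd' E' E) ?(half _ _ _ _ dd E E').
have cc : c = c' by have := same 0%N; rewrite !height0; lia.
have sameh j : (j <= n)%N -> height S j = height S' j.
  rewrite leq_eqVlt => /predU1P[->|/same]; last by rewrite cc => /addrI.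
  by rewrite !height_end.
apply/setP => j; have := heightS S j; rewrite !sameh ?heightS ?ltn_ord ?(ltnW (ltn_ord j)) //.
move=> /addrI; case: (j \in S); case: (j \in S') => //; lia.
Qed.

(* The walk through the largest beads of the residue classes steps by [t] when
   that stays on a bead and by [-s] otherwise. *)
Lemma core_encoded (l : int_partition) (r : int) : simultaneous_cores s t l ->
  exists S c, [/\ #|S| = s, encodes S l c & (n%:Z %| c - r)%Z].
Proof.
move=> [/(is_coreP l s0) cs /(is_coreP l t0) ct].
have n0 : (0 < n)%N by lia.
have cn k x : is_bead l x -> is_bead l (x - (k * n)%:Z).
  elim: k => [|k IH] bx; first by rewrite mul0n subr0.
  have -> : x - (k.+1 * n)%:Z = x - (k * n)%:Z - s%:Z - t%:Z by lia.
  exact/ct/cs/IH.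
pose I m := is_bead l m /\ ~ is_bead l (m + n%:Z).
have [m0 [Im0 m0r]] : exists m, I m /\ (n%:Z %| m - r)%Z.
  (* [r + N * n] lies above every bead. The first bead met when descending from it by steps [n] is
     the top of the class of [r], the starting point of the walk. *)
  pose N := (nth 0%N l 0 + `|r|)%N.
  have Pex : exists k, `[< is_bead l (r + (N * n)%:Z - (k * n)%:Z) >].
    exists (N + `|r| + size l + 1)%N; apply/asboolP/is_bead_small.
    have : ((N + `|r| + size l + 1) <= (N + `|r| + size l + 1) * n)%N by rewrite leq_pmulr.
    have : (N * n + (`|r| + size l + 1) <= (N + `|r| + size l + 1) * n)%N.
      have -> : (N + `|r| + size l + 1 = N + (`|r| + size l + 1))%N by lia.
      by rewrite mulnDl leq_add2l leq_pmulr.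
    lia.
  have [k /asboolP bk kmin] := ex_minnP Pex.
  exists (r + (N * n)%:Z - (k * n)%:Z); split; last first.
    by apply/dvdzP; exists (N%:Z - k%:Z); rewrite !PoszM; ring.
  split=> //; case: k bk kmin => [[i e] _ _|k bk kmin].
    have := partition_nth_le l (leq0n i).
    have : (N <= N * n)%N by rewrite leq_pmulr.
    by move: e; rewrite /bead /N; lia.
  have -> : r + (N * n)%:Z - (k.+1 * n)%:Z + n%:Z = r + (N * n)%:Z - (k * n)%:Z by lia.
  by move=> bk'; have := kmin k; rewrite ltnn => h; apply/notF/h/asboolP.
have Iuniq m m' : I m -> I m' -> (n%:Z %| m - m')%Z -> m = m'.
  have half a b q : I a -> I b -> a - b = q * n%:Z -> q <= 0.
    move=> [ba _] [_ nb] e; rewrite leNgt; apply/negP => q0; apply: nb.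
    have := cn `|(q - 1)%R|%N a ba; rewrite PoszM gez0_abs; last lia.
    by have -> : a - (q - 1) * n%:Z = b + n%:Z by move: e; lia.
  move=> Im Im' /dvdzP[q e].
  have q1 := half _ _ _ Im Im' e.
  have q2 : - q <= 0 by apply: (half _ _ _ Im' Im); rewrite mulNr -e; ring.
  have q0 : q = 0 by lia.
  by apply/eqP; rewrite -subr_eq0 e q0 mul0r.
pose step m := if `[< is_bead l (m + t%:Z) >] then m + t%:Z else m - s%:Z.
(* If [m + t] is a bead, then [m + t + n] is not, as [t]-closure would make [m + n] a bead.
   Otherwise [m - s] is a bead by [s]-closure, and the position [n] above it is the gap [m + t]. *)
have Istep m : I m -> I (step m).
  move=> [bm nbm]; rewrite /step; case: asboolP => h; split => //.
  - by move=> /ct; have -> : m + t%:Z + n%:Z - t%:Z = m + n%:Z by ring.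
  - exact: cs.
  - by have -> : m - s%:Z + n%:Z = m + t%:Z by lia.
pose H j := iter j step m0.
have IH j : I (H j) by elim: j => [|j IHj] //; exact: Istep.
pose S : {set 'I_(s + t)} := finset (fun i : 'I_(s + t) => `[< is_bead l (H i + t%:Z) >]).
have HE j : (j <= n)%N -> H j = m0 + height S j.
  elim: j => [|j IHj] jn; first by rewrite height0 addr0.
  rewrite (heightS S (Ordinal jn)) /= inE /= addrA -IHj; last exact: ltnW.
  by rewrite /H /= -/(H j) /step; case: ifP => _ //; ring.
(* [height S n] is a multiple of [n] and a residue class has only one top bead, so the walk closes
   up after [n] steps. This in turn forces [#|S| = s]. *)
have Hn : H n = m0.
  apply: Iuniq => //; rewrite HE // addrAC subrr add0r.
  apply/dvdzP; exists (#|[set i in S | (i < n)%N]|%:Z - s%:Z); rewrite /height; ring.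
have cS : #|S| = s.
  have : height S n = 0 by have := HE _ (leqnn n); rewrite Hn; lia.
  have -> : height S n = n%:Z * (#|S|%:Z - s%:Z).
    rewrite /height (_ : [set i in S | _] = S); first by ring.
    by apply/setP => i; rewrite !inE ltn_ord andbT.
  by move=> /eqP; rewrite mulf_eq0 => /orP[]; lia.
exists S, m0; split => // x; split; last first.
  by move=> [j [k [jn ->]]]; rewrite -HE ?(ltnW jn) //; apply: cn; case: (IH j).
move=> bx; pose G j := m0 + height S j.
have dG : distinct_mod n G by exact: distinct_mod_height.
have : `|(x %% n%:Z)%Z|%N \in [seq `|(G j %% n%:Z)%Z|%N | j <- iota 0 n].
  rewrite (perm_mem (perm_column_mod n0 dG)) mem_iota add0n /=.
  by have := @ltz_pmod x n%:Z; have := @modz_ge0 x n%:Z; lia.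
move=> /mapP[j]; rewrite mem_iota add0n /= => jn xj.
have [q e] : exists q, x = G j + q * n%:Z.
  exists ((x %/ n%:Z)%Z - (G j %/ n%:Z)%Z).
  by rewrite {1}(columnE (fun=> x) n0 0) {1}(columnE G n0 j) xj; ring.
have q0 : q <= 0.
  rewrite leNgt; apply/negP => q0; have [_] := IH j; apply.
  rewrite HE ?(ltnW jn) // -/(G j).
  have := cn `|(q - 1)%R|%N x bx; rewrite PoszM gez0_abs; last lia.
  by have -> : x - (q - 1) * n%:Z = G j + n%:Z by rewrite e; ring.
exists j, `|q|%N; split => //; rewrite PoszM; have -> : `|q|%N%:Z = - q by lia.
by rewrite e -/(G j); ring.
Qed.

Definition encoding S : int_partition * int :=
  if pselect (exists lc, encodes S lc.1 lc.2) is left h then projT1 (cid h)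
  else (empty_partition, 0).

Lemma encodingP S : #|S| = s -> encodes S (encoding S).1 (encoding S).2.
Proof.
move=> cS; rewrite /encoding; case: pselect => [h|[]]; first by case: cid.
by have [l [c E]] := exists_encoding cS; exists (l, c).
Qed.

(** The second component, the residue at which the walk starts, tells apart the [n] words of one
    core: the map is a bijection from the [s]-subsets onto pairs of a core and a residue. *)
Definition core_of_word S : int_partition * nat :=
  ((encoding S).1, `|((encoding S).2 %% n%:Z)%Z|%N).

Lemma core_of_word_inj : {in [pred S : {set 'I_(s + t)} | #|S| == s] &, injective core_of_word}.
Proof.
move=> S S'; rewrite !inE => /eqP cS /eqP cS' [lE cE].
have E := encodingP cS; have E' := encodingP cS'; rewrite -lE in E'.
apply: (encodes_inj cS cS' _ E E').
have n0 : (0 < n)%N by lia.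
rewrite (columnE (fun=> (encoding S).2) n0 0) (columnE (fun=> (encoding S').2) n0 0) cE.
by apply/dvdzP; eexists; rewrite opprD addrACA subrr addr0 -mulrBl.
Qed.

Lemma core_of_word_surj l r : simultaneous_cores s t l -> (r < n)%N ->
  exists2 S : {set 'I_(s + t)}, #|S| = s & core_of_word S = (l, r).
Proof.
move=> lc rn; have [S [c [cS E cr]]] := core_encoded r%:Z lc.
exists S => //; have E' := encodingP cS.
have ec := encodes_shift_inj E E'.
rewrite /core_of_word -ec; congr (_, _).
  by apply: is_bead_inj => x; rewrite E' E -ec.
by move: cr; rewrite -eqz_mod_dvd => /eqP ->; rewrite modz_small; lia.
Qed.

Lemma core_of_wordP S : #|S| = s -> simultaneous_cores s t (core_of_word S).1 /\
  ((core_of_word S).2 < n)%N.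
Proof.
move=> cS; split; first exact: encodes_core (encodingP cS).
rewrite /=; have := @ltz_pmod (encoding S).2 n%:Z; have := @modz_ge0 (encoding S).2 n%:Z; lia.
Qed.

Lemma finite_cores : finite_set (simultaneous_cores s t).
Proof.
have -> : simultaneous_cores s t =
    (fun S : {set 'I_(s + t)} => (core_of_word S).1) @`
      [set S : {set 'I_(s + t)} | #|S| = s].
  apply/seteqP; split => l; last by move=> [S cS <-]; have [] := core_of_wordP cS.
  by move=> lc; have [|S cS e] := @core_of_word_surj l 0 lc; [lia|exists S => //; rewrite e].
by apply: finite_image; exact: finite_finset.
Qed.

(* Each core comes from its [n] rotated words. *)
Lemma card_words_cores (Q : pred nat) :
  #|[pred S : {set 'I_(s + t)} | (#|S| == s) && Q (partition_size (core_of_word S).1)]| =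
  (n * #|` fset_set ([set l | Q (partition_size l)] `&` simultaneous_cores s t)|)%N.
Proof.
set W := [pred S | _]; set A := fset_set _.
have memA l : l \in A <-> Q (partition_size l) /\ simultaneous_cores s t l.
  rewrite in_fset_set; last exact: finite_setIr finite_cores.
  by split; [move/set_mem|move=> ?; exact/mem_set].
pose X := map core_of_word (enum W).
pose Y := [seq (l, r) | l <- enum_fset A, r <- iota 0 n].
have uX : uniq X.
  rewrite map_inj_in_uniq ?enum_uniq // => S S'; rewrite !mem_enum !inE => /andP[c _] /andP[c' _].
  by apply: core_of_word_inj; rewrite inE.
have uY : uniq Y by apply: allpairs_uniq; rewrite ?iota_uniq ?fset_uniq // => -[? ?] [? ?].
have : perm_eq X Y.
  apply: uniq_perm => // -[l r]; apply/idP/idP.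
    move=> /mapP[S]; rewrite mem_enum inE => /andP[/eqP cS QS] e.
    have [h1 h2] := core_of_wordP cS; move: QS; rewrite -e /= in h1 h2 * => QS.
    apply/allpairsP; exists (l, r) => /=; split => //; last by rewrite mem_iota.
    exact/memA.
  move=> /allpairsP[[l' r'] /= [/memA[Ql cl] + [-> ->]]]; rewrite mem_iota add0n /= => rn.
  have [S cS e] := core_of_word_surj cl rn.
  apply/mapP; exists S; last by rewrite e.
  by rewrite mem_enum inE cS eqxx e.
move=> /perm_size; rewrite size_map -cardE size_allpairs size_iota => ->.
by rewrite mulnC.
Qed.

End Words.

(** * Central limit theorem for linear statistics of a random subset *)

Section RealFacts.
Context {R : realType}.
Implicit Types x y : R.

(** A quadratic remainder passes through sums and integrals, so averages and expectations can be
    differentiated without a theorem on exchanging limits. *)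
Lemma is_derive_quadratic (F : R -> R) (x d M : R) :
  (forall h, `|F (x + h) - F x - h * d| <= M * h ^+ 2) -> is_derive x 1 F d.
Proof.
move=> hF; have M0 : 0 <= M.
  by have := hF 1; rewrite expr1n mulr1; apply: le_trans.
have cF : h^-1 *: (F (h *: 1 + x) - F x) @[h --> 0^'] --> d.
  apply/cvgrPdist_le => e e0.
  near=> h.
  have h0 : h != 0 by near: h; exact: nbhs_dnbhs_neq.
  have hM : `|h| <= e / (M + 1).
    near: h; apply: dnbhs0_le; rewrite divr_gt0 //; lra.
  rewrite /GRing.scale /= mulr1 [h + x]addrC.
  have -> : d - h^-1 * (F (x + h) - F x) = - (h^-1 * (F (x + h) - F x - h * d)).
    by field.
  rewrite normrN normrM normfV -ler_pdivlMl ?invr_gt0 ?normr_gt0 // invrK.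
  apply: le_trans (hF h) _; rewrite -real_normK ?num_real // expr2 mulrCA ler_pM2l ?normr_gt0 //.
  apply: (@le_trans _ _ ((M + 1) * `|h|)); first by rewrite ler_wpM2r //; lra.
  by rewrite mulrC -ler_pdivlMr //; lra.
by apply: DeriveDef; [apply/cvg_ex; exists d|apply/cvg_lim].
Unshelve. all: by end_near. Qed.

Lemma mean_value (f df : R -> R) x h : (forall y, is_derive y 1 f (df y)) ->
  exists2 z, `|z - x| <= `|h| & f (x + h) - f x = df z * h.
Proof.
move=> fd; have cf : continuous f.
  by move=> y; apply/differentiable_continuous/derivable1_diffP; case: (fd y).
have [h0|h0] := leP 0 h.
  have hx : x <= x + h by lra.
  have [c + e] := MVT_segment hx (fun y _ => fd y) (continuous_subspaceT cf).
  rewrite in_itv /= => /andP[c1 c2]; exists c.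
    by rewrite !ger0_norm //; lra.
  by rewrite e addrAC subrr add0r.
have hx : x + h <= x by lra.
have [c + e] := MVT_segment hx (fun y _ => fd y) (continuous_subspaceT cf).
rewrite in_itv /= => /andP[c1 c2]; exists c.
  by rewrite !ler0_norm //; lra.
by rewrite -opprB e; ring.
Qed.

Lemma sin_lipschitz x y : `|sin (x + y) - sin x| <= `|y|.
Proof.
have [z _ ->] := @mean_value sin cos x y (@is_derive_sin R).
by rewrite normrM ler_piMl // cos_max.
Qed.

Lemma cos_lipschitz x y : `|cos (x + y) - cos x| <= `|y|.
Proof.
have [z _ ->] := @mean_value cos (fun z => - sin z) x y (@is_derive_cos R).
by rewrite normrM normrN ler_piMl // sin_max.
Qed.

Lemma sin_taylor2 x y : `|sin (x + y) - sin x - y * cos x| <= y ^+ 2.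
Proof.
have [z zx ->] := @mean_value sin cos x y (@is_derive_sin R).
have -> : cos z * y - y * cos x = (cos z - cos x) * y by ring.
rewrite normrM -[leRHS]real_normK ?num_real // expr2 ler_wpM2r //.
by apply: le_trans zx; have := cos_lipschitz x (z - x); rewrite subrKC.
Qed.

Lemma cos_taylor2 x y : `|cos (x + y) - cos x - y * - sin x| <= y ^+ 2.
Proof.
have [z zx ->] := @mean_value cos (fun z => - sin z) x y (@is_derive_cos R).
have -> : - sin z * y - y * - sin x = - (sin z - sin x) * y by ring.
rewrite normrM normrN -[leRHS]real_normK ?num_real // expr2 ler_wpM2r //.
by apply: le_trans zx; have := sin_lipschitz x (z - x); rewrite subrKC.
Qed.

(** With the integrating factor [expR (v / 2 * x ^+ 2)], the mean value theorem on [0,1] turns an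
    approximate solution of [F' = - x v F] into an approximate Gaussian value at 1. It serves both
    the subset averages, with an error, and the normal law itself, with [e = 0]. *)
Lemma gaussian_ode (F dF : R -> R) (M v e : R) : 0 <= v ->
    (forall x h, `|F (x + h) - F x - h * dF x| <= M * h ^+ 2) ->
    (forall x, 0 <= x <= 1 -> `|dF x + x * v * F x| <= e) ->
  `|F 1 - F 0 * expR (- (v / 2))| <= e.
Proof.
move=> v0 qF ode.
pose G := F * (expR \o (v / 2 \*: (@GRing.exp R ^~ 2%N))).
have dG x : is_derive x 1 G ((dF x + x * v * F x) * expR (v / 2 * x ^+ 2)).
  have dFx := is_derive_quadratic (qF x).
  have dx2 : is_derive x 1 (v / 2 \*: (@GRing.exp R ^~ 2%N)) (v / 2 *: ((2%:R * x ^+ 1) *: 1)).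
    by apply: is_deriveZ; have := is_deriveX 2 (is_derive_id x 1).
  have dE := is_derive1_comp (is_derive_expR _) dx2.
  apply: (is_derive_eq (is_deriveM dFx dE)).
  by rewrite /GRing.scale /= ; lra.
have cG : continuous G.
  by move=> y; apply/differentiable_continuous/derivable1_diffP; case: (dG y).
have [c + E] := MVT ltr01 (fun x _ => dG x) (continuous_subspaceT cG).
rewrite in_itv /= => /andP[c0 c1].
have e1 : G 1 - G 0 = (F 1 - F 0 * expR (- (v / 2))) * expR (v / 2).
  rewrite mulrBl -mulrA -expRD addNr expR0 /G /= !fctE /=.
  by rewrite /GRing.scale /= expr1n expr0n /= mulr0 expR0 !mulr1.
have : `|G 1 - G 0| <= e * expR (v / 2).
  rewrite E subr0 mulr1 normrM [X in _ * X]ger0_norm ?expR_ge0 //.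
  apply: ler_pM; rewrite ?expR_ge0 ?normr_ge0 //; first by apply: ode; rewrite !ltW.
  rewrite ler_expR ler_piMr ?divr_ge0 // expr_le1 //; lra.
by rewrite e1 normrM (ger0_norm (expR_ge0 _)) ler_pM2r ?expR_gt0.
Qed.

End RealFacts.

(** * Averages over subsets of fixed size and exchangeable swaps *)

Section FixedSizeSubsets.
Context {R : realType}.
Variables s t : nat.
Hypotheses (s0 : (0 < s)%N) (t0 : (0 < t)%N).
Local Notation n := (s + t)%N.
Implicit Type S : {set 'I_(s + t)}.

Definition subsets_count : nat := #|[pred S : {set 'I_(s + t)} | #|S| == s]|.

Lemma subsets_count_gt0 : (0 < subsets_count)%N.
Proof.
rewrite /subsets_count; apply/card_gt0P.
have : (0 < #|[set A : {set 'I_(s + t)} | #|A| == s]%SET|)%N.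
  by rewrite card_draws card_ord bin_gt0 leq_addr.
by move=> /card_gt0P[A]; rewrite inE => cA; exists A.
Qed.

Definition average (f : {set 'I_(s + t)} -> R) : R :=
  (\sum_(S : {set 'I_(s + t)} | #|S| == s) f S) / subsets_count%:R.

Let N0 : (0 : R) < subsets_count%:R. Proof. by rewrite ltr0n subsets_count_gt0. Qed.

Lemma averageD f g : average (fun S => f S + g S) = average f + average g.
Proof. by rewrite /average big_split mulrDl. Qed.

Lemma averageB f g : average (fun S => f S - g S) = average f - average g.
Proof. by rewrite /average sumrB mulrBl. Qed.

Lemma averageZ c f : average (fun S => c * f S) = c * average f.
Proof. by rewrite /average -mulr_sumr mulrA. Qed.

Lemma average_cst c : average (fun=> c) = c.
Proof. by rewrite /average sumr_const -[c *+ _]mulr_natr mulfK ?gt_eqF. Qed.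

Lemma average_sum (I : Type) (r : seq I) (f : I -> {set 'I_(s + t)} -> R) :
  average (fun S => \sum_(i <- r) f i S) = \sum_(i <- r) average (f i).
Proof. by rewrite /average exchange_big /= mulr_suml. Qed.

Lemma le_average f g : (forall S, #|S| = s -> f S <= g S) -> average f <= average g.
Proof. by move=> fg; rewrite ler_pM2r ?invr_gt0 // ler_sum // => S /eqP /fg. Qed.

Lemma eq_average f g : (forall S, #|S| = s -> f S = g S) -> average f = average g.
Proof. by move=> fg; congr (_ / _); apply: eq_bigr => S /eqP /fg. Qed.

Lemma average_norm f : `|average f| <= average (fun S => `|f S|).
Proof.
rewrite /average normrM normfV (ger0_norm (ltW N0)) ler_pM2r ?invr_gt0 //.
exact: ler_norm_sum.
Qed.

Lemma average_norm_le f C : (forall S, #|S| = s -> `|f S| <= C) -> `|average f| <= C.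
Proof.
move=> fC; apply: le_trans (average_norm f) _; rewrite -[leRHS](average_cst C).
exact: le_average.
Qed.

Definition swap (i j : 'I_(s + t)) S : {set 'I_(s + t)} := tperm i j @: S.

Lemma swapK i j : involutive (swap i j).
Proof.
move=> S; rewrite /swap -imset_comp (eq_imset (g := id)) ?imset_id // => x.
by rewrite /= tpermK.
Qed.

Lemma mem_swap i j S x : (x \in swap i j S) = (tperm i j x \in S).
Proof. by rewrite /swap -{1}(tpermK i j x) mem_imset //; exact: perm_inj. Qed.

Lemma card_swap i j S : #|swap i j S| = #|S|.
Proof. by rewrite card_imset //; exact: perm_inj. Qed.

Definition swap_sum (F : {set 'I_(s + t)} -> 'I_(s + t) -> 'I_(s + t) -> R) : R :=
  \sum_(S : {set 'I_(s + t)} | #|S| == s) \sum_(i in S) \sum_(j in ~: S) F S i j.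

(** Exchangeability: [(S, i, j)] to [(swap i j S, j, i)] is a bijection of the triples with [i] in
    [S] and [j] outside. *)
Lemma swap_sum_swap F : swap_sum F = swap_sum (fun S i j => F (swap i j S) j i).
Proof.
have E (F' : {set 'I_(s + t)} -> 'I_(s + t) -> 'I_(s + t) -> R) :
    swap_sum F' = \sum_i \sum_j
      \sum_(S : {set 'I_(s + t)} | [&& #|S| == s, i \in S & j \notin S]) F' S i j.
  rewrite /swap_sum; transitivity (\sum_(S : {set 'I_(s + t)} | #|S| == s) \sum_i \sum_j
      (if (i \in S) && (j \notin S) then F' S i j else 0)).
    apply: eq_bigr => S _; rewrite big_mkcond; apply: eq_bigr => i _.
    case: (i \in S) => /=; last by rewrite big1.
    by rewrite big_mkcond; apply: eq_bigr => j _; rewrite inE.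
  rewrite exchange_big; apply: eq_bigr => i _; rewrite exchange_big.
  by apply: eq_bigr => j _; rewrite -big_mkcondr.
rewrite !E exchange_big; apply: eq_bigr => i _; apply: eq_bigr => j _.
rewrite (reindex_inj (inv_inj (swapK i j))); apply: eq_bigl => S.
by rewrite card_swap !mem_swap tpermL tpermR; congr (_ && _); rewrite andbC.
Qed.

Definition linear_stat (a : 'I_(s + t) -> R) S : R := \sum_(i in S) a i.

Lemma linear_stat_swap a S i j : i \in S -> j \notin S ->
  linear_stat a (swap i j S) = linear_stat a S + (a j - a i).
Proof.
move=> iS jS; rewrite /linear_stat.
rewrite (eq_bigl [pred x | (x \in S) && (x != i) || (x == j)]); last first.
  move=> x; rewrite mem_swap inE.
  case: tpermP => [->|->|/eqP xi /eqP xj].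
  - by rewrite (negbTE jS) eqxx andbF /=; apply/esym/eqP => ij; move: jS; rewrite -ij iS.
  - by rewrite iS eqxx orbT.
  - by rewrite xi (negbTE xj) andbT orbF.
rewrite (bigD1 j) /=; last by rewrite eqxx orbT.
rewrite [in RHS](bigD1 i) //= (eq_bigl (fun x => (x \in S) && (x != i))).
  by ring.
move=> x; case: (eqVneq x j) => [->|xj]; first by rewrite (negbTE jS) andbF.
by rewrite orbF andbT.
Qed.

Lemma sum_cst_card S (x : R) : \sum_(i in S) x = #|S|%:R * x.
Proof. by rewrite sumr_const mulr_natl. Qed.

Lemma sum_compl S (b : 'I_(s + t) -> R) :
  \sum_(j in ~: S) b j = \sum_j b j - \sum_(i in S) b i.
Proof.
rewrite [X in X - _](bigID (mem S)) /= [X in X - _]addrC addrK.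
by apply: eq_bigl => i; rewrite inE.
Qed.

Lemma card_compl S : #|S| = s -> #|~: S| = t.
Proof. by move=> cS; rewrite cardsCs finset.setCK card_ord cS addKn. Qed.

Lemma swap_sum_norm (F : {set 'I_(s + t)} -> 'I_(s + t) -> 'I_(s + t) -> R) M :
    (forall S i j, #|S| = s -> i \in S -> j \notin S -> `|F S i j| <= M) ->
  `|swap_sum F / subsets_count%:R| <= s%:R * t%:R * M.
Proof.
move=> FM; rewrite -[_ / _]/(average (fun S => \sum_(i in S) \sum_(j in ~: S) F S i j)).
apply: average_norm_le => S cS.
apply: le_trans (ler_norm_sum _ _ _) _.
have -> : s%:R * t%:R * M = \sum_(i in S) (t%:R * M).
  by rewrite sum_cst_card cS mulrA.
apply: ler_sum => i iS; apply: le_trans (ler_norm_sum _ _ _) _.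
have -> : t%:R * M = \sum_(j in ~: S) M by rewrite sum_cst_card card_compl.
by apply: ler_sum => j; rewrite inE => jS; exact: FM.
Qed.

Section Centered.
Variables (a : 'I_(s + t) -> R) (C : R).
Hypotheses (a_sum : \sum_i a i = 0) (a_le : forall i, `|a i| <= C).
Let A := linear_stat a.

Let C0 : 0 <= C.
Proof.
have i : 'I_(s + t) by apply: (@Ordinal _ 0); rewrite addn_gt0 s0.
exact: le_trans (normr_ge0 _) (a_le i).
Qed.

(* Exchangeability of the pair (S, S with a random element swapped out): the
   regression of the swapped statistic on [A] is exactly linear. *)
Lemma swap_identity (f : {set 'I_(s + t)} -> R) :
  n%:R * average (fun S => A S * f S) =
  2^-1 * (swap_sum (fun S i j => (a j - a i) * (f (swap i j S) - f S)) / subsets_count%:R).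
Proof.
rewrite /average !mulrA; congr (_ / _).
pose T := swap_sum (fun S i j => (a j - a i) * f S).
(* As [a] sums to zero, the differences [a j - a i] over all swaps of [S] add up to
   [- s A - t A = - n A]. *)
have TA : T = - (n%:R * \sum_(S : {set 'I_(s + t)} | #|S| == s) A S * f S).
  rewrite mulr_sumr -sumrN; apply: eq_bigr => S /eqP cS.
  under eq_bigr => i _ do
    rewrite -mulr_suml sumrB sum_compl a_sum sub0r sum_cst_card (card_compl cS).
  rewrite -mulr_suml sumrB sum_cst_card cS -mulr_sumr -/(linear_stat a S) -/(A S).
  by rewrite natrD; ring.
have TT : T = swap_sum (fun S i j => (a i - a j) * f (swap i j S)).
  exact: swap_sum_swap.
have -> : swap_sum (fun S i j => (a j - a i) * (f (swap i j S) - f S)) = - (T + T).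
  rewrite {1}TT /T /swap_sum -big_split -sumrN; apply: eq_bigr => S _ /=.
  rewrite -big_split -sumrN; apply: eq_bigr => i _ /=.
  by rewrite -big_split -sumrN; apply: eq_bigr => j _ /=; ring.
by rewrite TA; field.
Qed.

(** [swap_identity] at [f = A]: each of the [s t] swaps contributes [(a j - a i) ^+ 2], at most
    [4 * C ^+ 2]. *)
Lemma average_linear_stat_sqr :
  average (fun S => A S ^+ 2) <= 2 * C ^+ 2 * (s%:R * t%:R / n%:R).
Proof.
have n0 : (0 : R) < n%:R by rewrite ltr0n addn_gt0 s0.
rewrite mulrA ler_pdivlMr // mulrC.
have -> : average (fun S => A S ^+ 2) = average (fun S => A S * A S) by [].
rewrite swap_identity mulrC ler_pdivrMr //.
have := @swap_sum_norm (fun S i j => (a j - a i) * (A (swap i j S) - A S)) (4 * C ^+ 2).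
move=> /(_ _)/ler_normlW h; apply: le_trans (h _) _; last by lra.
move=> S i j cS iS jS; rewrite /A linear_stat_swap // addrAC subrr add0r normrM.
have d : `|a j - a i| <= 2 * C.
  by apply: le_trans (ler_normB _ _) _; have := a_le i; have := a_le j; lra.
by have -> : 4 * C ^+ 2 = (2 * C) * (2 * C); [ring|exact: ler_pM].
Qed.

End Centered.

Section CentralLimit.
Variables (a : 'I_(s + t) -> R) (C : R).
Hypotheses (a_sum : \sum_i a i = 0) (a_le : forall i, `|a i| <= C).
Let A := linear_stat a.
Let v : R := (\sum_i a i ^+ 2) / n%:R.
(** The normalisation of sampling without replacement: [A] has variance [s t v / (n - 1)], so
    [c * A] has variance close to [v]. *)
Let c : R := Num.sqrt (n%:R / (s%:R * t%:R)).
Let n0 : (0 : R) < n%:R. Proof. by rewrite ltr0n addn_gt0 s0. Qed.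
Let sR : (0 : R) < s%:R. Proof. by rewrite ltr0n. Qed.
Let tR : (0 : R) < t%:R. Proof. by rewrite ltr0n. Qed.
Let c2 : c ^+ 2 = n%:R / (s%:R * t%:R).
Proof. by rewrite sqr_sqrtr // divr_ge0 ?mulr_ge0 ?ler0n. Qed.
Let c0 : 0 < c. Proof. by rewrite sqrtr_gt0 divr_gt0 ?mulr_gt0. Qed.
Let C0 : 0 <= C.
Proof.
have i : 'I_(s + t) by apply: (@Ordinal _ 0); rewrite addn_gt0 s0.
exact: le_trans (normr_ge0 _) (a_le i).
Qed.
Let v_le : 0 <= v <= C ^+ 2.
Proof.
rewrite divr_ge0 ?sumr_ge0 //=; last by move=> i _; exact: sqr_ge0.
rewrite ler_pdivrMr // mulrC mulr_natl.
have -> : C ^+ 2 *+ n = \sum_(i < n) C ^+ 2 by rewrite sumr_const card_ord.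
rewrite ler_sum // => i _.
by rewrite -real_normK ?num_real // lerXn2r ?nnegrE.
Qed.

Let D := linear_stat (fun i => a i ^+ 2 - v).

(** The conditional second moment of the swap difference is the constant [2 s t v] plus two
    fluctuations. [D] is again a centred linear statistic, so the second-moment bound for linear
    statistics applies to [D] and to [A] alike. *)
Lemma swap_square_sum S : #|S| = s ->
  \sum_(i in S) \sum_(j in ~: S) (a j - a i) ^+ 2 =
  2 * s%:R * t%:R * v + (t%:R - s%:R) * D S + 2 * A S ^+ 2.
Proof.
move=> cS.
have vE : \sum_i a i ^+ 2 = n%:R * v by rewrite /v mulrC divfK ?gt_eqF.
pose Q := \sum_(i in S) a i ^+ 2.
have DE : D S = Q - s%:R * v by rewrite /D /linear_stat sumrB sum_cst_card cS.
have inner i : \sum_(j in ~: S) (a j - a i) ^+ 2 =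
    (n%:R * v - Q) + 2 * A S * a i + t%:R * a i ^+ 2.
  have -> : n%:R * v - Q = \sum_(j in ~: S) a j ^+ 2 by rewrite sum_compl vE.
  have -> : 2 * A S * a i = \sum_(j in ~: S) - (2 * a i) * a j.
    by rewrite -mulr_sumr sum_compl a_sum -/(linear_stat a S) -/(A S); ring.
  have -> : t%:R * a i ^+ 2 = \sum_(j in ~: S) a i ^+ 2.
    by rewrite sum_cst_card card_compl.
  by rewrite -!big_split; apply: eq_bigr => j _ /=; ring.
under eq_bigr => i _ do rewrite inner.
rewrite !big_split /= !sum_cst_card cS -!mulr_sumr -/(linear_stat a S) -/(A S) -/Q.
by rewrite DE natrD; ring.
Qed.

Lemma average_abs_D : average (fun S => `|D S|) <= (C ^+ 4 + 1) / c.
Proof.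
have vD : \sum_i (a i ^+ 2 - v) = 0.
  rewrite sumrB sumr_const card_ord -[v *+ _]mulr_natl /v [n%:R * _]mulrC divfK ?subrr //.
  by rewrite gt_eqF.
have Dle i : `|a i ^+ 2 - v| <= C ^+ 2.
  have := v_le => /andP[v0 v1].
  have : a i ^+ 2 <= C ^+ 2 by rewrite -real_normK ?num_real // lerXn2r ?nnegrE.
  by have := sqr_ge0 (a i); rewrite ler_norml; lra.
have := average_linear_stat_sqr vD Dle.
rewrite -/D -[s%:R * t%:R / n%:R]invrK invf_div -c2 => h.
(* This replaces Cauchy-Schwarz; the weight [c] balances the two terms, since the mean of [D ^+ 2]
   is of order [c ^- 2]. *)
have : average (fun S => `|D S|) <= average (fun S => 2^-1 * (c * D S ^+ 2 + c^-1)).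
  apply: le_average => S _.
  have := sqr_ge0 (`|D S| * c - 1).
  have -> : (`|D S| * c - 1) ^+ 2 = 2 * c * (2^-1 * (c * D S ^+ 2 + c^-1) - `|D S|).
    by rewrite sqrrB1 exprMn real_normK ?num_real //; field; rewrite gt_eqF.
  by rewrite pmulr_rge0 ?subr_ge0 // mulr_gt0.
move=> /le_trans; apply; rewrite averageZ averageD averageZ average_cst.
rewrite ler_pdivrMl // [X in _ <= X]mulrA ler_pdivlMr // mulrDl mulVf ?gt_eqF //.
have -> : c * average (fun S => D S ^+ 2) * c = average (fun S => D S ^+ 2) * c ^+ 2 by ring.
have : average (fun S => D S ^+ 2) * c ^+ 2 <= 2 * (C ^+ 2) ^+ 2.
  by rewrite -ler_pdivlMr ?exprn_gt0.
by rewrite -exprM; lra.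
Qed.

(** Stein's method for [F r], the mean of [cos (r c A)]: its derivative contains the mean of
    [A sin (r c A)], which [swap_identity] and a Taylor expansion of the sine turn into [- r v F r]
    up to error terms. *)
Theorem subset_central_limit :
  `|average (fun S => cos (c * A S)) - expR (- (v / 2))| <=
    c * (4 * C ^+ 3 + C ^+ 4 + 1) + 2 * C ^+ 2 * c ^+ 2.
Proof.
pose F r := average (fun S => cos (r * (c * A S))).
pose dF r := average (fun S => c * A S * - sin (r * (c * A S))).
have -> : average (fun S => cos (c * A S)) = F 1.
  by apply: eq_average => S _; rewrite mul1r.
have /andP[v0 v1] := v_le.
have F0 : F 0 = 1.
  by rewrite -[RHS](average_cst 1); apply: eq_average => S _; rewrite mul0r cos0.
rewrite -[X in _ - X]mul1r -[X in _ - X * _]F0.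
apply: (@gaussian_ode _ F dF (average (fun S => (c * A S) ^+ 2)) v) => //; last first.
- move=> r /andP[r0 r1].
  pose f S := sin (r * c * A S).
  have := swap_identity a_sum f.
  (* The remainder of the first-order expansion of the sine at [A S]. The main term carries the
     squared differences, which [swap_square_sum] adds up. *)
  pose E S i j := (a j - a i) * (f (swap i j S) - f S) - r * c * ((a j - a i) ^+ 2 * cos (r * c * A S)).
  have -> : swap_sum (fun S i j => (a j - a i) * (f (swap i j S) - f S)) / subsets_count%:R =
      swap_sum E / subsets_count%:R + r * c * average (fun S => cos (r * c * A S) *
         (2 * s%:R * t%:R * v + (t%:R - s%:R) * D S + 2 * A S ^+ 2)).
    rewrite -averageZ /average -mulrDl; congr (_ / _).
    rewrite -big_split; apply: eq_bigr => S /eqP cS /=.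
    rewrite -swap_square_sum //; pose X := cos (r * c * A S); rewrite -/X.
    rewrite !mulr_sumr -big_split; apply: eq_bigr => i _ /=.
    by rewrite !mulr_sumr -big_split; apply: eq_bigr => j _ /=; rewrite /E -/X; ring.
  have hE : `|swap_sum E / subsets_count%:R| <= s%:R * t%:R * (8 * C ^+ 3 * c ^+ 2).
    apply: swap_sum_norm => S i j cS iS jS; rewrite /E /f /A linear_stat_swap //.
    have d : `|a j - a i| <= 2 * C.
      by apply: le_trans (ler_normB _ _) _; have := a_le i; have := a_le j; lra.
    have := sin_taylor2 (r * c * linear_stat a S) (r * c * (a j - a i)).
    set X := sin _ - _ - _ => hX; rewrite [r * c * (_ + _)]mulrDr.
    have -> : (a j - a i) * (sin (r * c * linear_stat a S + r * c * (a j - a i)) -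
      sin (r * c * linear_stat a S)) - r * c * ((a j - a i) ^+ 2 * cos (r * c * linear_stat a S))
      = (a j - a i) * X by rewrite /X; ring.
    rewrite normrM; have -> : 8 * C ^+ 3 * c ^+ 2 = (2 * C) * (c * (2 * C)) ^+ 2 by ring.
    apply: ler_pM => //; apply: le_trans hX _.
    rewrite -real_normK ?num_real // lerXn2r ?nnegrE ?mulr_ge0 ?(ltW c0) //.
    rewrite !normrM (ger0_norm r0) (ger0_norm (ltW c0)) -mulrA.
    apply: (@le_trans _ _ (c * `|a j - a i|)); last by rewrite ler_pM2l.
    by rewrite ler_piMl // mulr_ge0 // ltW.
  set EE := swap_sum E / _ in hE *; move=> key.
  pose P := average (fun S => cos (r * c * A S) * ((t%:R - s%:R) * D S + 2 * A S ^+ 2)).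
  have split : average (fun S => cos (r * c * A S) *
         (2 * s%:R * t%:R * v + (t%:R - s%:R) * D S + 2 * A S ^+ 2)) =
       2 * s%:R * t%:R * v * F r + P.
    rewrite -averageZ -averageD; apply: eq_average => S _; rewrite mulrA; ring.
  rewrite split in key.
  have dFE : dF r = - (c * average (fun S => A S * f S)).
    by rewrite -mulN1r -!averageZ; apply: eq_average => S _; rewrite /f mulrA; ring.
  have st0 : s%:R * t%:R != 0 :> R by rewrite mulf_neq0 ?gt_eqF.
  have cst : c ^+ 2 * (s%:R * t%:R) / n%:R = 1 by rewrite c2 divfK // divff // gt_eqF.
  have res : dF r + r * v * F r = - (c / n%:R * 2^-1 * EE) - r * c ^+ 2 / (2 * n%:R) * P.
    rewrite dFE; have -> : c * average (fun S => A S * f S) =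
      c / n%:R * (n%:R * average (fun S => A S * f S)) by field; rewrite -?natrD !gt_eqF.
    have -> : r * v * F r = c ^+ 2 * (s%:R * t%:R) / n%:R * (r * v * F r) by rewrite cst mul1r.
    rewrite key; field.
    by rewrite -?natrD !gt_eqF.
  have hP : `|P| <= n%:R * ((C ^+ 4 + 1) / c) + 2 * (2 * C ^+ 2 * (s%:R * t%:R / n%:R)).
    apply: le_trans (average_norm _) _.
    apply: (@le_trans _ _ (average (fun S => n%:R * `|D S| + 2 * A S ^+ 2))).
      apply: le_average => S _; rewrite normrM.
      apply: (@le_trans _ _ `|(t%:R - s%:R) * D S + 2 * A S ^+ 2|).
        by rewrite ler_piMl // cos_max.
      have hA : 0 <= 2 * A S ^+ 2 by apply: mulr_ge0 => //; exact: sqr_ge0.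
      apply: le_trans (ler_normD _ _) _.
      rewrite [X in _ + X](ger0_norm hA) lerD2r normrM natrD; apply: ler_wpM2r => //.
      by rewrite ler_norml; have := sR; have := tR; lra.
    rewrite averageD !averageZ lerD // ler_pM2l //; first exact: average_abs_D.
    exact: average_linear_stat_sqr.
  rewrite res; apply: le_trans (ler_normB _ _) _; rewrite normrN normrM [X in X * _]ger0_norm; last first.
    by rewrite !divr_ge0 ?(ltW c0) ?(ltW n0).
  rewrite [X in _ + X <= _]normrM [X in _ + X * _ <= _]ger0_norm; last first.
    by apply: mulr_ge0; [apply: mulr_ge0 => //; exact: sqr_ge0|rewrite invr_ge0 mulr_ge0 ?(ltW n0)].
  have h1 : c / n%:R / 2 * `|EE| <= c * (4 * C ^+ 3).
    apply: (@le_trans _ _ (c / n%:R / 2 * (s%:R * t%:R * (8 * C ^+ 3 * c ^+ 2)))).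
      by rewrite ler_wpM2l // !divr_ge0 ?(ltW c0) ?(ltW n0).
    have -> : c / n%:R / 2 * (s%:R * t%:R * (8 * C ^+ 3 * c ^+ 2)) =
      c * (4 * C ^+ 3) * (c ^+ 2 * (s%:R * t%:R) / n%:R) by field; rewrite -?natrD !gt_eqF.
    by rewrite cst mulr1.
  have h2 : r * c ^+ 2 / (2 * n%:R) * `|P| <= c * (C ^+ 4 + 1) + 2 * C ^+ 2 * c ^+ 2.
    apply: (@le_trans _ _ (c ^+ 2 / (2 * n%:R) *
       (n%:R * ((C ^+ 4 + 1) / c) + 2 * (2 * C ^+ 2 * (s%:R * t%:R / n%:R))))).
      apply: ler_pM => //.
        by apply: mulr_ge0; [apply: mulr_ge0 => //; exact: sqr_ge0|rewrite invr_ge0 mulr_ge0 ?(ltW n0)].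
      by rewrite ler_pM2r ?invr_gt0 ?mulr_gt0 // ler_piMl ?sqr_ge0.
    have -> : c ^+ 2 / (2 * n%:R) *
       (n%:R * ((C ^+ 4 + 1) / c) + 2 * (2 * C ^+ 2 * (s%:R * t%:R / n%:R))) =
       c * (C ^+ 4 + 1) / 2 + (c ^+ 2 * (s%:R * t%:R) / n%:R) * 2 * C ^+ 2 / n%:R.
      by field; rewrite -?natrD !gt_eqF.
    rewrite cst mul1r; apply: lerD.
      have hh : 0 <= c * (C ^+ 4 + 1) by rewrite mulr_ge0 ?addr_ge0 ?exprn_ge0 ?(ltW c0).
      by move: hh; lra.
    rewrite ler_wpM2l ?mulr_ge0 ?exprn_ge0 // c2.
    rewrite ler_pdivlMr ?mulr_gt0 // mulrC ler_pdivrMr //.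
    by rewrite -!natrM ler_nat leq_mul ?leq_addr ?leq_addl.
  apply: le_trans (lerD h1 h2) _; lra.
- move=> r h; rewrite /F /dF [X in _ <= X]mulrC -!averageZ.
  have -> : average (fun S => cos ((r + h) * (c * A S))) - average (fun S => cos (r * (c * A S))) -
      average (fun S => h * (c * A S * - sin (r * (c * A S)))) =
    average (fun S => cos (r * (c * A S) + h * (c * A S)) - cos (r * (c * A S)) -
      h * (c * A S) * - sin (r * (c * A S))).
    rewrite -[X in _ - X - _]mul1r -[X in _ - X]mul1r -!mulNr -!averageZ -!averageD.
    by apply: eq_average => S _; rewrite mulrDl; ring.
  apply: le_trans (average_norm _) _; apply: le_average => S _.
  by rewrite -exprMn; exact: cos_taylor2.
Qed.

End CentralLimit.
End FixedSizeSubsets.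

(** * Fourier expansion of the size *)

Section Trigonometry.
Context {R : realType}.
Implicit Types x y : R.

Lemma cos_add_2pi x (k : nat) : cos (x + 2 * pi * k%:R) = cos x.
Proof.
by rewrite -[RHS](periodicn (@cosD2pi R) k x); congr (cos (_ + _)); rewrite -mulr_natr; ring.
Qed.

Lemma sin_add_2pi x (k : nat) : sin (x + 2 * pi * k%:R) = sin x.
Proof.
by rewrite -[RHS](periodicn (@sinD2pi R) k x); congr (sin (_ + _)); rewrite -mulr_natr; ring.
Qed.

(** From [y * cos y <= sin y] at [y = x / 2], doubling gives [sin x >= x * cos (x / 2) ^+ 2 = x * (1
    + cos x) / 2]. The constant 1/2 is enough because [pi >= 2] compensates it in
    [sin_half_angle_ge]. *)
Lemma sin_ge_half x : 0 <= x <= pi / 2 -> x / 2 <= sin x.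
Proof.
move=> /andP[x0 x1].
have [cpos hx] : 0 <= cos x /\ 0 <= x / 2 by split; [apply: cos_ge0_pihalf; lra|lra].
have cosx y : 0 <= y <= pi -> y * cos y <= sin y.
  move=> /andP[y0 y1].
  pose g : R -> R := (@sin R) - (@id R * @cos R).
  have dg (z : R) : is_derive z 1 g (z * sin z).
    rewrite /g; apply: is_derive_eq; rewrite /GRing.scale /=; ring.
  have cg : continuous g.
    by move=> z; apply/differentiable_continuous/derivable1_diffP; case: (dg z).
  have [c + E] := MVT_segment y0 (fun z _ => dg z) (continuous_subspaceT cg).
  rewrite in_itv /= => /andP[c0 c1].
  have : 0 <= g y - g 0.
    rewrite E subr0 !mulr_ge0 //; apply: sin_ge0_pi; apply/andP; split=> //.
    exact: le_trans c1 y1.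
  by rewrite /g /= !fctE sin0 mul0r subr0 subr0 subr_ge0.
have e : x = x / 2 + x / 2 by lra.
have h1 : x / 2 * cos (x / 2) <= sin (x / 2).
  by apply: cosx; have := @pi_gt0 R; lra.
have h2 : 0 <= cos (x / 2) by apply: cos_ge0_pihalf; have := @pi_gt0 R; lra.
have cx : cos x = 2 * cos (x / 2) ^+ 2 - 1.
  by rewrite {1}e cosD -!expr2 sin2cos2; ring.
have sx : sin x = 2 * (sin (x / 2) * cos (x / 2)) by rewrite {1}e sinD; ring.
have : x / 2 * cos (x / 2) * cos (x / 2) <= sin (x / 2) * cos (x / 2).
  by rewrite ler_wpM2r.
have : 0 <= x / 2 * cos x by rewrite mulr_ge0.
by rewrite cx sx; lra.
Qed.

End Trigonometry.

(** * Real discrete Fourier analysis on [Z/n] *)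

Section DiscreteFourier.
Context {R : realType}.
Variable n : nat.
Hypothesis n0 : (0 < n)%N.
Implicit Types (g : nat -> R) (k l j : nat).

Definition angle k j : R := 2 * pi * (k * j)%:R / n%:R.

Let nR : (0 : R) < n%:R. Proof. by rewrite ltr0n. Qed.

Lemma angleDl k l j : angle (k + l) j = angle k j + angle l j.
Proof. by rewrite /angle mulnDl natrD; ring. Qed.

Lemma angleS k j : angle k j.+1 = angle k j + angle k 1.
Proof. by rewrite /angle mulnS muln1 natrD; ring. Qed.

Lemma angle0 k : angle k 0 = 0.
Proof. by rewrite /angle muln0 mulr0 mul0r. Qed.

Lemma angle_n k : angle k n = 2 * pi * k%:R.
Proof. by rewrite /angle natrM; field; rewrite gt_eqF. Qed.

Lemma sin_half_angle_gt0 k : (0 < k < n)%N -> 0 < sin (angle k 1 / 2).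
Proof.
move=> /andP[k0 kn]; apply: sin_gt0_pi; rewrite /angle muln1.
have -> : 2 * pi * k%:R / n%:R / 2 = pi * (k%:R / n%:R) :> R by field; rewrite gt_eqF.
rewrite mulr_gt0 ?pi_gt0 ?divr_gt0 ?ltr0n //= gtr_pMr ?pi_gt0 //.
by rewrite ltr_pdivrMr // mul1r ltr_nat.
Qed.

(** Multiplying by the sine of half the increment makes the sum telescope, as for the Dirichlet
    kernel; over a full period the two ends cancel. *)
Lemma sum_cos_angle k : (0 < k < n)%N -> \sum_(0 <= j < n) cos (angle k j) = 0.
Proof.
move=> kn; have s0 := sin_half_angle_gt0 kn.
apply/eqP; rewrite -(mulrI_eq0 _ (mulfI (lt0r_neq0 s0))); apply/eqP.
have E m : sin (angle k 1 / 2) * (\sum_(0 <= j < m) cos (angle k j)) =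
    (sin (angle k m - angle k 1 / 2) + sin (angle k 1 / 2)) / 2.
  elim: m => [|m IH]; first by rewrite big_geq // mulr0 angle0 sub0r sinN addNr mul0r.
  rewrite big_nat_recr //= mulrDr IH (angleS k m).
  have -> : angle k m + angle k 1 - angle k 1 / 2 = angle k m + angle k 1 / 2 by field.
  by rewrite sinB sinD; field.
by rewrite E angle_n [2 * pi * _ - _]addrC sin_add_2pi sinN addNr mul0r.
Qed.

Lemma sum_sin_angle k : (0 < k < n)%N -> \sum_(0 <= j < n) sin (angle k j) = 0.
Proof.
move=> kn; have s0 := sin_half_angle_gt0 kn.
apply/eqP; rewrite -(mulrI_eq0 _ (mulfI (lt0r_neq0 s0))); apply/eqP.
have E m : sin (angle k 1 / 2) * (\sum_(0 <= j < m) sin (angle k j)) =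
    (cos (angle k 1 / 2) - cos (angle k m - angle k 1 / 2)) / 2.
  elim: m => [|m IH]; first by rewrite big_geq // mulr0 angle0 sub0r cosN subrr mul0r.
  rewrite big_nat_recr //= mulrDr IH (angleS k m).
  have -> : angle k m + angle k 1 - angle k 1 / 2 = angle k m + angle k 1 / 2 by field.
  by rewrite cosB cosD; field.
by rewrite E angle_n [2 * pi * _ - _]addrC cos_add_2pi cosN subrr mul0r.
Qed.

Lemma angleC k j : angle k j = angle j k.
Proof. by rewrite /angle mulnC. Qed.

Lemma sum_cos_angleB k l : (k < n)%N -> (l < n)%N ->
  \sum_(0 <= j < n) cos (angle k j - angle l j) = (k == l)%:R * n%:R.
Proof.
wlog kl : k l / (k <= l)%N.
  move=> W kn ln; case: (leqP k l) => kl; first exact: W.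
  rewrite eq_sym -W ?(ltnW kl) //; apply: eq_bigr => j _.
  by rewrite -cosN opprB.
move=> kn ln; case: (eqVneq k l) => [->|nkl].
  by under eq_bigr do rewrite subrr cos0; rewrite sumr_const_nat subn0 mul1r.
rewrite mul0r -[RHS](@sum_cos_angle (l - k)); last by lia.
apply: eq_bigr => j _; rewrite -cosN opprB; congr cos.
by rewrite -{1}(subnK kl) angleDl addrK.
Qed.

Lemma sum_sin_angleB k l : (k < n)%N -> (l < n)%N ->
  \sum_(0 <= j < n) sin (angle k j - angle l j) = 0.
Proof.
wlog kl : k l / (k <= l)%N.
  move=> W kn ln; case: (leqP k l) => kl; first exact: W.
  transitivity (- \sum_(0 <= j < n) sin (angle l j - angle k j)).
    by rewrite -sumrN; apply: eq_bigr => j _; rewrite -sinN opprB.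
  by rewrite W ?oppr0 // ltnW.
move=> kn ln; case: (eqVneq k l) => [->|nkl].
  by under eq_bigr do rewrite subrr sin0; rewrite big1.
transitivity (- \sum_(0 <= j < n) sin (angle (l - k) j)).
  rewrite -sumrN; apply: eq_bigr => j _; rewrite -sinN; congr sin.
  by rewrite -{1}(subnK kl) angleDl; ring.
by rewrite sum_sin_angle ?oppr0 //; lia.
Qed.

Definition fourier_cos g k : R := \sum_(0 <= j < n) g j * cos (angle k j).
Definition fourier_sin g k : R := \sum_(0 <= j < n) g j * sin (angle k j).
Definition power_spectrum g k : R := fourier_cos g k ^+ 2 + fourier_sin g k ^+ 2.

(** The subtracted square is the frequency 0 term, so only nonzero frequencies see the variance. *)
Lemma parseval g :
  n%:R * (\sum_(0 <= j < n) g j ^+ 2) - (\sum_(0 <= j < n) g j) ^+ 2 =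
  \sum_(1 <= k < n) power_spectrum g k.
Proof.
have P k : power_spectrum g k =
    \sum_(0 <= i < n) \sum_(0 <= j < n) g i * g j * cos (angle i k - angle j k).
  rewrite /power_spectrum /fourier_cos /fourier_sin !expr2 !big_distrlr /= -big_split.
  apply: eq_bigr => i _; rewrite -big_split; apply: eq_bigr => j _ /=.
  by rewrite ![angle _ k]angleC cosB; ring.
have -> : (\sum_(0 <= j < n) g j) ^+ 2 = power_spectrum g 0.
  rewrite /power_spectrum /fourier_cos /fourier_sin.
  under eq_bigr => j _ do rewrite -[g j]mulr1 -cos0 -[0](angle0 j) angleC.
  rewrite [X in _ + X ^+ 2]big1 ?expr0n ?addr0 // => j _.
  by rewrite angleC angle0 sin0 mulr0.
apply/eqP; rewrite subr_eq addrC; apply/eqP.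
have -> : power_spectrum g 0 + \sum_(1 <= k < n) power_spectrum g k =
   \sum_(0 <= k < n) power_spectrum g k by rewrite [RHS]big_ltn.
under [RHS]eq_bigr do rewrite P.
rewrite exchange_big mulr_sumr /=; apply: eq_big_nat => i /andP[_ iN].
rewrite exchange_big (bigD1_seq i) ?mem_index_iota ?iota_uniq //=.
rewrite -mulr_sumr sum_cos_angleB // eqxx mul1r big_nat_cond big1 ?addr0; first by ring.
move=> j /andP[/andP[_ jn] ji].
by rewrite -mulr_sumr sum_cos_angleB // eq_sym (negbTE ji) mul0r mulr0.
Qed.

(* Differencing multiplies Fourier coefficients by exp(i x) - 1, of squared
   modulus (2 sin (x/2))^2. *)
Lemma power_spectrum_difference g k : g 0%N = g n ->
  power_spectrum (fun j => g j.+1 - g j) k =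
  4 * sin (angle k 1 / 2) ^+ 2 * power_spectrum g k.
Proof.
move=> g0n; set x := angle k 1.
have shift (f : nat -> R) : f 0%N = f n ->
    \sum_(0 <= j < n) f j.+1 = \sum_(0 <= j < n) f j.
  move=> f0n; rewrite -(prednK n0) in f0n *.
  by rewrite big_nat_recr //= [RHS]big_nat_recl //= -f0n addrC.
have c1 : fourier_cos (fun j => g j.+1 - g j) k =
    fourier_cos g k * (cos x - 1) + fourier_sin g k * sin x.
  rewrite /fourier_cos; under eq_bigr do rewrite mulrBl; rewrite sumrB.
  have -> : \sum_(0 <= j < n) g j.+1 * cos (angle k j) =
      \sum_(0 <= j < n) g j * cos (angle k j - x).
    rewrite -(shift (fun j => g j * cos (angle k j - x))).
      by apply: eq_bigr => j _; rewrite angleS addrK.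
    by rewrite g0n angle0 angle_n [_ * k%:R - x]addrC sub0r cos_add_2pi.
  rewrite !mulr_suml -sumrB -big_split; apply: eq_bigr => j _ /=.
  by rewrite cosB; ring.
have s1 : fourier_sin (fun j => g j.+1 - g j) k =
    fourier_sin g k * (cos x - 1) - fourier_cos g k * sin x.
  rewrite /fourier_sin; under eq_bigr do rewrite mulrBl; rewrite sumrB.
  have -> : \sum_(0 <= j < n) g j.+1 * sin (angle k j) =
      \sum_(0 <= j < n) g j * sin (angle k j - x).
    rewrite -(shift (fun j => g j * sin (angle k j - x))).
      by apply: eq_bigr => j _; rewrite angleS addrK.
    by rewrite g0n angle0 angle_n [_ * k%:R - x]addrC sub0r sin_add_2pi.
  rewrite !mulr_suml -!sumrB; apply: eq_bigr => j _ /=.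
  by rewrite sinB; ring.
rewrite /power_spectrum c1 s1.
have e : x = x / 2 + x / 2 by field.
have cx : cos x = 1 - 2 * sin (x / 2) ^+ 2.
  by rewrite {1}e cosD -!expr2 cos2sin2; ring.
have sx : sin x = 2 * (sin (x / 2) * cos (x / 2)) by rewrite {1}e sinD; ring.
have cc := cos2sin2 (x / 2).
set u := sin (x / 2) in cx sx cc *; set w := cos (x / 2) in sx cc.
set p := fourier_cos g k; set q := fourier_sin g k.
have sx2 : sin x ^+ 2 = 4 * u ^+ 2 * (1 - u ^+ 2) by rewrite sx -cc; ring.
rewrite cx; transitivity ((p ^+ 2 + q ^+ 2) * (4 * (u ^+ 2) ^+ 2 + sin x ^+ 2)).
  by ring.
by rewrite sx2; ring.
Qed.

Lemma power_spectrum_affine g k (a b : R) : (0 < k < n)%N ->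
  power_spectrum (fun j => a * g j + b) k = a ^+ 2 * power_spectrum g k.
Proof.
move=> kn; rewrite /power_spectrum.
have -> : fourier_cos (fun j => a * g j + b) k = a * fourier_cos g k.
  transitivity (a * fourier_cos g k + b * (\sum_(0 <= j < n) cos (angle k j))).
    by rewrite /fourier_cos !mulr_sumr -big_split; apply: eq_bigr => j _ /=; ring.
  by rewrite sum_cos_angle // mulr0 addr0.
have -> : fourier_sin (fun j => a * g j + b) k = a * fourier_sin g k.
  transitivity (a * fourier_sin g k + b * (\sum_(0 <= j < n) sin (angle k j))).
    by rewrite /fourier_sin !mulr_sumr -big_split; apply: eq_bigr => j _ /=; ring.
  by rewrite sum_sin_angle // mulr0 addr0.
ring.
Qed.

Lemma power_spectrum_sym g k : (k <= n)%N -> power_spectrum g (n - k) = power_spectrum g k.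
Proof.
move=> kn; rewrite /power_spectrum.
have aE j : angle (n - k) j = - angle k j + 2 * pi * j%:R.
  by have := angleDl (n - k) k j; rewrite subnK // [angle n j]angleC angle_n => ->; ring.
congr (_ ^+ 2 + _).
  by apply: eq_bigr => j _; rewrite aE cos_add_2pi cosN.
rewrite -[RHS]sqrrN; congr (_ ^+ 2).
by rewrite /fourier_sin -sumrN; apply: eq_bigr => j _; rewrite aE sin_add_2pi sinN mulrN.
Qed.

Lemma sin_half_angle_sym k : (k <= n)%N -> sin (angle (n - k) 1 / 2) = sin (angle k 1 / 2).
Proof.
move=> kn.
have -> : angle (n - k) 1 / 2 = pi - angle k 1 / 2.
  by rewrite /angle !muln1 natrB //; field; rewrite gt_eqF.
by rewrite sinB sinpi cospi mul0r sub0r mulN1r opprK.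
Qed.

Lemma sin_half_angle_ge k : (0 < k < n)%N -> (2 * k <= n)%N ->
  k%:R <= n%:R * sin (angle k 1 / 2).
Proof.
move=> /andP[k0 kn] k2n; have p2 := @pi_ge2 R; have p0 := @pi_gt0 R.
rewrite mulrC -ler_pdivrMr //.
have aE : angle k 1 / 2 = pi * (k%:R / n%:R).
  by rewrite /angle muln1; field; rewrite gt_eqF.
apply: le_trans (@sin_ge_half _ _ _).
  rewrite aE; have : 0 <= k%:R / n%:R :> R by rewrite divr_ge0.
  move: (k%:R / n%:R) => q q0; have : 0 <= (pi - 2) * q by rewrite mulr_ge0 //; lra.
  lra.
rewrite aE mulr_ge0 ?divr_ge0 ?(ltW p0) //= ler_pM2l // ler_pdivrMr //.
by rewrite ler_pdivlMl // -natrM ler_nat.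
Qed.

Section TrigonometricPolynomial.
Variables (K : nat) (p q : nat -> R).
Hypothesis Kn : (2 * K < n)%N.

Definition trig_poly j : R :=
  \sum_(1 <= k < K.+1) (p k * cos (angle k j) + q k * sin (angle k j)).

Lemma trig_poly_sum : \sum_(0 <= j < n) trig_poly j = 0.
Proof.
rewrite /trig_poly exchange_big /= big_nat_cond big1 // => k /andP[/andP[k1 kK] _].
by rewrite big_split /= -!mulr_sumr sum_cos_angle ?sum_sin_angle ?mulr0 ?addr0 //; lia.
Qed.

Lemma trig_poly_bound j : `|trig_poly j| <= \sum_(1 <= k < K.+1) (`|p k| + `|q k|).
Proof.
apply: le_trans (ler_norm_sum _ _ _) _; apply: ler_sum => k _.
apply: le_trans (ler_normD _ _) _; rewrite !normrM.
by apply: lerD; rewrite ler_piMr ?cos_max ?sin_max.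
Qed.

(** Orthogonality without aliasing: [2 * K < n] keeps every sum [k + l] of two frequencies strictly
    between 0 and [n], so only the terms with [k = l] survive. *)
Lemma trig_poly_energy :
  (\sum_(0 <= j < n) trig_poly j ^+ 2) / n%:R =
  2^-1 * \sum_(1 <= k < K.+1) (p k ^+ 2 + q k ^+ 2).
Proof.
have E j : trig_poly j ^+ 2 = \sum_(1 <= k < K.+1) \sum_(1 <= l < K.+1)
    2^-1 * ((p k * p l + q k * q l) * cos (angle k j - angle l j) +
            (p k * p l - q k * q l) * cos (angle (k + l) j) +
            (q k * p l - p k * q l) * sin (angle k j - angle l j) +
            (q k * p l + p k * q l) * sin (angle (k + l) j)).
  rewrite expr2 big_distrlr /=; apply: eq_bigr => k _; apply: eq_bigr => l _.
  by rewrite angleDl cosB cosD sinB sinD; field.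
under eq_bigr do rewrite E.
rewrite exchange_big mulr_suml mulr_sumr /=; apply: eq_big_nat => k /andP[k1 kK].
rewrite exchange_big /= (bigD1_seq k) ?mem_index_iota ?iota_uniq ?k1 //=.
have S l : (1 <= l < K.+1)%N -> \sum_(0 <= j < n)
    2^-1 * ((p k * p l + q k * q l) * cos (angle k j - angle l j) +
            (p k * p l - q k * q l) * cos (angle (k + l) j) +
            (q k * p l - p k * q l) * sin (angle k j - angle l j) +
            (q k * p l + p k * q l) * sin (angle (k + l) j)) =
    2^-1 * ((p k * p l + q k * q l) * ((k == l)%:R * n%:R)).
  move=> /andP[l1 lK]; rewrite -mulr_sumr !big_split /= -!mulr_sumr.
  by rewrite sum_cos_angleB ?sum_sin_angleB ?sum_cos_angle ?sum_sin_angle ?mulr0 ?addr0 //; lia.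
rewrite S ?k1 // eqxx mul1r big_nat_cond big1 ?addr0.
  by field; rewrite gt_eqF.
by move=> l /andP[lK lk]; rewrite S // eq_sym (negbTE lk) mul0r !mulr0.
Qed.

End TrigonometricPolynomial.

End DiscreteFourier.

(** * The scaled size as a spectral sum, and its truncation *)

Section WatsonStatistic.
Context {R : realType}.
Variables s t : nat.
Hypotheses (s0 : (0 < s)%N) (t0 : (0 < t)%N) (cop : coprime s t).
Local Notation n := (s + t)%N.
Implicit Type S : {set 'I_(s + t)}.

Let n0 : (0 < n)%N. Proof. by rewrite addn_gt0 s0. Qed.
Let sR : (0 : R) < s%:R. Proof. by rewrite ltr0n. Qed.
Let tR : (0 : R) < t%:R. Proof. by rewrite ltr0n. Qed.
Let nR : (0 : R) < n%:R. Proof. by rewrite ltr0n. Qed.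

Definition indicator S (j : nat) : R :=
  (if insub j is Some i then (i : 'I_(s + t)) \in S else false)%:R.

Definition cos_stat k := linear_stat (fun i : 'I_(s + t) => cos (angle n k i) : R).
Definition sin_stat k := linear_stat (fun i : 'I_(s + t) => sin (angle n k i) : R).

Definition spectrum S k : R := cos_stat k S ^+ 2 + sin_stat k S ^+ 2.

Lemma sum_indicator S (f : nat -> R) :
  \sum_(0 <= j < n) indicator S j * f j = linear_stat (fun i => f i) S.
Proof.
rewrite big_mkord /linear_stat [RHS]big_mkcond; apply: eq_bigr => i _.
by rewrite /indicator valK; case: (i \in S); rewrite ?mul1r ?mul0r.
Qed.

Lemma spectrumE S k : power_spectrum n (indicator S) k = spectrum S k.
Proof. by rewrite /power_spectrum /fourier_cos /fourier_sin !sum_indicator. Qed.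

Lemma spectrum_ge0 S k : 0 <= spectrum S k.
Proof. by rewrite addr_ge0 ?sqr_ge0. Qed.

Lemma spectrum_sym S k : (k <= n)%N -> spectrum S (n - k) = spectrum S k.
Proof. by move=> kn; rewrite -!spectrumE power_spectrum_sym. Qed.

(** The increments of the height are the affine image [n * indicator - s] of the indicator.
    Differencing accounts for the sine in the denominator, the factor [n] for [n ^+ 2], and the
    constant [s] is invisible at nonzero frequencies. *)
Lemma height_variance S : #|S| = s ->
  n%:R * (\sum_(0 <= j < n) (height S j)%:~R ^+ 2) - (\sum_(0 <= j < n) (height S j)%:~R) ^+ 2 =
  \sum_(1 <= k < n) n%:R ^+ 2 * spectrum S k / (4 * sin (angle n k 1 / 2) ^+ 2) :> R.
Proof.
move=> cS; rewrite parseval //; apply: eq_big_nat => k /andP[k1 kn].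
have kk : (0 < k < n)%N by rewrite k1.
have sk := sin_half_angle_gt0 (R := R) n0 kk.
rewrite -spectrumE -(power_spectrum_affine n0 (indicator S) n%:R (- s%:R)) //.
have <- : power_spectrum n (fun j => (height S j.+1)%:~R - (height S j)%:~R) k =
    power_spectrum n (fun j => n%:R * indicator S j + - s%:R) k :> R.
  have E j : (j < n)%N -> (height S j.+1)%:~R - (height S j)%:~R = n%:R * indicator S j - s%:R :> R.
    move=> jn; rewrite -(rmorphB intr) /= (heightS s0 t0 cop S (Ordinal jn)) addrAC subrr add0r.
    rewrite /indicator insubT /= -[Sub j jn]/(Ordinal jn).
    case: (Ordinal jn \in S) => /=; first by rewrite mulr1 natrD addrAC subrr add0r.
    by rewrite mulr0 sub0r rmorphN.
  rewrite /power_spectrum /fourier_cos /fourier_sin; congr (_ ^+ 2 + _ ^+ 2);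
    by apply: eq_big_nat => j /andP[_ jn]; rewrite E.
rewrite power_spectrum_difference //; last by rewrite height0 height_end.
by field; rewrite gt_eqF.
Qed.

(** Watson's two-sample statistic of [S] against its complement, in spectral form:
    [height S j / (s t)] is the difference of the two empirical distribution functions. *)
Definition watson S : R :=
  \sum_(1 <= k < n) spectrum S k / (s%:R * t%:R * n%:R * (4 * sin (angle n k 1 / 2) ^+ 2)).

(** The additive constant of [encodes_size] after scaling, of order [n / (s t)]. *)
Definition size_shift : R := (n%:R ^+ 2 - 1) / (12 * s%:R * t%:R * n%:R).

Lemma scaled_size_word S : #|S| = s ->
  scaled_size R s t (core_of_word S).1 = watson S - size_shift.
Proof.
move=> cS; have := encodes_size s0 t0 cop (encodingP s0 t0 cop cS).
move=> /(congr1 (fun z : int => z%:~R : R)).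
rewrite /core_of_word /= /scaled_size /size_shift -natrD; move: (partition_size _) => z.
rewrite !(rmorphM, rmorphB, rmorphXn, rmorph1) /= !rmorph_sum /=.
under eq_bigr do rewrite rmorphXn /=.
rewrite (height_variance cS) => E.
have W : \sum_(1 <= k < n) n%:R ^+ 2 * spectrum S k / (4 * sin (angle n k 1 / 2) ^+ 2) =
    s%:R * t%:R * n%:R ^+ 3 * watson S.
  rewrite /watson mulr_sumr; apply: eq_big_nat => k /andP[k1 kn].
  have kk : (0 < k < n)%N by rewrite k1.
  have sk := sin_half_angle_gt0 (R := R) n0 kk.
  by field; rewrite -?natrD !gt_eqF.
rewrite W in E.
move: E; rewrite -!pmulrn => E.
have : z%:R = (12 * (s%:R * t%:R * n%:R ^+ 3 * watson S) - n%:R ^+ 2 * (n%:R ^+ 2 - 1)) / (24 * n%:R ^+ 2) :> R.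
  by rewrite -!expr2 in E; rewrite -E; field; rewrite -?natrD !gt_eqF.
by move=> ->; field; rewrite -?natrD !gt_eqF.
Qed.

(** Only the order [s t / n] matters, so bounding the cosine and sine parts separately by the crude
    second-moment estimate suffices. *)
Lemma average_spectrum k : (0 < k < n)%N ->
  average (spectrum ^~ k) <= 4 * (s%:R * t%:R / n%:R).
Proof.
move=> kn; rewrite averageD.
have c1 : \sum_(i < n) cos (angle n k i) = 0 :> R.
  by rewrite -(big_mkord xpredT (fun i => cos (angle n k i))) sum_cos_angle.
have c2 : \sum_(i < n) sin (angle n k i) = 0 :> R.
  by rewrite -(big_mkord xpredT (fun i => sin (angle n k i))) sum_sin_angle.
have h1 := average_linear_stat_sqr s0 c1 (fun i => cos_max _).
have h2 := average_linear_stat_sqr s0 c2 (fun i => sin_max _).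
rewrite expr1n mulr1 in h1 h2; rewrite /cos_stat /sin_stat; lra.
Qed.

(** Here [n sin (pi k / n)] is replaced by its limit [pi k], and the factor 2 accounts for the
    mirror frequency [n - k]. *)
Definition watson_trunc (K : nat) S : R :=
  \sum_(1 <= k < K.+1) n%:R / (s%:R * t%:R) * (2 * spectrum S k) / (4 * pi ^+ 2 * k%:R ^+ 2).

(** The mean cost of replacing the sines; 8 is the mirror factor 2 times the constant 4 of
    [average_spectrum]. *)
Definition coef_error (K m : nat) : R :=
  8 * \sum_(1 <= k < K.+1)
    `|(4 * (m%:R * sin (angle m k 1 / 2)) ^+ 2)^-1 - (4 * pi ^+ 2 * k%:R ^+ 2)^-1|.

Lemma sum_inv_sqr_le (K M : nat) : (0 < K)%N ->
  \sum_(K.+1 <= k < M) (k%:R ^+ 2)^-1 <= K%:R^-1 :> R.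
Proof.
(* Telescoping [1/k^2 <= 1/(k-1) - 1/k]; the [maxn] keeps the strengthened bound true when the sum
   is empty. *)
move=> K0; suff : \sum_(K.+1 <= k < M) (k%:R ^+ 2)^-1 <= K%:R^-1 - (maxn K M.-1)%:R^-1 :> R.
  by move=> /le_trans; apply; rewrite gerBl invr_ge0.
elim: M => [|M IH]; first by rewrite big_geq // maxn0 subrr.
rewrite [M.+1.-1]/=.
case: (ltnP K M) => KM; last by rewrite big_geq // subrr.
rewrite big_nat_recr //=; apply: le_trans (lerD IH (lexx _)) _.
have -> : maxn K M.-1 = M.-1 by apply/maxn_idPr; lia.
rewrite -addrA lerD2l -subr_ge0.
have M1 : (0 : R) < M.-1%:R by rewrite ltr0n; lia.
have -> : M%:R = M.-1%:R + 1 :> R by rewrite natr1 prednK //; lia.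
move: (M.-1%:R : R) M1 => x x0.
have -> : - (x + 1)^-1 - (- x^-1 + ((x + 1) ^+ 2)^-1) = (x * (x + 1) ^+ 2)^-1.
  by field; rewrite !gt_eqF //; lra.
by rewrite invr_ge0 !mulr_ge0 ?exprn_ge0 //; lra.
Qed.

(** The frequencies strictly between [K] and [n - K] contribute at most [2 / K] in mean. The outer
    ones pair up as [k] and [n - k], and there only the coefficients differ. *)
Lemma watson_trunc_error (K : nat) : (0 < K)%N -> (2 * K < n)%N ->
  average (fun S => `|watson S - watson_trunc K S|) <= 2 / K%:R + coef_error K n.
Proof.
move=> K0 Kn.
pose T S k := spectrum S k / (s%:R * t%:R * n%:R * (4 * sin (angle n k 1 / 2) ^+ 2)).
have T0 S k : 0 <= T S k.
  apply: divr_ge0; first exact: spectrum_ge0.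
  by apply: mulr_ge0; [rewrite !mulr_ge0|apply: mulr_ge0 => //; exact: sqr_ge0].
have Tsym S k : (k <= n)%N -> T S (n - k)%N = T S k.
  by move=> kn; rewrite /T spectrum_sym // sin_half_angle_sym.
have avT k : (0 < k < n)%N -> average (T ^~ k) <= ((n%:R * sin (angle n k 1 / 2)) ^+ 2)^-1.
  move=> kn; have sk := sin_half_angle_gt0 (R := R) n0 kn.
  rewrite /T; under eq_average => S _ do rewrite mulrC.
  rewrite averageZ mulrC ler_pdivrMr ?mulr_gt0 ?exprn_gt0 //.
  apply: le_trans (average_spectrum kn) _.
  rewrite le_eqVlt; apply/orP; left; apply/eqP; field.
  by rewrite -?natrD !gt_eqF.
(* Adding the two inverse squares, instead of taking the larger one, gives a single formula on the
   whole range; reflection then makes the two resulting sums equal. *)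
have avT2 k : (0 < k < n)%N -> average (T ^~ k) <= (k%:R ^+ 2)^-1 + ((n - k)%N%:R ^+ 2)^-1.
  move=> kn; apply: le_trans (avT k kn) _; have /andP[k0 kn'] := kn.
  case: (leqP (2 * k) n) => k2.
    apply: (@le_trans _ _ (k%:R ^+ 2)^-1); last by rewrite lerDl invr_ge0 sqr_ge0.
    rewrite lef_pV2 ?posrE ?exprn_gt0 ?mulr_gt0 ?ltr0n ?sin_half_angle_gt0 //.
    have h := sin_half_angle_ge (R := R) n0 kn k2.
    by rewrite lerXn2r ?nnegrE //; apply: le_trans h.
  apply: (@le_trans _ _ ((n - k)%N%:R ^+ 2)^-1); last by rewrite lerDr invr_ge0 sqr_ge0.
  have nk : (0 < n - k < n)%N by lia.
  rewrite -(sin_half_angle_sym (R := R) n0 (ltnW kn')).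
  have := sin_half_angle_ge (R := R) n0 nk; move=> /(_ (ltac:(lia))) h.
  rewrite lef_pV2 ?posrE ?exprn_gt0 ?mulr_gt0 ?ltr0n ?sin_half_angle_gt0 //; last by lia.
  by rewrite lerXn2r ?nnegrE //; apply: le_trans h.
have split S : watson S = \sum_(1 <= k < K.+1) 2 * T S k + \sum_(K.+1 <= k < n - K) T S k.
  have -> : watson S = \sum_(1 <= k < n) T S k by [].
  have hK : \sum_(n - K <= k < n) T S k = \sum_(1 <= k < K.+1) T S k.
    rewrite -{1}(add0n (n - K)%N) big_addn (_ : (n - (n - K))%N = K); last by lia.
    rewrite big_add1 /= big_nat_rev /=; apply: eq_big_nat => i /andP[_ iK].
    by rewrite add0n -Tsym; [congr T; lia|lia].
  rewrite (big_cat_nat (n := K.+1)) //=; last by lia.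
  rewrite [X in _ + X](big_cat_nat (n := (n - K)%N)) //=; [|lia|exact: leq_subr].
  by rewrite hK -mulr_sumr; ring.
have bound S : `|watson S - watson_trunc K S| <=
    \sum_(K.+1 <= k < n - K) T S k + \sum_(1 <= k < K.+1)
     2 * (n%:R / (s%:R * t%:R)) * `|(4 * (n%:R * sin (angle n k 1 / 2)) ^+ 2)^-1 -
        (4 * pi ^+ 2 * k%:R ^+ 2)^-1| * spectrum S k.
  rewrite split /watson_trunc addrAC -sumrB addrC; apply: le_trans (ler_normD _ _) _.
  apply: lerD; first by rewrite ger0_norm // sumr_ge0.
  apply: le_trans (ler_norm_sum _ _ _) _; apply: ler_sum_nat => k /andP[k1 kK].
  have kn : (0 < k < n)%N by lia.
  have sk := sin_half_angle_gt0 (R := R) n0 kn.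
  have k0 : (0 : R) < k%:R by rewrite ltr0n.
  have c0 : 0 <= 2 * (n%:R / (s%:R * t%:R)) * spectrum S k.
    by rewrite !mulr_ge0 ?spectrum_ge0 ?invr_ge0 ?mulr_ge0 ?(ltW sR) ?(ltW tR) ?(ltW nR).
  set e := ((4 * (n%:R * sin (angle n k 1 / 2)) ^+ 2)^-1 - (4 * pi ^+ 2 * k%:R ^+ 2)^-1).
  rewrite [X in _ <= X]mulrAC -{1}(ger0_norm c0) -normrM.
  rewrite le_eqVlt; apply/orP; left; apply/eqP; congr `|_|; rewrite /T /e.
  have := @pi_gt0 R; move: (@pi R) => p p0; field.
  by rewrite -?natrD !gt_eqF.
apply: (@le_trans _ _ (average (fun S => \sum_(K.+1 <= k < n - K) T S k + \sum_(1 <= k < K.+1)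
     2 * (n%:R / (s%:R * t%:R)) * `|(4 * (n%:R * sin (angle n k 1 / 2)) ^+ 2)^-1 -
        (4 * pi ^+ 2 * k%:R ^+ 2)^-1| * spectrum S k))).
  by apply: le_average => S _; exact: bound.
rewrite averageD !average_sum; apply: lerD.
  apply: (@le_trans _ _ (\sum_(K.+1 <= k < n - K) ((k%:R ^+ 2)^-1 + ((n - k)%N%:R ^+ 2)^-1))).
    by apply: ler_sum_nat => k /andP[k1 kK]; apply: avT2; lia.
  rewrite big_split /=.
  have -> : \sum_(K.+1 <= k < n - K) ((n - k)%N%:R ^+ 2)^-1 = \sum_(K.+1 <= k < n - K) (k%:R ^+ 2)^-1 :> R.
    rewrite big_nat_rev /=; apply: eq_big_nat => k /andP[k1 kK].
    by congr ((_%:R ^+ 2)^-1); lia.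
  by have := sum_inv_sqr_le (n - K) K0; lra.
rewrite /coef_error mulr_sumr; apply: ler_sum_nat => k /andP[k1 kK].
rewrite averageZ; set e := `|_ - _|.
have kn : (0 < k < n)%N by lia.
have := average_spectrum kn => h.
apply: (@le_trans _ _ (2 * (n%:R / (s%:R * t%:R)) * e * (4 * (s%:R * t%:R / n%:R)))).
  by rewrite ler_wpM2l // !mulr_ge0 ?invr_ge0 ?mulr_ge0 ?(ltW sR) ?(ltW tR) ?(ltW nR) // normr_ge0.
rewrite le_eqVlt; apply/orP; left; apply/eqP; field.
by rewrite -?natrD !gt_eqF.
Qed.

End WatsonStatistic.

Lemma cvg_coef_error (R : realType) (K : nat) : coef_error K m @[m --> \oo] --> (0 : R).
Proof.
rewrite /coef_error -[X in _ --> X](mulr0 8); apply: cvgMr.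
elim: K => [|K IH].
  by under eq_cvg do rewrite big_geq //; exact: cvg_cst.
set k := K.+1; pose L := (4 * pi ^+ 2 * k%:R ^+ 2 : R)^-1.
pose f m : R := `|(4 * (m%:R * sin (angle m k 1 / 2)) ^+ 2)^-1 - L|.
suff cf : f m @[m --> \oo] --> (0 : R).
  pose F m j : R := `|(4 * (m%:R * sin (angle m j 1 / 2)) ^+ 2)^-1 - (4 * pi ^+ 2 * j%:R ^+ 2)^-1|.
  have h : (fun m => (\sum_(1 <= j < k) F m j) + f m) = (fun m => \sum_(1 <= j < k.+1) F m j).
    by apply/funext => m; rewrite [RHS]big_nat_recr.
  suff : (fun m => \sum_(1 <= j < k.+1) F m j) @ \oo --> (0 : R) by [].
  by rewrite -h; have := cvgD IH cf; rewrite addr0; exact.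
have pk : 0 < pi * k%:R :> R by rewrite mulr_gt0 ?pi_gt0 ?ltr0n.
have sc : (m%:R * sin (angle m k 1 / 2) : R) @[m --> \oo] --> pi * k%:R.
  apply/cvgrPdist_le => e e0; near=> m.
  have m0 : (0 < m)%N by near: m; exact: nbhs_infty_gt.
  have mR : (0 : R) < m%:R by rewrite ltr0n.
  pose x : R := angle m k 1 / 2.
  have xE : x = pi * k%:R / m%:R by rewrite /x /angle muln1; field; rewrite gt_eqF.
  have := sin_taylor2 0 x; rewrite add0r sin0 subr0 cos0 mulr1 => h.
  have -> : pi * k%:R - m%:R * sin (angle m k 1 / 2) = - (m%:R * (sin x - x)).
    have mx : m%:R * x = pi * k%:R by rewrite xE; field; rewrite gt_eqF.
    by rewrite mulrBr mx /x; ring.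
  rewrite normrN normrM (ger0_norm (ltW mR)).
  apply: (@le_trans _ _ (m%:R * x ^+ 2)); first by rewrite ler_pM2l.
  have -> : m%:R * x ^+ 2 = (pi * k%:R) ^+ 2 / m%:R by rewrite xE; field; rewrite gt_eqF.
  rewrite ler_pdivrMr // -ler_pdivrMl //.
  by near: m; exact: nbhs_infty_ger.
have : f m @[m --> \oo] --> `|L - L|.
  apply: cvg_norm; apply: cvgB; last exact: cvg_cst.
  have -> : L = (4 * (pi * k%:R) ^+ 2)^-1 by rewrite /L; congr (_^-1); ring.
  apply: cvgV; first by rewrite gt_eqF // mulr_gt0 // exprn_gt0.
  by apply: cvgMr; rewrite !expr2; apply: cvgM.
by rewrite subrr normr0.
Unshelve. all: by end_near. Qed.

(** * Characteristic function of the standard normal law *)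

Section NormalCharacteristicFunction.
Context {R : realType}.
Notation mu := (@lebesgue_measure R).
Implicit Types b c x : R.

Let p : R -> R := normal_pdf 0 1.

Let pE x : p x = normal_peak 1 * expR (- (x ^+ 2 / 2)).
Proof.
by rewrite /p normal_pdfE ?oner_neq0 // /normal_fun subr0 expr1n mulNr.
Qed.

Let p0 x : 0 <= p x. Proof. exact: normal_pdf_ge0. Qed.

Let mp : measurable_fun setT p. Proof. exact: measurable_normal_pdf. Qed.

Lemma integrable_normal_sqr : mu.-integrable setT (fun x => (x ^+ 2 * normal_pdf 0 1 x)%:E).
Proof.
(* The dominating function is a multiple of the normal density of variance 2: half of the exponent
   absorbs the square, since [x ^+ 2 <= 4 * expR (x ^+ 2 / 4)]. *)
pose s : R := Num.sqrt 2.
have s2 : s ^+ 2 = 2 by rewrite sqr_sqrtr.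
have s0 : s != 0 by rewrite -sqrf_eq0 s2.
have k0 : 0 < normal_peak s :> R by exact: normal_peak_gt0.
have := integrable_normal_pdf 0 s.
move=> /(integrableZl measurableT (4 * normal_peak 1 / normal_peak s)).
apply: le_integrable => //.
  by apply/measurable_EFinP; apply: measurable_funM => //; exact: measurable_funX.
move=> x _; rewrite -EFinM lee_fin ger0_norm; last by rewrite mulr_ge0 ?sqr_ge0 ?normal_pdf_ge0.
apply: le_trans (ler_norm _).
rewrite -/(p x) pE normal_pdfE // /normal_fun subr0 s2.
have -> : 2 *+ 2 = 4 :> R by ring.
have -> : - (x ^+ 2 / 2) = - x ^+ 2 / 4 + - x ^+ 2 / 4 by field.
rewrite expRD.
set e := expR _.
have e0 : 0 < e by exact: expR_gt0.
have -> : 4 * normal_peak 1 / normal_peak s * (normal_peak s * e) = 4 * normal_peak 1 * e.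
  by field; rewrite gt_eqF.
have -> : x ^+ 2 * (normal_peak 1 * (e * e)) = (x ^+ 2 * e) * (normal_peak 1 * e) by ring.
have -> : 4 * normal_peak 1 * e = 4 * (normal_peak 1 * e) by ring.
rewrite ler_wpM2r ?mulr_ge0 ?normal_peak_ge0 ?(ltW e0) //.
rewrite /e mulNr expRN ler_pdivrMr ?expR_gt0 //.
by have := expR_ge1Dx (x ^+ 2 / 4); lra.
Qed.

Lemma integrable_normal_quadratic (f : R -> R) (A B : R) : measurable_fun setT f ->
  (forall x, `|f x| <= A + B * x ^+ 2) ->
  mu.-integrable setT (fun x => (f x * normal_pdf 0 1 x)%:E).
Proof.
move=> mf fAB.
have i1 := integrableZl measurableT A (integrable_normal_pdf 0 1).
have i2 := integrableZl measurableT B integrable_normal_sqr.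
apply: le_integrable (integrableD measurableT i1 i2) => //.
  by apply/measurable_EFinP; apply: measurable_funM.
move=> x _; rewrite -!EFinM -EFinD lee_fin normrM.
apply: le_trans (ler_norm _); rewrite (ger0_norm (normal_pdf_ge0 _ _ _)).
by rewrite mulrA -mulrDl ler_wpM2r // normal_pdf_ge0.
Qed.

Let measurable_phase c th (f : R -> R) : continuous f -> measurable_fun setT (fun x => f (c * x + th)).
Proof.
move=> cf; apply: continuous_measurable_fun => x.
apply: continuous_comp; last exact: cf.
by apply: cvgD; [apply: cvgMr; exact: cvg_id|exact: cvg_cst].
Qed.

(* Integration by parts: the integrand is the derivative of
   [sin (c * x + th) * p x]. *)
Lemma normal_stein c th :
  \int[mu]_x ((c * cos (c * x + th) - x * sin (c * x + th)) * normal_pdf 0 1 x) = 0.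
Proof.
pose g x := (c * cos (c * x + th) - x * sin (c * x + th)) * p x.
pose G x := sin (c * x + th) * p x.
have mg : measurable_fun setT (fun x => c * cos (c * x + th) - x * sin (c * x + th)).
  apply: measurable_funB.
    by apply: measurable_funM => //; apply: measurable_phase; exact: continuous_cos.
  by apply: measurable_funM => //; apply: measurable_phase; exact: continuous_sin.
have ig : mu.-integrable setT (EFin \o g).
  apply: (@integrable_normal_quadratic _ (`|c| + 1) 1) => // x.
  apply: le_trans (ler_normB _ _) _; rewrite !normrM.
  have h1 : `|c| * `|cos (c * x + th)| <= `|c| by rewrite ler_piMr // cos_max.
  have h2 : `|x| * `|sin (c * x + th)| <= `|x| by rewrite ler_piMr // sin_max.
  have h3 : `|x| <= 1 + x ^+ 2.
    have := sqr_ge0 (`|x| - 1); rewrite sqrrB1 real_normK ?num_real //.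
    by have := sqr_ge0 x; lra.
  by lra.
have dG x : is_derive x 1 G (g x).
  have d1 : is_derive x (1 : R) (fun y : R => c * y + th) c.
    have -> : (fun y : R => c * y + th) = (c \*: (@id R)) + cst th by [].
    by apply: is_derive_eq; rewrite addr0 /GRing.scale /= mulr1.
  have d2 : is_derive x (1 : R) (fun y : R => - (y ^+ 2 / 2)) (- x).
    have -> : (fun y : R => - (y ^+ 2 / 2)) = (- 2^-1) \*: ((@id R) ^+ 2).
      by apply/funext => y; change (- (y ^+ 2 / 2) = - 2^-1 * (y ^+ 2)); ring.
    by apply: is_derive_eq; rewrite /GRing.scale /= expr1; field.
  have d3 := is_derive1_comp (is_derive_sin _) d1.
  have d4 := is_derive1_comp (is_derive_expR _) d2.
  have -> : G = (@sin R \o (fun y => c * y + th)) *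
      (normal_peak 1 \*: (@expR R \o (fun y => - (y ^+ 2 / 2)))).
    by apply/funext => y; rewrite /G pE.
  apply: is_derive_eq; rewrite /GRing.scale /= /g pE /GRing.scale /=; ring.
have cg : continuous g.
  move=> x; apply: cvgM; last exact: continuous_normal_pdf.
  have cl : (fun y => c * y + th) y @[y --> x] --> c * x + th.
    by apply: cvgD; [apply: cvgMr; exact: cvg_id|exact: cvg_cst].
  apply: cvgB; first by apply: cvgMr; apply: continuous_comp cl _; exact: continuous_cos.
  by apply: cvgM; [exact: cvg_id|apply: continuous_comp cl _; exact: continuous_sin].
(* On [[-N, N]] the integral is a difference of boundary values of [G], which vanish in the limit;
   dominated convergence identifies the same limit with the full integral. *)
pose f_ (N : nat) := (EFin \o g) \_ (`[- N%:R, N%:R] : set R).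
have lim1 : (\int[mu]_x f_ N x)%E @[N --> \oo] --> (\int[mu]_x (g x)%:E)%E.
  have mgE : measurable_fun setT (EFin \o g).
    by apply/measurable_EFinP; exact: continuous_measurable_fun.
  have mf_ N : measurable_fun setT (f_ N).
    by apply/(measurable_restrictT _ _).1 => //; exact: measurable_funTS.
  have cf_ : {ae mu, forall x, setT x -> f_ ^~ x @ \oo --> (EFin \o g) x}.
    apply: aeW => x _; apply: cvg_near_cst; near=> N; rewrite /f_ patchE ifT //.
    rewrite inE /= in_itv /=; apply/andP; split; last first.
      by apply: (le_trans (ler_norm _)); near: N; exact: nbhs_infty_ger.
    by rewrite lerNl; apply: (le_trans (ler_norm _)); rewrite normrN; near: N; exact: nbhs_infty_ger.
  have df_ : {ae mu, forall x N, setT x -> (`|f_ N x| <= (abse \o (EFin \o g)) x)%E}.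
    by apply: aeW => x N _; rewrite /f_ patchE; case: ifP => _ //=; rewrite normr0 lee_fin.
  by have [_ _ ] := @dominated_convergence _ (measurableTypeR R) R mu setT measurableT f_ (EFin \o g)
    (abse \o (EFin \o g)) mf_ mgE cf_ (integrable_abse ig) df_.
have lim2 : (\int[mu]_x f_ N x)%E @[N --> \oo] --> 0%:E.
  have E (N : nat) : (0 < N)%N -> (\int[mu]_x f_ N x = (G N%:R - G (- N%:R))%:E)%E.
    move=> N0; rewrite -integral_mkcond EFinB; apply: continuous_FTC2.
    - by have NR : (0 : R) < N%:R; [rewrite ltr0n|lra].
    - exact: continuous_subspaceT.
    - split.
      + by move=> x _; case: (dG x).
      + apply: cvg_at_right_filter; apply: differentiable_continuous.
        by apply/derivable1_diffP; case: (dG (- N%:R)).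
      + apply: cvg_at_left_filter; apply: differentiable_continuous.
        by apply/derivable1_diffP; case: (dG N%:R).
    - by move=> x _; rewrite derive1E; case: (dG x).
  apply: (@cvg_trans _ ((G N%:R - G (- N%:R))%:E @[N --> \oo])).
    apply: near_eq_cvg; near=> N; rewrite E //; near: N; exact: nbhs_infty_gt.
  apply: cvg_EFin; first by apply: nearW.
  apply/cvgrPdist_le => e e0; near=> N; rewrite /= sub0r normrN.
  have pN : normal_peak 1 * expR (- (N%:R ^+ 2 / 2)) <= e / 2.
    have Ne : normal_peak 1 / (e / 2) <= N%:R by near: N; exact: nbhs_infty_ger.
    rewrite expRN ler_pdivrMr ?expR_gt0 //.
    have Nx : N%:R <= expR (N%:R ^+ 2 / 2) :> R.
      apply: le_trans (expR_ge1Dx _); have := sqr_ge0 (N%:R - 1 : R).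
      by rewrite sqrrB1; have := ler0n R N; lra.
    apply: (@le_trans _ _ (e / 2 * N%:R)); last by rewrite ler_pM2l ?divr_gt0.
    by rewrite mulrC -ler_pdivrMr ?divr_gt0.
  apply: le_trans (ler_normB _ _) _; rewrite /G !normrM !pE sqrrN.
  have k0 : 0 <= normal_peak 1 * expR (- (N%:R ^+ 2 / 2)) :> R by rewrite mulr_ge0 ?normal_peak_ge0 ?expR_ge0.
  rewrite (ger0_norm k0).
  have h1 : `|sin (c * N%:R + th)| * (normal_peak 1 * expR (- (N%:R ^+ 2 / 2))) <= e / 2.
    by apply: le_trans pN; rewrite ler_piMl // sin_max.
  have h2 : `|sin (c * - N%:R + th)| * (normal_peak 1 * expR (- (N%:R ^+ 2 / 2))) <= e / 2.
    by apply: le_trans pN; rewrite ler_piMl // sin_max.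
  by lra.
by have := cvg_unique _ lim1 lim2 => /(_ _) h; rewrite /Rintegral h.
Unshelve. all: by end_near. Qed.

(** Scaling the frequency by [r] in [0,1], Stein's identity makes [F' = - r b^2 F] exact, so
    [gaussian_ode] applies with error 0. *)
Lemma normal_char_fun b th :
  \int[mu]_x (cos (b * x + th) * normal_pdf 0 1 x) = cos th * expR (- (b ^+ 2 / 2)).
Proof.
pose F r := \int[mu]_x (cos (r * b * x + th) * p x).
pose dF r := \int[mu]_x (- (b * x * sin (r * b * x + th)) * p x).
have mc r : measurable_fun setT (fun x => cos (r * b * x + th)).
  by apply: measurable_phase; exact: continuous_cos.
have ms r : measurable_fun setT (fun x => - (b * x * sin (r * b * x + th))).
  apply: measurable_funN; apply: measurable_funM.
    by apply: measurable_funM.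
  by apply: measurable_phase; exact: continuous_sin.
have ic r : mu.-integrable setT (fun x => (cos (r * b * x + th) * p x)%:E).
  by apply: (@integrable_normal_quadratic _ 1 0) => // x; rewrite mul0r addr0 cos_max.
have ab x : `|x| <= 1 + x ^+ 2.
  have := sqr_ge0 (`|x| - 1); rewrite sqrrB1 real_normK ?num_real //.
  by have := sqr_ge0 x; lra.
have is_ r : mu.-integrable setT (fun x => (- (b * x * sin (r * b * x + th)) * p x)%:E).
  apply: (@integrable_normal_quadratic _ `|b| `|b|) => // x.
  have -> : `|b| + `|b| * x ^+ 2 = `|b| * (1 + x ^+ 2) by ring.
  rewrite normrN 2!normrM -mulrA ler_wpM2l //.
  by apply: le_trans (ab x); rewrite ler_piMr // sin_max.
pose M := \int[mu]_x ((b * x) ^+ 2 * p x).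
have iM : mu.-integrable setT (fun x => ((b * x) ^+ 2 * p x)%:E).
  apply: (@integrable_normal_quadratic _ 0 (b ^+ 2)).
    by apply: measurable_funX; exact: measurable_funM.
  by move=> x; rewrite add0r exprMn ger0_norm // mulr_ge0 ?sqr_ge0.
have -> : \int[mu]_x (cos (b * x + th) * normal_pdf 0 1 x) = F 1.
  by apply: eq_Rintegral => x _; rewrite mul1r.
have <- : F 0 = cos th.
  rewrite /F; under eq_Rintegral do rewrite !mul0r add0r.
  rewrite RintegralZl //; last exact: integrable_normal_pdf.
  by rewrite /Rintegral integral_normal_pdf mulr1.
apply/eqP; rewrite -subr_eq0 -normr_le0; apply: (@gaussian_ode _ F dF M) => //; first exact: sqr_ge0.
- move=> r h.
  have e1 : \int[mu]_x (cos ((r + h) * b * x + th) * p x - cos (r * b * x + th) * p x) =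
      F (r + h) - F r.
    exact: (@RintegralB _ (measurableTypeR R) R mu setT _ _ measurableT (ic _) (ic _)).
  have e2 : \int[mu]_x (h * (- (b * x * sin (r * b * x + th)) * p x)) = h * dF r.
    exact: (@RintegralZl _ (measurableTypeR R) R mu setT _ h measurableT (is_ r)).
  have -> : F (r + h) - F r - h * dF r = \int[mu]_x
      ((cos ((r + h) * b * x + th) * p x - cos (r * b * x + th) * p x) -
        h * (- (b * x * sin (r * b * x + th)) * p x)).
    rewrite -e1 -e2; apply/esym/RintegralB => //.
      exact: (integrableB measurableT (ic _) (ic _)).
    exact: (integrableZl measurableT h (is_ r)).
  have i3 : mu.-integrable setT (EFin \o (fun x =>
      (cos ((r + h) * b * x + th) * p x - cos (r * b * x + th) * p x) -
        h * (- (b * x * sin (r * b * x + th)) * p x))).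
    exact: (integrableB measurableT (integrableB measurableT (ic _) (ic _))
      (integrableZl measurableT h (is_ r))).
  apply: le_trans (le_normr_Rintegral measurableT i3) _.
  have e4 : \int[mu]_x (h ^+ 2 * ((b * x) ^+ 2 * p x)) = h ^+ 2 * M.
    exact: (@RintegralZl _ (measurableTypeR R) R mu setT _ (h ^+ 2) measurableT iM).
  rewrite [M * _]mulrC -e4; apply: (@le_Rintegral _ (measurableTypeR R) R mu setT _ _ measurableT
    (integrable_abse i3) (integrableZl measurableT (h ^+ 2) iM)).
  move=> x _; have := cos_taylor2 (r * b * x + th) (h * (b * x)).
  set u := r * b * x + th; have -> : (r + h) * b * x + th = u + h * (b * x) by rewrite /u; ring.
  move=> hu; have -> : cos (u + h * (b * x)) * p x - cos u * p x - h * (- (b * x * sin u) * p x) =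
    (cos (u + h * (b * x)) - cos u - h * (b * x) * - sin u) * p x by ring.
  rewrite normrM (ger0_norm (p0 _)) [X in _ <= X]mulrA ler_wpM2r //.
  by apply: le_trans hu _; rewrite exprMn.
- move=> r _; rewrite /dF /F.
  have := normal_stein (r * b) th => st.
  have -> : r * b ^+ 2 = b * (r * b) by ring.
  have e5 : \int[mu]_x (b * (r * b) * (cos (r * b * x + th) * p x)) = b * (r * b) * F r.
    exact: (@RintegralZl _ (measurableTypeR R) R mu setT _ (b * (r * b)) measurableT (ic r)).
  have e6 := @RintegralD _ (measurableTypeR R) R mu setT _ _ measurableT (is_ r)
    (integrableZl measurableT (b * (r * b)) (ic r)).
  have ig : mu.-integrable setT (fun x =>
      ((r * b * cos (r * b * x + th) - x * sin (r * b * x + th)) * p x)%:E).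
    apply: (@integrable_normal_quadratic _ (`|r * b| + 1) 1).
      apply: measurable_funB; first by apply: measurable_funM.
      by apply: measurable_funM => //; apply: measurable_phase; exact: continuous_sin.
    move=> x; apply: le_trans (ler_normB _ _) _; rewrite [X in X + _]normrM [X in _ + X]normrM.
    have h1 : `|r * b| * `|cos (r * b * x + th)| <= `|r * b| by rewrite ler_piMr // cos_max.
    have h2 : `|x| * `|sin (r * b * x + th)| <= `|x| by rewrite ler_piMr // sin_max.
    by apply: le_trans (lerD h1 h2) _; rewrite mul1r -addrA lerD2l; exact: ab.
  have e7 := @RintegralZl _ (measurableTypeR R) R mu setT _ b measurableT ig.
  have e8 : \int[mu]_x (- (b * x * sin (r * b * x + th)) * p x +
      b * (r * b) * (cos (r * b * x + th) * p x)) = 0.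
    rewrite -[RHS](mulr0 b) -st -e7; apply: eq_Rintegral => x _; ring.
  have -> : \int[mu]_x (- (b * x * sin (r * b * x + th)) * p x) +
      b * (r * b) * \int[mu]_x (cos (r * b * x + th) * p x) = 0.
    by rewrite -[RHS]e8 -[X in _ + X]e5; exact/esym/e6.
  by rewrite normr0.
Qed.

End NormalCharacteristicFunction.

(** * Expectations of independent standard normal variables *)

Section Expectation.
Context {R : realType} d (T : measurableType d) (P : probability T R).
Implicit Types f g : T -> R.

Definition expect f : R := \int[P]_w f w.

Lemma bounded_integrable f M : measurable_fun setT f -> (forall w, `|f w| <= M) ->
  P.-integrable setT (EFin \o f).
Proof.
move=> mf fM; have ic : P.-integrable setT (EFin \o cst M).
  exact: finite_measure_integrable_cst.
apply: le_integrable ic => //; first exact/measurable_EFinP.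
by move=> w _ /=; rewrite lee_fin; apply: le_trans (fM w) _; exact: ler_norm.
Qed.

Lemma expectD f g : P.-integrable setT (EFin \o f) -> P.-integrable setT (EFin \o g) ->
  expect (fun w => f w + g w) = expect f + expect g.
Proof. by move=> If Ig; rewrite /expect RintegralD. Qed.

Lemma expectB f g : P.-integrable setT (EFin \o f) -> P.-integrable setT (EFin \o g) ->
  expect (fun w => f w - g w) = expect f - expect g.
Proof. by move=> If Ig; rewrite /expect RintegralB. Qed.

Lemma expectZ c f : P.-integrable setT (EFin \o f) -> expect (fun w => c * f w) = c * expect f.
Proof. by move=> If; rewrite /expect RintegralZl. Qed.

Lemma expect_cst c : expect (cst c) = c.
Proof. by rewrite /expect Rintegral_cst //= probability_setT /= mulr1. Qed.

Lemma le_expect f g : P.-integrable setT (EFin \o f) -> P.-integrable setT (EFin \o g) ->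
  (forall w, f w <= g w) -> expect f <= expect g.
Proof. by move=> If Ig fg; apply: le_Rintegral => // w _; exact: fg. Qed.

Lemma eq_expect f g : f =1 g -> expect f = expect g.
Proof. by move=> fg; apply: eq_Rintegral => w _; exact: fg. Qed.

Lemma expect_norm_le f M : measurable_fun setT f -> (forall w, `|f w| <= M) -> `|expect f| <= M.
Proof.
move=> mf fM; have If := bounded_integrable mf fM.
apply: le_trans (le_normr_Rintegral measurableT If) _.
rewrite -[leRHS](expect_cst M); apply: (@le_expect (fun w => `|f w|) (cst M)) => //.
  exact: (integrable_abse If).
exact: finite_measure_integrable_cst.
Qed.

Lemma expect_sum (I : Type) (r : seq I) (F : I -> T -> R) :
  (forall i, P.-integrable setT (EFin \o F i)) ->
  expect (fun w => \sum_(i <- r) F i w) = \sum_(i <- r) expect (F i) /\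
  P.-integrable setT (EFin \o (fun w => \sum_(i <- r) F i w)).
Proof.
move=> IF; elim: r => [|i r [IH1 IH2]].
  rewrite big_nil; split; first by rewrite -[RHS](expect_cst 0); apply: eq_expect => w; rewrite big_nil.
  rewrite (_ : (fun w => _) = cst 0); first exact: finite_measure_integrable_cst.
  by apply/funext => w; rewrite big_nil.
have -> : (fun w => \sum_(j <- i :: r) F j w) = (fun w => F i w + \sum_(j <- r) F j w).
  by apply/funext => w; rewrite big_cons.
split; first by rewrite big_cons -IH1 expectD.
exact: (integrableD measurableT (IF i) IH2).
Qed.

Lemma expect_indic (A : set T) : measurable A -> expect \1_A = fine (P A).
Proof. by move=> mA; rewrite /expect /Rintegral integral_indic // setIT. Qed.

Lemma expect_cvg (f_ : nat -> T -> R) f M :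
  (forall n, measurable_fun setT (f_ n)) -> measurable_fun setT f ->
  (forall n w, `|f_ n w| <= M) ->
  {ae P, forall w, f_ n w @[n --> \oo] --> f w} ->
  expect (f_ n) @[n --> \oo] --> expect f.
Proof.
move=> mf_ mf f_M cf.
have m1 n : measurable_fun setT (EFin \o f_ n) by exact/measurable_EFinP.
have m2 : measurable_fun setT (EFin \o f) by exact/measurable_EFinP.
have c1 : {ae P, forall w, setT w -> (EFin \o f_ n) w @[n --> \oo] --> (EFin \o f) w}.
  by apply: filterS cf => w cw _; apply: cvg_EFin => //; exact: nearW.
have ic : P.-integrable setT (EFin \o cst M) by exact: finite_measure_integrable_cst.
have b1 : {ae P, forall w n, setT w -> (`|(EFin \o f_ n) w| <= (EFin \o cst M) w)%E}.
  by apply: aeW => w n _ /=; rewrite lee_fin.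
have [If _ L] := dominated_convergence measurableT m1 m2 c1 ic b1.
apply: fine_cvg; rewrite fineK //; exact: integrable_fin_num.
Qed.

(* Quantising [f] to multiples of 1/N reduces the product rule for a bounded
   measurable function to the one for indicators. *)
Lemma expect_mul_approx (Y G : T -> R) (f : R -> R) :
  measurable_fun setT Y -> measurable_fun setT G -> measurable_fun setT f ->
  (forall w, `|G w| <= 1) -> (forall x, `|f x| <= 1) ->
  (forall B : set R, measurable B ->
    expect (fun w => \1_B (Y w) * G w) = expect (fun w => \1_B (Y w)) * expect G) ->
  expect (fun w => f (Y w) * G w) = expect (fun w => f (Y w)) * expect G.
Proof.
move=> mY mG mf G1 f1 ind.
have mfY : measurable_fun setT (fun w => f (Y w)) by exact: measurableT_comp.
have EG : `|expect G| <= 1 by exact: expect_norm_le.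
suff approx (N : nat) : (0 < N)%N ->
    `|expect (fun w => f (Y w) * G w) - expect (fun w => f (Y w)) * expect G| <= 2 / N%:R.
  apply/eqP; rewrite -subr_eq0 -normr_le0; apply/ler_addgt0Pr => e e0; rewrite add0r.
  pose N := (Num.truncn (2 / e)).+1.
  apply: le_trans (approx N _) _ => //; rewrite ler_pdivrMr ?ltr0n // mulrC -ler_pdivrMr //.
  by apply/ltW/truncnS_gt.
move=> N0; have NR : (0 : R) < N%:R by rewrite ltr0n.
pose B (j : nat) : set R := f @^-1` `[j%:R / N%:R - 1, j.+1%:R / N%:R - 1[%classic.
have mB j : measurable (B j) by rewrite -[B j]setTI; apply: mf => //; exact: measurable_itv.
pose c (j : nat) : R := j%:R / N%:R - 1.
(* The intervals are half-open, so the extra level [2 * N] is needed to catch the value 1 of [f]. *)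
pose r := index_iota 0 (2 * N).+1.
pose fN (x : R) : R := \sum_(j <- r) c j * \1_(B j) x.
have fNE x : `|f x - fN x| <= N%:R^-1.
  pose y := N%:R * (f x + 1); have := f1 x; rewrite ler_norml => /andP[f1x f2x].
  have y0 : 0 <= y by rewrite mulr_ge0 //; lra.
  pose j0 := Num.truncn y.
  have /andP[j1 j2] := truncn_itv y0.
  have memB j : (x \in B j) = (j == j0).
    apply/idP/eqP => [|->].
      rewrite inE /B /= in_itv /= => /andP[h1 h2].
      apply/esym/truncn_def; rewrite /y; apply/andP; split.
        by rewrite mulrC -ler_pdivrMr //; lra.
      by rewrite mulrC -ltr_pdivlMr //; lra.
    rewrite inE /B /= in_itv /=; apply/andP; split.
      by rewrite lerBlDr ler_pdivrMr // mulrC.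
    by rewrite ltrBrDr ltr_pdivlMr // mulrC.
  have j0r : j0 \in r.
    rewrite mem_index_iota /= ltnS -(ler_nat R); apply: le_trans j1 _.
    by rewrite natrM /y [2 * _]mulrC ler_pM2l //; lra.
  have -> : fN x = c j0.
    rewrite /fN (bigD1_seq j0) ?iota_uniq //= indicE memB eqxx mulr1 big1 ?addr0 // => j jj.
    by rewrite indicE memB (negbTE jj) mulr0.
  rewrite /c; have -> : f x - (j0%:R / N%:R - 1) = (y - j0%:R) / N%:R.
    by rewrite /y; field; rewrite gt_eqF.
  rewrite normrM normfV (ger0_norm (ltW NR)) ler_piMl ?invr_ge0 ?(ltW NR) //.
  rewrite ger0_norm ?subr_ge0 // lerBlDr; apply/ltW.
  by move: j2; rewrite -natr1 addrC.
have mI j : measurable_fun setT (fun w => \1_(B j) (Y w) : R).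
  by apply: measurableT_comp mY => //; exact: measurable_indic.
have b1 j w : `|\1_(B j) (Y w) : R| <= 1 by rewrite indicE; case: (_ \in _); rewrite /= ?normr1 ?normr0.
have i1 j : P.-integrable setT (EFin \o (fun w => c j * \1_(B j) (Y w))).
  apply: (@bounded_integrable _ `|c j|); first exact: measurable_funM.
  by move=> w; rewrite normrM ler_piMr.
have i2 j : P.-integrable setT (EFin \o (fun w => c j * (\1_(B j) (Y w) * G w))).
  apply: (@bounded_integrable _ `|c j|); first by do 2 apply: measurable_funM => //.
  by move=> w; rewrite !normrM ler_piMr // mulr_ile1.
have [e1 I1] := expect_sum r i1; have [e2 I2] := expect_sum r i2.
have key : expect (fun w => \sum_(j <- r) c j * (\1_(B j) (Y w) * G w)) =
    expect (fun w => \sum_(j <- r) c j * \1_(B j) (Y w)) * expect G.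
  rewrite e1 e2 mulr_suml; apply: eq_bigr => j _.
  have ij : P.-integrable setT (EFin \o (fun w => \1_(B j) (Y w))) by exact: bounded_integrable (b1 j).
  have ijG : P.-integrable setT (EFin \o (fun w => \1_(B j) (Y w) * G w)).
    apply: (@bounded_integrable _ 1); first exact: measurable_funM.
    by move=> w; rewrite normrM mulr_ile1.
  by rewrite !expectZ // ind // mulrA.
have ifG : P.-integrable setT (EFin \o (fun w => f (Y w) * G w)).
  apply: (@bounded_integrable _ 1); first exact: measurable_funM.
  by move=> w; rewrite normrM mulr_ile1.
have if_ : P.-integrable setT (EFin \o (fun w => f (Y w))) by exact: bounded_integrable.
have d1 : `|expect (fun w => f (Y w) * G w) -
    expect (fun w => \sum_(j <- r) c j * (\1_(B j) (Y w) * G w))| <= N%:R^-1.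
  rewrite -expectB //; apply: expect_norm_le.
    by apply: measurable_funB; [exact: measurable_funM|exact/measurable_EFinP/(measurable_int P)].
  move=> w; have -> : f (Y w) * G w - \sum_(j <- r) c j * (\1_(B j) (Y w) * G w) =
      (f (Y w) - fN (Y w)) * G w.
    by rewrite mulrBl /fN mulr_suml; congr (_ - _); apply: eq_bigr => j _; rewrite mulrA.
  by rewrite normrM; apply: le_trans (fNE (Y w)); rewrite ler_piMr.
have d2 : `|expect (fun w => f (Y w)) -
    expect (fun w => \sum_(j <- r) c j * \1_(B j) (Y w))| <= N%:R^-1.
  rewrite -expectB //; apply: expect_norm_le.
    by apply: measurable_funB => //; exact/measurable_EFinP/(measurable_int P).
  by move=> w; exact: fNE.
have -> : expect (fun w => f (Y w) * G w) - expect (fun w => f (Y w)) * expect G =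
  (expect (fun w => f (Y w) * G w) - expect (fun w => \sum_(j <- r) c j * (\1_(B j) (Y w) * G w)))
  - (expect (fun w => f (Y w)) - expect (fun w => \sum_(j <- r) c j * \1_(B j) (Y w))) * expect G.
  by rewrite key; ring.
apply: le_trans (ler_normB _ _) _; rewrite normrM.
have -> : 2 / N%:R = N%:R^-1 + N%:R^-1 * 1 :> R by ring.
by apply: lerD => //; apply: ler_pM.
Qed.

End Expectation.

(** * Transfer from the normal law to random variables *)

Section StandardNormal.
Context {R : realType}.
Notation mu := (@lebesgue_measure R).

Lemma integral_normal_prob (f : measurableTypeR R -> \bar R) :
  measurable_fun setT f -> (\int[normal_prob (0 : R) 1]_x `|f x| < +oo)%E ->
  (\int[normal_prob (0 : R) 1]_x f x = \int[mu]_x (f x * (normal_pdf 0 1 x)%:E))%E.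
Proof.
move=> mf finf.
rewrite -(Radon_Nikodym_change_of_variables (@normal_prob_dominates R 0 1)) //=; last first.
  by apply/integrableP; split.
apply: ae_eq_integral => //.
- apply: emeasurable_funM => //; apply: (measurable_int mu).
  by apply: Radon_Nikodym_integrable; exact: normal_prob_dominates.
- apply: emeasurable_funM => //; apply/measurable_EFinP; exact: measurable_normal_pdf.
- apply: ae_eqe_mul2l => /=.
  rewrite Radon_NikodymE //=; first exact: normal_prob_dominates.
  move=> dom; case: cid => /= h [h1 h2 h3].
  apply: integral_ae_eq => //=.
  + by apply/measurable_EFinP; exact: measurable_normal_pdf.
  + by move=> E _ mE; rewrite -h3.
Qed.

Lemma standard_normal_char_fun d (T : measurableType d) (P : probability T R)
    (X : {RV P >-> R}) b th : standard_normal X ->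
  expect P (fun w => cos (b * X w + th)) = cos th * expR (- (b ^+ 2 / 2)).
Proof.
move=> nX; pose Y : T -> measurableTypeR R := X.
have mY : measurable_fun setT Y by exact: (@measurable_funPT _ _ _ _ X).
pose g (x : measurableTypeR R) : R := cos (b * x + th).
have mg : measurable_fun setT g.
  apply: continuous_measurable_fun => x.
  apply: continuous_comp; last exact: continuous_cos.
  by apply: cvgD; [apply: cvgMr; exact: cvg_id|exact: cvg_cst].
have mEg : measurable_fun setT (EFin \o g) by exact/measurable_EFinP.
have gX : P.-integrable setT ((EFin \o g) \o Y).
  apply: (@bounded_integrable _ _ _ _ (g \o Y) 1); first exact: measurableT_comp.
  by move=> w; exact: cos_max.
rewrite -normal_char_fun /expect /Rintegral; congr fine.
transitivity (\int[pushforward P Y]_y (EFin \o g) y)%E.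
  by rewrite (integral_pushforward mY mEg) ?preimage_setT.
have nY A : measurable A -> pushforward P Y A = normal_prob 0 1 A by exact: nX.
transitivity (\int[normal_prob (0 : R) 1]_y (EFin \o g) y)%E.
  by apply: eq_measure_integral => A mA _; exact: nY.
rewrite integral_normal_prob //.
have /integrableP[] // : (normal_prob (0 : R) 1).-integrable setT (EFin \o g).
apply: (@bounded_integrable _ _ _ (normal_prob 0 1) g 1) => // x; exact: cos_max.
Qed.

End StandardNormal.

(** * Product rule and Gaussian sums under independence *)

Section Independence.
Context {R : realType} d (T : measurableType d) (P : probability T R).
Local Notation expect := (expect P).
Variables (I : choiceType) (X : I -> {RV P >-> R}).
Hypothesis indX : mutually_independent X.

Lemma independent_indicators (J : seq I) (A : I -> set R) : uniq J ->
  (forall i, measurable (A i)) ->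
  expect (fun w => \prod_(i <- J) \1_(A i) (X i w)) =
  \prod_(i <- J) expect (fun w => \1_(A i) (X i w)).
Proof.
move=> uJ mA; have := indX [fset i | i in J]%fset mA.
have pJ : perm_eq (enum_fset [fset i | i in J]%fset) J.
  by apply: uniq_perm => // i; rewrite !inE.
rewrite (perm_big _ pJ) /= => h.
have mXA i : measurable (X i @^-1` A i) by rewrite -[_ @^-1` _]setTI; exact: measurable_funP.
have -> : (fun w => \prod_(i <- J) \1_(A i) (X i w)) =
    \1_(\bigcap_(i in [set` [fset i | i in J]%fset]) X i @^-1` A i) :> (T -> R).
  apply/funext => w; rewrite indicE.
  have [wA|wA] := boolP (w \in _).
    rewrite big_seq big1 // => i iJ; rewrite indicE mem_set //.
    by move/set_mem: wA => /(_ i); apply; rewrite /= !inE.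
  have [i iJ iA] : exists2 i, i \in J & ~ A i (X i w).
    apply: contrapT => h'; move/negP: wA; apply; apply/mem_set => i /=; rewrite !inE => iJ.
    by apply: contrapT => nA; apply: h'; exists i.
  by rewrite (big_rem i) //= indicE memNset // mul0r.
rewrite expect_indic; last first.
  by apply: fin_bigcap_measurable => //; exact: finite_fset.
rewrite h (eq_bigr (fun i => (expect (fun w => \1_(A i) (X i w)))%:E)) ?prodEFin //.
move=> i _; rewrite -[LHS]fineK ?fin_num_measure // -(expect_indic P (mXA i)).
by [].
Qed.

Lemma expect_prod (J : seq I) (f : I -> R -> R) : uniq J ->
  (forall i, measurable_fun setT (f i)) -> (forall i x, `|f i x| <= 1) ->
  expect (fun w => \prod_(i <- J) f i (X i w)) = \prod_(i <- J) expect (fun w => f i (X i w)).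
Proof.
move=> uJ mf f1.
(* The induction needs both kinds of factors: testing the factor [i] against an indicator of [B]
   moves [i] from [J1] to [J2], with [A i] replaced by [B]. *)
have gen (J1 J2 : seq I) (A : I -> set R) : uniq (J1 ++ J2) -> (forall i, measurable (A i)) ->
    expect (fun w => \prod_(i <- J1) f i (X i w) * \prod_(i <- J2) \1_(A i) (X i w)) =
    \prod_(i <- J1) expect (fun w => f i (X i w)) * \prod_(i <- J2) expect (fun w => \1_(A i) (X i w)).
  elim: J1 J2 A => [|i J1 IH] J2 A uJ12 mA.
    under eq_expect => w do rewrite big_nil mul1r.
    by rewrite big_nil mul1r independent_indicators.
  move: uJ12 => /= /andP[iJ uJ12].
  pose G w := \prod_(i <- J1) f i (X i w) * \prod_(i <- J2) \1_(A i) (X i w).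
  have mG : measurable_fun setT G.
    apply: measurable_funM; apply: measurable_prod => j _.
      by apply: measurableT_comp.
    by apply: measurableT_comp => //; exact: measurable_indic.
  have G1 w : `|G w| <= 1.
    have prod1 (r : seq I) (F : I -> R) : (forall j, `|F j| <= 1) -> `|\prod_(j <- r) F j| <= 1.
      move=> F1; elim/big_rec: _ => [|j y _ y1]; first by rewrite normr1.
      by rewrite normrM mulr_ile1.
    rewrite normrM mulr_ile1 //; apply: prod1 => // j.
    by rewrite indicE; case: (_ \in _); rewrite /= ?normr1 ?normr0.
  have -> : expect (fun w => \prod_(j <- i :: J1) f j (X j w) * \prod_(j <- J2) \1_(A j) (X j w)) =
      expect (fun w => f i (X i w) * G w).
    by apply: eq_expect => w; rewrite big_cons mulrA.
  rewrite big_cons -mulrA -IH //; apply: expect_mul_approx => // B mB.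
  pose A' j := if j == i then B else A j.
  have mA' j : measurable (A' j) by rewrite /A'; case: ifP.
  have uJ' : uniq (J1 ++ i :: J2) by rewrite uniq_catC /= mem_cat orbC -mem_cat iJ uniq_catC.
  have A'J2 j : j \in J2 -> A' j = A j.
    move=> jJ; rewrite /A' ifN //; apply: contraNneq iJ => <-; by rewrite mem_cat jJ orbT.
  have e1 : expect (fun w => \1_B (X i w) * G w) = expect (fun w =>
      \prod_(j <- J1) f j (X j w) * \prod_(j <- i :: J2) \1_(A' j) (X j w)).
    apply: eq_expect => w; rewrite big_cons /A' eqxx /G mulrCA; congr (_ * (_ * _)).
    by apply: eq_big_seq => j /A'J2 e; rewrite -/(A' j) e.
  rewrite e1 IH // big_cons {1}/A' eqxx [expect G]IH // mulrCA; congr (_ * (_ * _)).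
  by apply: eq_big_seq => j /A'J2 ->.
have := gen J [::] (fun=> setT); rewrite cats0 => /(_ uJ (fun=> measurableT)).
rewrite [in RHS]big_nil mulr1 => <-; apply: eq_expect => w; by rewrite big_nil mulr1.
Qed.

(* Stated for an arbitrary phase [th], so that the sine terms of the addition
   formula are covered by the induction. *)
Lemma expect_cos_sum (J : seq I) (b : I -> R) th : uniq J ->
  (forall i, standard_normal (X i)) ->
  expect (fun w => cos (th + \sum_(i <- J) b i * X i w)) =
  cos th * expR (- (\sum_(i <- J) b i ^+ 2) / 2).
Proof.
move=> uJ nX.
(* [J2] collects the factors already split off. The addition formula produces a cosine term and a
   sine term in [X i]; the latter is a cosine with phase shifted by [pi / 2], and it vanishes
   because the sine has mean zero. *)
have gen (J1 J2 : seq I) th' (g : I -> R -> R) : uniq (J1 ++ J2) ->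
    (forall i, measurable_fun setT (g i)) -> (forall i x, `|g i x| <= 1) ->
    expect (fun w => cos (th' + \sum_(i <- J1) b i * X i w) * \prod_(i <- J2) g i (X i w)) =
    cos th' * expR (- (\sum_(i <- J1) b i ^+ 2) / 2) * \prod_(i <- J2) expect (fun w => g i (X i w)).
  elim: J1 J2 th' g => [|i J1 IH] J2 th' g uJ12 mg g1.
    rewrite big_nil oppr0 mul0r expR0 mulr1 -(expect_prod uJ12 mg g1) -expectZ.
      by apply: eq_expect => w; rewrite big_nil addr0.
    apply: (@bounded_integrable _ _ _ _ _ 1).
      by apply: measurable_prod => j _; exact: measurableT_comp.
    move=> w; elim/big_rec: _ => [|j y _ y1]; first by rewrite normr1.
    by rewrite normrM mulr_ile1.
  move: uJ12 => /= /andP[iJ uJ12].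
  pose g' (h : R -> R) j := if j == i then h else g j.
  have mcos : measurable_fun setT (fun x : R => cos (b i * x)).
    apply: measurableT_comp; first exact: (continuous_measurable_fun (@continuous_cos R)).
    exact: measurable_funM.
  have msin : measurable_fun setT (fun x : R => sin (b i * x)).
    apply: measurableT_comp; first exact: (continuous_measurable_fun (@continuous_sin R)).
    exact: measurable_funM.
  have mg' h : measurable_fun setT h -> forall j, measurable_fun setT (g' h j).
    by move=> mh j; rewrite /g'; case: ifP.
  have g'1 h : (forall x, `|h x| <= 1) -> forall j x, `|g' h j x| <= 1.
    by move=> h1 j x; rewrite /g'; case: ifP.
  have uJ' : uniq (J1 ++ i :: J2) by rewrite uniq_catC /= mem_cat orbC -mem_cat iJ uniq_catC.
  have g'J2 h j : j \in J2 -> g' h j = g j.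
    move=> jJ; rewrite /g' ifN //; apply: contraNneq iJ => <-; by rewrite mem_cat jJ orbT.
  have IHc := IH (i :: J2) th' _ uJ' (mg' _ mcos) (g'1 _ (fun x => cos_max _)).
  have IHs := IH (i :: J2) (th' - pi / 2) _ uJ' (mg' _ msin) (g'1 _ (fun x => sin_max _)).
  have ec : expect (fun w => cos (b i * X i w)) = expR (- (b i ^+ 2 / 2)).
    have := standard_normal_char_fun (b i) 0 (nX i); rewrite cos0 mul1r => <-.
    by apply: eq_expect => w; rewrite addr0.
  have es : expect (fun w => sin (b i * X i w)) = 0.
    have := standard_normal_char_fun (b i) (- (pi / 2)) (nX i).
    rewrite cosN cos_pihalf mul0r => <-.
    by apply: eq_expect => w; rewrite cosBpihalf.
  have prodg h : \prod_(j <- i :: J2) expect (fun w => g' h j (X j w)) =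
      expect (fun w => h (X i w)) * \prod_(j <- J2) expect (fun w => g j (X j w)).
    rewrite big_cons {1}/g' eqxx; congr (_ * _); apply: eq_big_seq => j /(g'J2 h) e.
    by rewrite e.
  have prodw h w : \prod_(j <- i :: J2) g' h j (X j w) =
      h (X i w) * \prod_(j <- J2) g j (X j w).
    by rewrite big_cons {1}/g' eqxx; congr (_ * _); apply: eq_big_seq => j /(g'J2 h) ->.
  rewrite prodg es mul0r mulr0 in IHs; rewrite prodg ec in IHc.
  have mS : measurable_fun setT (fun w => \sum_(j <- J1) b j * X j w).
    by apply: measurable_sum => j; exact: measurable_funM.
  have int_ (h : R -> R) th1 : measurable_fun setT h -> (forall x, `|h x| <= 1) ->
      P.-integrable setT (EFin \o (fun w => cos (th1 + \sum_(j <- J1) b j * X j w) *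
        \prod_(j <- i :: J2) g' h j (X j w))).
    move=> mh h1; apply: (@bounded_integrable _ _ _ _ _ 1).
      apply: measurable_funM.
        apply: measurableT_comp; first exact: (continuous_measurable_fun (@continuous_cos R)).
        exact: measurable_funD.
      by apply: measurable_prod => j _; apply: measurableT_comp => //; exact: mg'.
    move=> w; rewrite normrM mulr_ile1 ?cos_max //.
    elim/big_rec: _ => [|j y _ y1]; first by rewrite normr1.
    by rewrite normrM mulr_ile1 //; exact: g'1.
  transitivity (expect (fun w => cos (th' + \sum_(j <- J1) b j * X j w) *
        \prod_(j <- i :: J2) g' (fun x => cos (b i * x)) j (X j w)) -
      expect (fun w => cos (th' - pi / 2 + \sum_(j <- J1) b j * X j w) *
        \prod_(j <- i :: J2) g' (fun x => sin (b i * x)) j (X j w))).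
    rewrite -expectB; [|exact: int_ mcos (fun x => cos_max _)|exact: int_ msin (fun x => sin_max _)].
    apply: eq_expect => w; rewrite big_cons !prodw.
    have -> : th' + (b i * X i w + \sum_(j <- J1) b j * X j w) =
      (th' + \sum_(j <- J1) b j * X j w) + b i * X i w by ring.
    by rewrite cosD [th' - _ + _]addrAC cosBpihalf; ring.
  rewrite IHc IHs subr0 big_cons.
  have -> : - (b i ^+ 2 + \sum_(j <- J1) b j ^+ 2) / 2 =
    - (\sum_(j <- J1) b j ^+ 2) / 2 + - (b i ^+ 2 / 2) by ring.
  by rewrite expRD; ring.
have one1 (i : I) (x : R) : `|1 : R| <= 1 by rewrite normr1.
have := gen J [::] th (fun _ _ => 1); rewrite cats0 => /(_ uJ (fun=> measurable_cst _) one1).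
by rewrite [in RHS]big_nil mulr1 => <-; apply: eq_expect => w; rewrite big_nil mulr1.
Qed.

End Independence.

(** * Almost sure convergence of the limiting series *)

Section USquaredSeries.
Context {R : realType}.
Notation mu := (@lebesgue_measure R).

Lemma ge0_integral_normal_prob (f : measurableTypeR R -> \bar R) :
  measurable_fun setT f -> (forall x, (0 <= f x)%E) ->
  (\int[normal_prob (0 : R) 1]_x f x = \int[mu]_x (f x * (normal_pdf 0 1 x)%:E))%E.
Proof.
move=> mf f0; have dom := @normal_prob_dominates R 0 1.
rewrite -(Radon_Nikodym_SigmaFinite.change_of_variables dom) //=.
have mpdf : measurable_fun [set: measurableTypeR R] (EFin \o (@normal_pdf R 0 1)).
  by apply/measurable_EFinP; exact: measurable_normal_pdf.
have ifN := Radon_Nikodym_SigmaFinite.f_integrable dom.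
apply: ae_eq_integral => //.
- by apply: emeasurable_funM => //; exact: measurable_int ifN.
- exact: emeasurable_funM.
- apply: ae_eqe_mul2l => /=; apply: integral_ae_eq => //= A _ mA.
  by rewrite -Radon_Nikodym_SigmaFinite.f_integral.
Qed.

Lemma standard_normal_sqr d (T : measurableType d) (P : probability T R)
    (X : {RV P >-> R}) : standard_normal X ->
  (\int[P]_w (X w ^+ 2)%:E = \int[mu]_x (x ^+ 2 * normal_pdf 0 1 x)%:E)%E.
Proof.
move=> nX; pose Y : T -> measurableTypeR R := X.
have mY : measurable_fun setT Y by exact: (@measurable_funPT _ _ _ _ X).
pose g (x : measurableTypeR R) : \bar R := (x ^+ 2)%:E.
have mg : measurable_fun setT g.
  by apply/measurable_EFinP; apply: measurable_funX.
have g0 x : (0 <= g x)%E by rewrite lee_fin sqr_ge0.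
transitivity (\int[pushforward P Y]_y g y)%E.
  by rewrite (ge0_integral_pushforward mY) ?preimage_setT.
have nY A : measurable A -> pushforward P Y A = normal_prob 0 1 A by exact: nX.
transitivity (\int[normal_prob (0 : R) 1]_y g y)%E.
  by apply: eq_measure_integral => A mA _; exact: nY.
by rewrite ge0_integral_normal_prob.
Qed.

Variables (d : measure_display) (T : measurableType d) (P : probability T R).
Variables Z Zt : nat -> {RV P >-> R}.
Hypotheses (hZ : forall k, standard_normal (Z k)) (hZt : forall k, standard_normal (Zt k)).

Definition U_squared_sum K w : R := \sum_(0 <= k < K) U_squared_term Z Zt k w.

Lemma U_squared_term_ge0 k w : 0 <= U_squared_term Z Zt k w.
Proof.
rewrite /U_squared_term divr_ge0 //; first by rewrite addr_ge0 // sqr_ge0.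
by rewrite !mulr_ge0 ?exprn_ge0 ?pi_ge0.
Qed.

Lemma measurable_U_squared_term k : measurable_fun setT (U_squared_term Z Zt k).
Proof.
rewrite /U_squared_term; apply: measurable_funM => //.
by apply: measurable_funD; apply: measurable_funX; exact: measurable_funPT.
Qed.

Lemma measurable_U_squared_sum K : measurable_fun setT (U_squared_sum K).
Proof. by apply: measurable_sum => k; exact: measurable_U_squared_term. Qed.

Lemma U_squared_sum_ge0 K w : 0 <= U_squared_sum K w.
Proof. by apply: sumr_ge0 => k _; exact: U_squared_term_ge0. Qed.

Lemma U_squared_ge0 w : 0 <= U_squared Z Zt w.
Proof.
apply/fine_ge0/nneseries_ge0 => k _ _.
by rewrite lee_fin U_squared_term_ge0.
Qed.

Lemma sum_inv_sqr_lt2 (K : nat) : \sum_(0 <= k < K) (k.+1%:R ^+ 2)^-1 <= 2 :> R.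
Proof.
(* The sharper bound [2 - 1/(K+1)] is what the telescoping induction preserves. *)
suff : \sum_(0 <= k < K.+1) (k.+1%:R ^+ 2)^-1 <= 2 - K.+1%:R^-1 :> R.
  rewrite big_nat_recr //= => h; apply: le_trans (_ : _ <= 2 - K.+1%:R^-1 :> R) _.
    by apply: le_trans h; rewrite lerDl invr_ge0 sqr_ge0.
  by rewrite gerBl invr_ge0.
elim: K => [|K IH]; first by rewrite big_nat1 invr1 expr1n invr1; lra.
rewrite big_nat_recr //=; apply: le_trans (lerD IH (lexx _)) _.
have K1 : (0 : R) < K.+1%:R by rewrite ltr0n.
have -> : K.+2%:R = K.+1%:R + 1 :> R by rewrite -natr1.
move: (K.+1%:R) K1 => x x0; rewrite -subr_ge0.
have -> : 2 - (x + 1)^-1 - (2 - x^-1 + ((x + 1) ^+ 2)^-1) = (x * (x + 1) ^+ 2)^-1.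
  by field; rewrite !gt_eqF //= addr_gt0.
by rewrite invr_ge0 mulr_ge0 ?sqr_ge0 // ltW.
Qed.

(** The terms are nonnegative, so the sum may be integrated termwise; its mean is dominated by a
    multiple of the sum of the inverse squares, hence finite. *)
Lemma ae_U_squared_lty :
  {ae P, forall w, (\sum_(0 <= k <oo) (U_squared_term Z Zt k w)%:E < +oo)%E}.
Proof.
pose f w := (\sum_(0 <= k <oo) (U_squared_term Z Zt k w)%:E)%E.
have t0 k w : (0 <= (U_squared_term Z Zt k w)%:E)%E by rewrite lee_fin U_squared_term_ge0.
have f0 w : (0 <= f w)%E by apply: nneseries_ge0 => k _ _; exact: t0.
have mt k : measurable_fun setT (fun w => (U_squared_term Z Zt k w)%:E).
  by apply/measurable_EFinP; exact: measurable_U_squared_term.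
have mf : measurable_fun setT f by exact: ge0_emeasurable_sum.
set I2 := (\int[mu]_x (x ^+ 2 * normal_pdf 0 1 x)%:E)%E.
have I2f : I2 \is a fin_num by exact: integrable_fin_num (integrable_normal_sqr (R := R)).
have I20 : (0 <= I2)%E.
  by apply: integral_ge0 => x _; rewrite lee_fin mulr_ge0 ?sqr_ge0 // normal_pdf_ge0.
pose C := fine I2; have IC : I2 = C%:E by rewrite /C fineK.
have C0 : 0 <= C by exact: fine_ge0.
have It k : (\int[P]_w (U_squared_term Z Zt k w)%:E <= (C * (k.+1%:R ^+ 2)^-1)%:E)%E.
  have c0 : 0 <= (4 * pi ^+ 2 * k.+1%:R ^+ 2)^-1 :> R.
    by rewrite invr_ge0 !mulr_ge0 ?exprn_ge0 ?pi_ge0.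
  rewrite /U_squared_term; under eq_integral do rewrite mulrC EFinM EFinD.
  have mZ (X : {RV P >-> R}) : measurable_fun setT (fun w => (X w ^+ 2)%:E).
    by apply/measurable_EFinP; apply: measurable_funX; exact: measurable_funPT.
  have Z0 (X : {RV P >-> R}) w : (0 <= (X w ^+ 2)%:E)%E by rewrite lee_fin sqr_ge0.
  rewrite ge0_integralZl //; last 2 first.
    - exact: emeasurable_funD.
    - by move=> w _; rewrite adde_ge0.
  rewrite ge0_integralD // !standard_normal_sqr // -/I2 IC -EFinD -EFinM lee_fin.
  have -> : (4 * pi ^+ 2 * k.+1%:R ^+ 2)^-1 * (C + C) =
     C * (k.+1%:R ^+ 2)^-1 * (2 * pi ^+ 2)^-1 :> R.
    have k0 : k.+1%:R != 0 :> R by rewrite pnatr_eq0.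
    have pi0 : pi != 0 :> R by rewrite gt_eqF // pi_gt0.
    by move: (k.+1%:R : R) (@pi R) k0 pi0 => x p x0 p0; field; rewrite p0 x0.
  rewrite ler_piMr ?mulr_ge0 ?invr_ge0 ?sqr_ge0 // invf_le1 ?mulr_gt0 ?exprn_gt0 ?pi_gt0 //.
  have : 2 <= pi :> R by exact: pi_ge2.
  by nra.
have If : (\int[P]_w f w <= (C * 2)%:E)%E.
  rewrite integral_nneseries //; apply: lime_le.
    by apply: is_cvg_nneseries => k _ _; apply: integral_ge0.
  apply: nearW => K; apply: (@le_trans _ _ (\sum_(0 <= k < K) (C * (k.+1%:R ^+ 2)^-1)%:E)%E).
    exact: lee_sum.
  by rewrite sumEFin lee_fin -mulr_sumr ler_wpM2l // sum_inv_sqr_lt2.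
have intf : P.-integrable setT f.
  apply/integrableP; split => //; under eq_integral do rewrite gee0_abs //.
  exact: le_lt_trans If (ltry _).
apply: filterS (integrable_ae measurableT intf) => w /(_ I).
by rewrite ge0_fin_numE.
Qed.

Lemma ae_cvg_U_squared :
  {ae P, forall w, U_squared_sum K w @[K --> \oo] --> U_squared Z Zt w}.
Proof.
apply: filterS ae_U_squared_lty => w wlt.
have t0 k : (0 <= (U_squared_term Z Zt k w)%:E)%E by rewrite lee_fin U_squared_term_ge0.
apply: (@fine_cvg _ _ _ _ (EFin \o (U_squared_sum ^~ w))).
have -> : EFin \o (U_squared_sum ^~ w) =
  (fun K => (\sum_(0 <= k < K) (U_squared_term Z Zt k w)%:E)%E).
  by apply/funext => K /=; rewrite sumEFin.
rewrite /U_squared /= /U_squared_fun fineK; last first.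
  by rewrite ge0_fin_numE // nneseries_ge0.
by apply: is_cvg_nneseries.
Qed.

End USquaredSeries.

(** * Convergence in distribution *)

Section Linearisation.
Context {R : realType} (d : measure_display) (T : measurableType d) (P : probability T R).
Variables Z Zt : nat -> {RV P >-> R}.
Hypotheses (hZ : forall k, standard_normal (Z k)) (hZt : forall k, standard_normal (Zt k)).
Hypothesis hind : mutually_independent
  (fun i : nat + nat => match i with inl k => Z k | inr k => Zt k end).

Section FixedParameters.
Variables s t : nat.
Hypotheses (s0 : (0 < s)%N) (t0 : (0 < t)%N).
Local Notation n := (s + t)%N.
Variables (K : nat) (m : R).
Hypothesis m0 : 0 <= m.

Local Notation c := (Num.sqrt (n%:R / (s%:R * t%:R)) : R).

(** The weights are tuned so that one random wave can be read in two ways. For fixed [S] its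
    statistic is Gaussian and averages to [expR (- (m * watson_trunc K S))]; for fixed [w] it is a
    linear statistic of [S] whose limiting variance is [2 * m * U_squared_sum Z Zt K w]. Frequencies
    start at 1 and the variables at 0, whence [k.-1]. *)
Definition wave_coef (X : nat -> {RV P >-> R}) w k : R :=
  Num.sqrt m / (pi * k%:R) * X k.-1 w.

Definition random_wave w (i : 'I_(s + t)) : R :=
  trig_poly n K (wave_coef Z w) (wave_coef Zt w) i.

Lemma expect_average (f : T -> {set 'I_(s + t)} -> R) M :
  (forall S, measurable_fun setT (f ^~ S)) -> (forall w S, `|f w S| <= M) ->
  expect P (fun w => average (f w)) = average (fun S => expect P (f ^~ S)) /\
  measurable_fun setT (fun w => average (f w)).
Proof.
move=> mf fM; have If S : P.-integrable setT (EFin \o f ^~ S).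
  by apply: (@bounded_integrable _ _ _ P _ M) => // w; exact: fM.
pose r := seq.filter (fun S : {set 'I_(s + t)} => #|S| == s) (index_enum _).
have [E1 E2] := expect_sum r If.
rewrite /average; under eq_fun do rewrite mulrC.
have E3 : (fun w => \sum_(S : {set 'I_(s + t)} | #|S| == s) f w S) =
  (fun w => \sum_(S <- r) f w S).
  by apply/funext => w; rewrite big_filter.
split; last first.
  apply: measurable_funM => //; rewrite E3.
  exact/measurable_EFinP/(measurable_int P).
rewrite expectZ E3 // E1 big_filter mulrC //.
Qed.

Lemma linear_stat_random_wave w (S : {set 'I_(s + t)}) :
  linear_stat (random_wave w) S =
  \sum_(0 <= k < K) Num.sqrt m / (pi * k.+1%:R) *
    (cos_stat k.+1 S * Z k w + sin_stat k.+1 S * Zt k w).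
Proof.
rewrite /linear_stat /random_wave /trig_poly exchange_big /= big_add1 /=.
apply: eq_bigr => k _; rewrite big_split /= -!mulr_sumr /wave_coef /= mulrDr.
by rewrite -!mulrA; congr (_ * (_ * _) + _ * (_ * _)); rewrite mulrC.
Qed.

(* Gaussian linearisation of the square: exp(-b^2/2) is the mean of cos(bZ). *)
Lemma expect_random_wave (S : {set 'I_(s + t)}) :
  expect P (fun w => cos (c * linear_stat (random_wave w) S)) =
    expR (- (m * watson_trunc K S)) /\
  measurable_fun setT (fun w => cos (c * linear_stat (random_wave w) S)).
Proof.
pose J := map inl (iota 0 K) ++ map inr (iota 0 K) : seq (nat + nat).
pose X i : {RV P >-> R} := match i with inl k => Z k | inr k => Zt k end.
pose b i : R := match i with
  | inl k => c * (Num.sqrt m / (pi * k.+1%:R)) * cos_stat k.+1 S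
  | inr k => c * (Num.sqrt m / (pi * k.+1%:R)) * sin_stat k.+1 S end.
have uJ : uniq J.
  rewrite cat_uniq !map_inj_uniq ?iota_uniq /= ?andbT; last 2 first.
    - by move=> ? ? [].
    - by move=> ? ? [].
  by apply/hasPn => i /mapP[k _ ->]; apply/negP => /mapP[].
have nX i : standard_normal (X i) by case: i => k /=.
have E : (fun w => cos (c * linear_stat (random_wave w) S)) =
    (fun w => cos (0 + \sum_(i <- J) b i * X i w)).
  apply/funext => w; rewrite add0r linear_stat_random_wave big_cat /= !big_map.
  rewrite -[iota 0 K](_ : index_iota 0 K = _); last by rewrite /index_iota subn0.
  rewrite -big_split /= mulr_sumr; congr cos; apply: eq_bigr => k _ /=.
  by ring.
rewrite E; split; last first.
  apply: measurableT_comp; first exact: (continuous_measurable_fun (@continuous_cos R)).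
  by apply: measurable_funD => //; apply: measurable_sum => i; exact: measurable_funM.
rewrite (expect_cos_sum hind) // cos0 mul1r; congr expR.
rewrite big_cat /= !big_map -[iota 0 K](_ : index_iota 0 K = _); last by rewrite /index_iota subn0.
rewrite -big_split /= mulNr; congr (- _); rewrite /watson_trunc big_add1 /= mulr_suml mulr_sumr.
apply: eq_bigr => k _; rewrite /spectrum !exprMn.
rewrite sqr_sqrtr ?divr_ge0 ?mulr_ge0 ?ler0n // sqr_sqrtr // exprVn exprMn.
have pi0 : pi != 0 :> R by rewrite gt_eqF // pi_gt0.
have k0 : k.+1%:R != 0 :> R by rewrite pnatr_eq0.
have sR : s%:R != 0 :> R by rewrite pnatr_eq0 -lt0n.
have tR : t%:R != 0 :> R by rewrite pnatr_eq0 -lt0n.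
move: (k.+1%:R : R) (s%:R : R) (t%:R : R) (@pi R) k0 sR tR pi0 (n%:R : R) => x y z p x0 y0 z0 p0 u.
by field; rewrite p0 x0 y0 z0.
Qed.

Lemma average_laplace_wave :
  average (fun S : {set 'I_(s + t)} => expR (- (m * watson_trunc K S))) =
    expect P (fun w => average (fun S => cos (c * linear_stat (random_wave w) S))) /\
  measurable_fun setT (fun w => average (fun S => cos (c * linear_stat (random_wave w) S))).
Proof.
have [] := @expect_average (fun w S => cos (c * linear_stat (random_wave w) S)) 1.
- by move=> S; have [] := expect_random_wave S.
- by move=> w S; exact: cos_max.
move=> -> mA; split => //; apply: eq_average => S _.
by have [->] := expect_random_wave S.
Qed.

Lemma random_wave_central_limit w C : (2 * K < n)%N ->
    C = \sum_(1 <= k < K.+1) (`|wave_coef Z w k| + `|wave_coef Zt w k|) ->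
  `|average (fun S => cos (c * linear_stat (random_wave w) S)) -
    expR (- (m * U_squared_sum Z Zt K w))| <=
  c * (4 * C ^+ 3 + C ^+ 4 + 1) + 2 * C ^+ 2 * c ^+ 2.
Proof.
move=> Kn EC; have n0 : (0 < n)%N by rewrite addn_gt0 s0.
have h1 : \sum_i random_wave w i = 0.
  by rewrite -[RHS](trig_poly_sum n0 (wave_coef Z w) (wave_coef Zt w) Kn) big_mkord.
have h2 i : `|random_wave w i| <= C by rewrite EC; exact: trig_poly_bound.
have := subset_central_limit s0 t0 h1 h2.
have -> // : (\sum_i random_wave w i ^+ 2) / n%:R / 2 = m * U_squared_sum Z Zt K w.
have := trig_poly_energy n0 (wave_coef Z w) (wave_coef Zt w) Kn; rewrite big_mkord => ->.
rewrite /U_squared_sum big_add1 /= mulr_sumr mulr_suml mulr_sumr; apply: eq_bigr => k _.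
rewrite /wave_coef /U_squared_term /= !exprMn sqr_sqrtr // exprVn exprMn.
have pi0 : pi != 0 :> R by rewrite gt_eqF // pi_gt0.
have k0 : k.+1%:R != 0 :> R by rewrite pnatr_eq0.
by move: (k.+1%:R : R) (@pi R) k0 pi0 => x p x0 p0; field; rewrite p0 x0.
Qed.

End FixedParameters.

End Linearisation.

(** * Convergence of the Laplace transform along sequences *)

Section LaplaceLimit.
Context {R : realType} (d : measure_display) (T : measurableType d) (P : probability T R).
Variables Z Zt : nat -> {RV P >-> R}.
Hypotheses (hZ : forall k, standard_normal (Z k)) (hZt : forall k, standard_normal (Zt k)).
Hypothesis hind : mutually_independent
  (fun i : nat + nat => match i with inl k => Z k | inr k => Zt k end).

Lemma cvg_dist_lt (u : nat -> R) l e : u i @[i --> \oo] --> l -> 0 < e ->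
  \forall i \near \oo, `|l - u i| < e.
Proof. by move/cvgrPdist_lt => ul e0; exact: ul. Qed.

Lemma squeeze_dist (u v : nat -> R) (l : R) :
  (\forall i \near \oo, `|u i - l| <= v i) -> v i @[i --> \oo] --> 0 ->
  u i @[i --> \oo] --> l.
Proof.
move=> uv v0; apply/cvgrPdist_lt => e e0.
have := cvg_dist_lt v0 e0; apply: filterS2 uv => i h1 h2.
rewrite distrC; apply: le_lt_trans h1 (le_lt_trans _ h2).
by rewrite sub0r normrN ler_norm.
Qed.

Lemma cvg_sum_seq (I : Type) (r : seq I) (u : I -> nat -> R) (l : I -> R) :
  (forall j, u j i @[i --> \oo] --> l j) ->
  \sum_(j <- r) u j i @[i --> \oo] --> \sum_(j <- r) l j.
Proof.
move=> ul; elim: r => [|j r IH].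
  have -> : (fun i => \sum_(j <- [::]) u j i) = cst 0 by apply/funext => i; rewrite big_nil.
  by rewrite big_nil; exact: cvg_cst.
have -> : (fun i => \sum_(k <- j :: r) u k i) = (fun i => u j i + \sum_(k <- r) u k i).
  by apply/funext => i; rewrite big_cons.
by rewrite big_cons; apply: cvgD.
Qed.

Lemma expR_negB_le (x y : R) : 0 <= x -> 0 <= y -> `|expR (- x) - expR (- y)| <= `|x - y|.
Proof.
wlog xy : x y / x <= y.
  move=> H x0 y0; have [xy|/ltW yx] := leP x y; first exact: H.
  by rewrite distrC [leRHS]distrC; exact: H.
move=> x0 y0; rewrite ger0_norm ?subr_ge0 ?ler_expR ?lerN2 //.
rewrite distrC ger0_norm ?subr_ge0 //.
have -> : - y = - x + (x - y) by ring.
rewrite expRD -[X in X - _]mulr1 -mulrBr.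
have := expR_ge1Dx (x - y); have : expR (- x) <= 1 by rewrite expR_le1 oppr_le0.
have := expR_gt0 (- x); have : expR (x - y) <= 1 by rewrite expR_le1 subr_le0.
by nra.
Qed.

Variables s_ t_ : nat -> nat.
Hypotheses (hs : forall i, (i < s_ i)%N) (ht : forall i, (i < t_ i)%N).
Hypothesis cop : forall i, coprime (s_ i) (t_ i).

Let sP i : (0 < s_ i)%N. Proof. exact: leq_ltn_trans (hs i). Qed.
Let tP i : (0 < t_ i)%N. Proof. exact: leq_ltn_trans (ht i). Qed.
Let c2 i : R := (s_ i + t_ i)%:R / ((s_ i)%:R * (t_ i)%:R).

Lemma cvg_scale2 : c2 i @[i --> \oo] --> 0.
Proof.
apply: (@squeeze_dist _ (fun i => 2 * harmonic i)); last first.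
  by rewrite -[X in _ --> X](mulr0 2); apply: cvgMr; exact: cvg_harmonic.
apply: nearW => i; rewrite subr0 ger0_norm; last by rewrite divr_ge0 ?mulr_ge0 ?ler0n.
have s0 : (0 : R) < (s_ i)%:R by rewrite ltr0n.
have t0 : (0 : R) < (t_ i)%:R by rewrite ltr0n.
have -> : c2 i = (s_ i)%:R^-1 + (t_ i)%:R^-1.
  by rewrite /c2 natrD; field; rewrite !gt_eqF.
have -> : 2 * harmonic i = i.+1%:R^-1 + i.+1%:R^-1 :> R by rewrite /harmonic /=; ring.
by apply: lerD; rewrite lef_pV2 ?posrE ?ltr0n // ler_nat.
Qed.

Lemma cvg_scale : Num.sqrt (c2 i) @[i --> \oo] --> 0.
Proof.
rewrite -[X in _ --> X]sqrtr0.
exact: (cvg_comp _ _ cvg_scale2 (@sqrt_continuous R 0)).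
Qed.

Lemma cvg_size_shift : size_shift (R := R) (s_ i) (t_ i) @[i --> \oo] --> 0.
Proof.
apply: (@squeeze_dist _ c2); last exact: cvg_scale2.
apply: nearW => i; rewrite subr0 /size_shift /c2.
have n1 : (1 : R) <= (s_ i + t_ i)%:R by rewrite ler1n addn_gt0 sP.
have s0 : (0 : R) < (s_ i)%:R by rewrite ltr0n.
have t0 : (0 : R) < (t_ i)%:R by rewrite ltr0n.
move: ((s_ i + t_ i)%:R : R) n1 => n n1; have n0 : 0 < n by lra.
have n2 : 0 <= n ^+ 2 - 1 by nra.
rewrite ger0_norm; last by rewrite divr_ge0 // mulr_ge0 ?(ltW n0) // !mulr_ge0.
rewrite -subr_ge0.
have -> : n / ((s_ i)%:R * (t_ i)%:R) - (n ^+ 2 - 1) / (12 * (s_ i)%:R * (t_ i)%:R * n) =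
  (11 * n ^+ 2 + 1) / (12 * (s_ i)%:R * (t_ i)%:R * n).
  by field; rewrite !gt_eqF.
by rewrite divr_ge0 // ?mulr_ge0 ?(ltW n0) //; nra.
Qed.

(** For each fixed [w] the coefficient bound [C] of the wave does not depend on [i], so the central
    limit theorem gives pointwise convergence; averages of cosines are bounded by 1, which allows
    dominated convergence in [w]. *)
Lemma cvg_average_watson_trunc (K : nat) (m : R) : 0 <= m ->
  average (fun S : {set 'I_(s_ i + t_ i)} => expR (- (m * watson_trunc K S)))
    @[i --> \oo] --> expect P (fun w => expR (- (m * U_squared_sum Z Zt K w))).
Proof.
move=> m0.
under eq_fun => i do rewrite (average_laplace_wave hZ hZt hind (sP i) (tP i) K m0).1.
apply: (@expect_cvg _ _ _ _ _ _ 1).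
- by move=> i; exact: (average_laplace_wave hZ hZt hind (sP i) (tP i) K m0).2.
- apply: measurableT_comp => //; apply: measurable_funN; apply: measurable_funM => //.
  exact: measurable_U_squared_sum.
- by move=> i w; apply: average_norm_le => // S _; exact: cos_max.
apply: aeW => w.
pose C := \sum_(1 <= k < K.+1) (`|wave_coef m Z w k| + `|wave_coef m Zt w k|).
apply: (@squeeze_dist _ (fun i => Num.sqrt (c2 i) * (4 * C ^+ 3 + C ^+ 4 + 1) +
    2 * C ^+ 2 * (Num.sqrt (c2 i)) ^+ 2)).
  exists K => // i /= Ki; apply: random_wave_central_limit => //.
  by have := hs i; have := ht i; lia.
rewrite -[X in _ --> X](_ : 0 * (4 * C ^+ 3 + C ^+ 4 + 1) + 2 * C ^+ 2 * (0 * 0) = 0); last by ring.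
apply: cvgD; first by apply: cvgMl; exact: cvg_scale.
by apply: cvgMr; under eq_fun do rewrite expr2; apply: cvgM; exact: cvg_scale.
Qed.

Lemma watson_trunc_ge0 s t K (S : {set 'I_(s + t)}) : 0 <= watson_trunc K S :> R.
Proof.
apply: sumr_ge0 => k _; rewrite divr_ge0 //; last by rewrite !mulr_ge0 ?exprn_ge0 ?pi_ge0.
by rewrite !mulr_ge0 ?divr_ge0 ?mulr_ge0 ?spectrum_ge0.
Qed.

Lemma scaled_size_ge0 s t l : 0 <= scaled_size R s t l.
Proof. by rewrite /scaled_size divr_ge0 // divr_ge0 // mulr_ge0 // ?mulr_ge0 // addr_ge0. Qed.

Lemma cvg_average_laplace (m : R) : 0 <= m ->
  average (fun S : {set 'I_(s_ i + t_ i)} => expR (- (m * scaled_size R (s_ i) (t_ i) (core_of_word S).1)))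
    @[i --> \oo] --> expect P (fun w => expR (- (m * U_squared Z Zt w))).
Proof.
move=> m0.
have mexp (f : T -> R) : measurable_fun setT f -> measurable_fun setT (fun w => expR (- (m * f w))).
  by move=> mf; apply: measurableT_comp => //; apply: measurable_funN; exact: measurable_funM.
have LK : expect P (fun w => expR (- (m * U_squared_sum Z Zt K w))) @[K --> \oo] -->
    expect P (fun w => expR (- (m * U_squared Z Zt w))).
  apply: (@expect_cvg _ _ _ _ _ _ 1).
  - by move=> K; apply: mexp; exact: measurable_U_squared_sum.
  - by apply: mexp; exact: measurable_funPT.
  - move=> K w; rewrite ger0_norm ?expR_ge0 // expR_le1 oppr_le0 mulr_ge0 //.
    exact: U_squared_sum_ge0.
  apply: filterS (ae_cvg_U_squared hZ hZt) => w cw.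
  have cNw : - (m * U_squared_sum Z Zt K w) @[K --> \oo] --> - (m * U_squared Z Zt w).
    by apply: cvgN; apply: cvgMr.
  exact: (cvg_comp _ _ cNw (@continuous_expR R _)).
(* Five errors share [e]: the tail of the limiting series and the mean tail [2 / K], both made small
   by choosing [K] first, and then, for large [i], the central limit theorem at that [K], the
   coefficient error and the shift. *)
apply/cvgrPdist_lt => e e0; have e5 : 0 < e / 5 by rewrite divr_gt0.
have [K [K0 [h1 h2]]] : exists K, (0 < K)%N /\
    (`|expect P (fun w => expR (- (m * U_squared Z Zt w))) -
       expect P (fun w => expR (- (m * U_squared_sum Z Zt K w)))| < e / 5) /\
    (m * (2 / K%:R) < e / 5).
  have [K1 _ hK1] := cvg_dist_lt LK e5.
  pose K2 := (Num.truncn (2 * m / (e / 5))).+1.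
  exists (maxn K1.+1 K2); split; first by rewrite leq_max.
  split; first by apply: hK1; rewrite /= leq_max leqnSn.
  have K2gt : 2 * m / (e / 5) < K2%:R by apply: truncnS_gt.
  have K0 : (0 : R) < (maxn K1.+1 K2)%:R by rewrite ltr0n leq_max.
  rewrite mulrA [m * 2]mulrC ltr_pdivrMr // [ltRHS]mulrC -ltr_pdivrMr //.
  by apply: lt_le_trans K2gt _; rewrite ler_nat leq_maxr.
have c1 := cvg_dist_lt (@cvg_average_watson_trunc K m m0) e5.
have nK : (s_ i + t_ i)%N @[i --> \oo] --> \oo.
  move=> A [N _ NA]; exists N => // i /= Ni; apply: NA => /=.
  by have := hs i; lia.
have ce : m * coef_error (R := R) K (s_ i + t_ i) @[i --> \oo] --> 0.
  rewrite -[X in _ --> X](mulr0 m); apply: cvgMr.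
  exact: (cvg_comp (fun i => (s_ i + t_ i)%N) (coef_error K) nK (@cvg_coef_error R K)).
have csh : m * size_shift (R := R) (s_ i) (t_ i) @[i --> \oo] --> 0.
  by rewrite -[X in _ --> X](mulr0 m); apply: cvgMr; exact: cvg_size_shift.
have c3 := cvg_dist_lt ce e5.
have c4 := cvg_dist_lt csh e5.
have c5 : \forall i \near \oo, (K <= i)%N by exists K.
near=> i.
have Kn : (2 * K < s_ i + t_ i)%N.
  have : (K <= i)%N by near: i.
  by have := hs i; have := ht i; lia.
have b1 : `|expect P (fun w => expR (- (m * U_squared_sum Z Zt K w))) -
    average (fun S : {set 'I_(s_ i + t_ i)} => expR (- (m * watson_trunc K S)))| < e / 5.
  by near: i.
have b3 : m * coef_error K (s_ i + t_ i) < e / 5.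
  apply: le_lt_trans (ler_norm _) _; rewrite -normrN -sub0r; by near: i.
have b4 : `|m * size_shift (s_ i) (t_ i)| < e / 5.
  rewrite -normrN -sub0r; by near: i.
have b2 : `|average (fun S : {set 'I_(s_ i + t_ i)} => expR (- (m * watson_trunc K S))) -
    average (fun S : {set 'I_(s_ i + t_ i)} => expR (- (m * scaled_size R (s_ i) (t_ i) (core_of_word S).1)))| <=
    m * (2 / K%:R) + m * coef_error K (s_ i + t_ i) + `|m * size_shift (s_ i) (t_ i)|.
  rewrite -averageB; apply: le_trans (average_norm _) _.
  apply: (@le_trans _ _ (average (fun S : {set 'I_(s_ i + t_ i)} =>
      m * `|watson S - watson_trunc K S| + `|m * size_shift (s_ i) (t_ i)|))).
    apply: le_average => // S cS.
    apply: le_trans (expR_negB_le _ _) _.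
    - by rewrite mulr_ge0 // watson_trunc_ge0.
    - by rewrite mulr_ge0 // scaled_size_ge0.
    rewrite (scaled_size_word (sP i) (tP i) (cop i) cS).
    have -> : m * watson_trunc K S - m * (watson S - size_shift (s_ i) (t_ i)) =
      m * size_shift (s_ i) (t_ i) - m * (watson S - watson_trunc K S) by ring.
    by apply: le_trans (ler_normB _ _) _; rewrite addrC normrM (ger0_norm m0).
  rewrite averageD averageZ average_cst // lerD2r -mulrDr ler_wpM2l //.
  exact: watson_trunc_error.
have -> : expect P (fun w => expR (- (m * U_squared Z Zt w))) -
    average (fun S : {set 'I_(s_ i + t_ i)} => expR (- (m * scaled_size R (s_ i) (t_ i) (core_of_word S).1))) =
  (expect P (fun w => expR (- (m * U_squared Z Zt w))) -
    expect P (fun w => expR (- (m * U_squared_sum Z Zt K w)))) +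
  (expect P (fun w => expR (- (m * U_squared_sum Z Zt K w))) -
    average (fun S : {set 'I_(s_ i + t_ i)} => expR (- (m * watson_trunc K S)))) +
  (average (fun S : {set 'I_(s_ i + t_ i)} => expR (- (m * watson_trunc K S))) -
    average (fun S : {set 'I_(s_ i + t_ i)} => expR (- (m * scaled_size R (s_ i) (t_ i) (core_of_word S).1)))) by ring.
apply: le_lt_trans (ler_normD _ _) _; apply: le_lt_trans (lerD (ler_normD _ _) b2) _.
move: h1 h2 b1 b3 b4; lra.
Unshelve. all: by end_near.
Qed.

End LaplaceLimit.

(** * Polynomials in [exp(-u)] separating half-lines *)

Section Separation.
Context {R : realType}.

(* In the variable y = exp(-u), the polynomial 1 - (1 - y^k)^N tends to the
   indicator of u <= x when k grows and N is about exp(k(x + h/2)). *)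
Lemma separating_poly (x h e : R) : 0 <= x -> 0 < h -> 0 < e ->
  exists p : {poly R}, forall u, 0 <= u ->
    [/\ 0 <= p.[expR (- u)] <= 1, u <= x -> 1 - e <= p.[expR (- u)] &
        x + h <= u -> p.[expR (- u)] <= e].
Proof.
move=> x0 h0 e0.
(* With [z = k h / 2] at least [2 / e], the inequality [1 + z <= expR z] gives
   [2 * expR (- z) <= e], the error allowed on both sides. *)
have [k [k0 kE]] : exists k : nat, (0 : R) < k%:R /\ 2 / e <= k%:R * (h / 2).
  exists (Num.truncn (4 / (e * h))).+1; split; first by rewrite ltr0n.
  have := truncnS_gt (4 / (e * h)); move: ((Num.truncn (4 / (e * h))).+1%:R : R) => y.
  rewrite ltr_pdivrMr ?mulr_gt0 // ler_pdivrMr // => H; nra.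
have [z zE] : exists z, z = k%:R * (h / 2) by exists (k%:R * (h / 2)).
rewrite -zE in kE.
have ze : 2 <= e * z by rewrite mulrC -ler_pdivrMr.
have z0 : 0 < z by rewrite zE mulr_gt0 // divr_gt0.
have kh : k%:R * h = 2 * z by rewrite zE; field.
have small : 2 * expR (- z) <= e.
  rewrite expRN ler_pdivrMr ?expR_gt0 //.
  by have := expR_ge1Dx z; nra.
(* This places the threshold at the midpoint [x + h / 2]: [N * q] is at least [expR z] for [u <= x],
   where [(1 - q) ^+ N] is tiny, and at most [2 * expR (- z)] for [u >= x + h], where Bernoulli's
   inequality applies. *)
have [r rE] : exists r, r = expR (k%:R * x + z) by exists (expR (k%:R * x + z)).
have r0 : 0 <= r by rewrite rE expR_ge0.
have [N [rN Nr]] : exists N : nat, r < N%:R /\ N%:R <= r + 1.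
  exists (Num.truncn r).+1; split; first exact: truncnS_gt.
  by rewrite -natr1 lerD2r truncn_le.
clear kE zE.
exists (1 - (1 - 'X^k) ^+ N) => u u0.
rewrite !(hornerD, hornerN, horner_exp, hornerX, hornerC).
have -> : expR (- u) ^+ k = expR (- (k%:R * u)) by rewrite -expRM_natl mulrN.
set q := expR (- (k%:R * u)).
have q0 : 0 < q by exact: expR_gt0.
have q1 : q <= 1 by rewrite expR_le1 oppr_le0 mulr_ge0 // ltW.
have p01 : 0 <= 1 - q <= 1 by rewrite subr_ge0 q1 gerBl ltW.
have pN : 0 <= (1 - q) ^+ N <= 1.
  by have /andP[? ?] := p01; rewrite exprn_ge0 // exprn_ile1.
split; first by have /andP[? ?] := pN; rewrite subr_ge0 gerBl; apply/andP.
- move=> ux; rewrite lerD2l lerN2.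
  apply: (@le_trans _ _ (expR (- q) ^+ N)).
    by rewrite lerXn2r ?nnegrE ?expR_ge0 //; [lra|have := expR_ge1Dx (- q)].
  rewrite -expRM_natl mulrN.
  have qr : expR z <= q * N%:R.
    apply: (@le_trans _ _ (q * r)); last by rewrite ler_wpM2l ?ltW.
    rewrite rE -expRD ler_expR; have : k%:R * u <= k%:R * x by rewrite ler_pM2l.
    by lra.
  apply: (@le_trans _ _ (expR (- (expR z)))).
    by rewrite ler_expR lerN2 mulrC.
  apply: le_trans small.
  rewrite !expRN -[leLHS]mul1r; apply: ler_pM; rewrite ?invr_ge0 ?expR_ge0 ?ler1n //.
  by rewrite lef_pV2 ?posrE ?expR_gt0 // ler_expR; have := expR_ge1Dx z; lra.
- move=> xu; apply: le_trans small.
  apply: (@le_trans _ _ (N%:R * q)).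
    have bern n : 1 - n%:R * q <= (1 - q) ^+ n.
      elim: n => [|n IH]; first by rewrite mul0r subr0 expr0.
      rewrite exprS -natr1; have /andP[a0 a1] := p01.
      have nn : (0 : R) <= n%:R by [].
      by apply: (@le_trans _ _ ((1 - q) * (1 - n%:R * q))); [nra|rewrite ler_wpM2l].
    by have := bern N; lra.
  apply: (@le_trans _ _ ((r + 1) * q)); first by rewrite ler_wpM2r // ltW.
  have kxu : k%:R * x + 2 * z <= k%:R * u by rewrite -kh -mulrDr ler_pM2l.
  have rq : r * q <= expR (- z).
    by rewrite rE -expRD ler_expR; move: kxu; lra.
  have qz : q <= expR (- z).
    rewrite ler_expR lerN2; have : 0 <= k%:R * x by rewrite mulr_ge0 // ltW.
    by move: kxu z0; lra.
  by lra.
Qed.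

End Separation.

(** * From Laplace transforms to distribution functions *)

Section DistributionLimit.
Context {R : realType} (d : measure_display) (T : measurableType d) (P : probability T R).
Variables Z Zt : nat -> {RV P >-> R}.
Hypotheses (hZ : forall k, standard_normal (Z k)) (hZt : forall k, standard_normal (Zt k)).
Hypothesis hind : mutually_independent
  (fun i : nat + nat => match i with inl k => Z k | inr k => Zt k end).

Local Notation U := (U_squared Z Zt).

Definition word_cdf s t (x : R) : R :=
  average (fun S : {set 'I_(s + t)} => (scaled_size R s t (core_of_word S).1 <= x)%R%:R).

(** Passing from cores to words multiplies the numerator and the denominator by the same [n], so the
    uniform law is preserved. *)
Lemma cdf_scaled_core_size s t x : (0 < s)%N -> (0 < t)%N -> coprime s t ->
  cdf (scaled_core_size R s t) x = (word_cdf s t x)%:E.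
Proof.
move=> s0 t0 cop.
pose Q (k : nat) := (k%:R / (s%:R * t%:R * (s%:R + t%:R) / 2) <= x).
have fc := finite_cores s0 t0 cop.
have ne : simultaneous_cores s t !=set0.
  by exists empty_partition; split; rewrite /is_core.
rewrite /cdf /distribution /pushforward /= uniform_onE //; congr EFin.
rewrite (_ : scaled_core_size R s t @^-1` `]-oo, x] = [set l | Q (partition_size l)]); last first.
  by apply/seteqP; split=> l /=; rewrite in_itv.
have c1 := card_words_cores s0 t0 cop Q.
have c2 := card_words_cores s0 t0 cop predT.
have n0 : (s + t)%:R != 0 :> R by rewrite pnatr_eq0 -lt0n addn_gt0 s0.
rewrite /word_cdf /average -natr_sum /subsets_count.
rewrite (_ : \sum_(S : {set 'I_(s + t)} | #|S| == s) _ =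
  #|[pred S : {set 'I_(s + t)} | (#|S| == s) && Q (partition_size (core_of_word S).1)]|); last first.
  by rewrite -sum1_card [RHS]big_mkcondr; apply: eq_bigr => S _; rewrite /Q /scaled_size; case: ifP.
rewrite (_ : #|[pred S : {set 'I_(s + t)} | #|S| == s]| =
  #|[pred S : {set 'I_(s + t)} | (#|S| == s) && predT (partition_size (core_of_word S).1)]|); last first.
  by apply: eq_card => S; rewrite !inE andbT.
rewrite c1 c2 !natrM invfM mulrACA divff // mul1r; congr (_ / _%:R).
by congr (#|` fset_set _|); apply/seteqP; split=> l /= => [|[]].
Qed.

Lemma cdf_U_squared x : cdf U x = (expect P (fun w => (U w <= x)%R%:R))%:E.
Proof.
have mA : measurable (U @^-1` `]-oo, x]).
  by rewrite -[_ @^-1` _]setTI; apply: measurable_funPT => //; exact: measurable_itv.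
rewrite /cdf /distribution /pushforward -[LHS]fineK ?fin_num_measure // -(expect_indic P mA).
congr EFin; apply: eq_expect => w; rewrite indicE; congr (_%:R : R); congr nat_of_bool.
by apply/idP/idP => [/set_mem|h]; [|apply/mem_set]; rewrite /= in_itv.
Qed.

Variables s_ t_ : nat -> nat.
Hypotheses (hs : forall i, (i < s_ i)%N) (ht : forall i, (i < t_ i)%N).
Hypothesis cop : forall i, coprime (s_ i) (t_ i).

Let sP i : (0 < s_ i)%N. Proof. exact: leq_ltn_trans (hs i). Qed.

Local Notation Y i S := (scaled_size R (s_ i) (t_ i) (core_of_word (S : {set 'I_(s_ i + t_ i)})).1).

Let mexp (m : R) : measurable_fun setT (fun w => expR (- (m * U w))).
Proof.
apply: measurableT_comp => //; apply: measurable_funN; exact: measurable_funM.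
Qed.

Let iexp (m : R) : 0 <= m -> P.-integrable setT (EFin \o (fun w => expR (- (m * U w)))).
Proof.
move=> m0; apply: (@bounded_integrable _ _ _ P _ 1) => // w.
by rewrite ger0_norm ?expR_ge0 // expR_le1 oppr_le0 mulr_ge0 // U_squared_ge0.
Qed.

Lemma horner_expR (p : {poly R}) u :
  p.[expR (- u)] = \sum_(0 <= j < size p) p`_j * expR (- (j%:R * u)).
Proof.
rewrite horner_coef big_mkord; apply: eq_bigr => j _.
by rewrite -expRM_natl mulrN.
Qed.

Lemma cvg_average_poly (p : {poly R}) :
  average (fun S => p.[expR (- Y i S)]) @[i --> \oo] --> expect P (fun w => p.[expR (- U w)]) /\
  P.-integrable setT (EFin \o (fun w => p.[expR (- U w)])).
Proof.
have ij (j : nat) : P.-integrable setT (EFin \o (fun w => p`_j * expR (- (j%:R * U w)))).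
  exact: (integrableZl measurableT _ (iexp (ler0n R j))).
have [E1 E2] := expect_sum (index_iota 0 (size p)) ij.
have e : (fun w => p.[expR (- U w)]) =
    (fun w => \sum_(0 <= j < size p) p`_j * expR (- (j%:R * U w))).
  by apply/funext => w; rewrite horner_expR.
rewrite e; split => //; rewrite E1.
under eq_fun => i.
  rewrite (@eq_average _ _ _ _ (fun S => \sum_(0 <= j < size p) p`_j * expR (- (j%:R * Y i S)))); last first.
    by move=> S _; rewrite horner_expR.
  rewrite average_sum; under eq_bigr do rewrite averageZ; over.
apply: cvg_sum_seq => j.
rewrite expectZ; last exact: iexp.
by apply: cvgMr; exact: (cvg_average_laplace hZ hZt hind hs ht cop).
Qed.

Let mle x : measurable_fun setT (fun w => (U w <= x)%R%:R : R).
Proof.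
have mU : measurable_fun setT U by exact: measurable_funPT.
have : measurable_fun setT (\1_(U @^-1` `]-oo, x]) : T -> R).
  apply: measurable_indic; rewrite -[_ @^-1` _]setTI; apply: mU => //; exact: measurable_itv.
apply: eq_measurable_fun => w _; rewrite indicE; congr (_%:R : R); congr nat_of_bool.
by apply/idP/idP => [/set_mem|h]; [|apply/mem_set]; rewrite /= in_itv.
Qed.

Let ile x : P.-integrable setT (EFin \o (fun w => (U w <= x)%R%:R : R)).
Proof.
apply: (@bounded_integrable _ _ _ P _ 1); first exact: mle.
by move=> w; rewrite ger0_norm // lern1 leq_b1.
Qed.

(** The separating polynomial lies, up to [e / 3], between the indicators of [u <= x] and
    [u <= x + h], and its mean converges. This sandwich gives a bound in each direction at the price
    of a shift [h]. *)
Lemma word_cdf_limit x h e : 0 < h -> 0 < e -> \forall i \near \oo,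
  word_cdf (s_ i) (t_ i) x <= expect P (fun w => (U w <= x + h)%R%:R) + e /\
  expect P (fun w => (U w <= x)%R%:R) <= word_cdf (s_ i) (t_ i) (x + h) + e.
Proof.
move=> h0 e0; have e3 : 0 < e / 3 by rewrite divr_gt0.
(* The polynomials only separate at [0 <= x]; for negative [x] both distribution functions
   vanish. *)
have [x0|x0] := ltP x 0.
  apply: nearW => i; split.
    rewrite /word_cdf (@eq_average _ _ _ _ (fun=> 0)) ?average_cst //; last first.
      move=> S _; case: leP => // Yx; have := scaled_size_ge0 (R := R) (s_ i) (t_ i) (core_of_word S).1.
      by move=> /(fun h => le_lt_trans (le_trans h Yx) x0); rewrite ltxx.
    apply: addr_ge0 (ltW e0); rewrite -(expect_cst P 0).
    apply: le_expect; [|exact: ile|by move=> w; exact: ler0n].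
    exact: finite_measure_integrable_cst.
  rewrite (@eq_expect _ _ _ _ _ (cst 0)); last first.
    move=> w; case: leP => // Ux; have := U_squared_ge0 Z Zt w.
    by move=> /(fun h => le_lt_trans (le_trans h Ux) x0); rewrite ltxx.
  rewrite expect_cst; apply: addr_ge0 (ltW e0).
  by apply: mulr_ge0; rewrite ?invr_ge0 //; apply: sumr_ge0.
have [p hp] := separating_poly x0 h0 e3.
have [cp ip] := cvg_average_poly p.
have := cvg_dist_lt cp e3; apply: filterS => i; rewrite ltr_distl => /andP[l1 l2].
have ic : P.-integrable setT (EFin \o cst (e / 3)) by exact: finite_measure_integrable_cst.
have up u : 0 <= u -> (u <= x)%R%:R <= p.[expR (- u)] + e / 3.
  move=> u0; have [/andP[p0 _] h1 _] := hp u u0; case: (leP u x) => ux /=; last by lra.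
  by have := h1 ux; lra.
have lo u : 0 <= u -> p.[expR (- u)] <= (u <= x + h)%R%:R + e / 3.
  move=> u0; have [/andP[_ p1] _ h2] := hp u u0; case: (leP u (x + h)) => ux /=; first by lra.
  by have := h2 (ltW ux); lra.
have a1 : word_cdf (s_ i) (t_ i) x <= average (fun S => p.[expR (- Y i S)]) + e / 3.
  rewrite -[X in _ + X](@average_cst R (s_ i) (t_ i)) -averageD.
  by apply: le_average => S _; apply: up; exact: scaled_size_ge0.
have a2 : average (fun S => p.[expR (- Y i S)]) <= word_cdf (s_ i) (t_ i) (x + h) + e / 3.
  rewrite -[X in _ + X](@average_cst R (s_ i) (t_ i)) -averageD.
  by apply: le_average => S _; apply: lo; exact: scaled_size_ge0.
have b1 : expect P (fun w => (U w <= x)%R%:R) <= expect P (fun w => p.[expR (- U w)]) + e / 3.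
  rewrite -[X in _ + X](expect_cst P) -expectD //; apply: le_expect => //.
    exact: (integrableD measurableT ip ic).
  by move=> w; apply: up; exact: U_squared_ge0.
have b2 : expect P (fun w => p.[expR (- U w)]) <= expect P (fun w => (U w <= x + h)%R%:R) + e / 3.
  rewrite -[X in _ + X](expect_cst P) -expectD //; apply: le_expect => //.
    exact: (integrableD measurableT (ile _) ic).
  by move=> w; apply: lo; exact: U_squared_ge0.
by split; lra.
Qed.

Lemma cvg_word_cdf x : {for x, continuous (cdf U)} -> forall e, 0 < e -> \forall i \near \oo,
  `|word_cdf (s_ i) (t_ i) x - expect P (fun w => (U w <= x)%R%:R)| < e.
Proof.
move=> cx e e0; pose F y := expect P (fun w => (U w <= y)%R%:R).
have cF : F y @[y --> x] --> F x.
  have := @fine_cvg R R (nbhs x) (nbhs_filter x) (cdf U) (F x); rewrite -cdf_U_squared => /(_ cx).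
  by rewrite (_ : fine \o cdf U = F) //; apply/funext => y; rewrite /comp cdf_U_squared.
have e2 : 0 < e / 2 by rewrite divr_gt0.
move/cvgrPdist_lt: cF => /(_ _ e2) /nbhs_ballP[r /= r0 hr].
have r2 : 0 < r / 2 by rewrite divr_gt0.
have Fp : `|F x - F (x + r / 2)| < e / 2.
  by apply: hr; rewrite /ball /= opprD addNKr normrN gtr0_norm // ltr_pdivrMr // ltr_pMr // ltr1n.
have Fm : `|F x - F (x - r / 2)| < e / 2.
  by apply: hr; rewrite /ball /= opprB addrC subrK gtr0_norm // ltr_pdivrMr // ltr_pMr // ltr1n.
(* The upper bound is used at [x] and the lower bound at [x - r / 2], so that both concern
   [word_cdf] at [x]; continuity of the limit absorbs the shifts. *)
have := word_cdf_limit x r2 e2; have := word_cdf_limit (x - r / 2) r2 e2; rewrite subrK.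
apply: filterS2 => i [_ h1] [h2 _].
move: Fp Fm; rewrite !ltr_distl -/(F x) => /andP[? ?] /andP[? ?].
by move: h1 h2; rewrite -/(F _) -/(F _); lra.
Qed.

End DistributionLimit.

Theorem theorem1 (R : realType) (d : measure_display) (T : measurableType d)
    (P : probability T R) (Z Zt : nat -> {RV P >-> R})
    (hZ : forall k, standard_normal (Z k))
    (hZt : forall k, standard_normal (Zt k))
    (hind : mutually_independent
              (fun i : nat + nat =>
                 match i with inl k => Z k | inr k => Zt k end)) :
  cvg_in_distribution
    (within [set st : nat * nat | coprime st.1 st.2] (filter_prod \oo \oo))
    (fun st : nat * nat => scaled_core_size R st.1 st.2)
    (U_squared Z Zt).
Proof.
move=> x cx; set F := expect P (fun w => (U_squared Z Zt w <= x)%R%:R).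
(* If no threshold [N] worked, choice would yield a coprime sequence with both entries at index [i]
   above [i] that stays [e] away from the limit, against the sequential result. *)
have unif e : 0 < e -> exists N : nat, forall s t, (N < s)%N -> (N < t)%N -> coprime s t ->
    `|word_cdf s t x - F| < e.
  move=> e0; apply: contrapT => nN.
  have ex (i : nat) : exists st : nat * nat, [/\ (i < st.1)%N, (i < st.2)%N, coprime st.1 st.2 &
      ~ `|word_cdf st.1 st.2 x - F| < e].
    apply: contrapT => nst; apply: nN; exists i => s t si ti cst; apply: contrapT => h.
    by apply: nst; exists (s, t).
  have [f hf] := choice ex.
  have hs i : (i < (f i).1)%N by have [] := hf i.
  have ht i : (i < (f i).2)%N by have [] := hf i.
  have cop i : coprime (f i).1 (f i).2 by have [] := hf i.
  have [N _ hN] := cvg_word_cdf hZ hZt hind hs ht cop cx e0.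
  by have [_ _ _] := hf N; apply; apply: hN => /=.
rewrite cdf_U_squared -/F.
apply: (@cvg_trans _ ((word_cdf st.1 st.2 x)%:E @[st --> within [set st : nat * nat | coprime st.1 st.2] (filter_prod \oo \oo)])).
  apply: near_eq_cvg; rewrite near_withinE.
  exists ([set n | (0 < n)%N], [set n | (0 < n)%N]); first by split; exists 1%N.
  by case=> s t; case=> s0 t0 cst; exact: esym (cdf_scaled_core_size x s0 t0 cst).
apply: cvg_EFin; first exact: nearW.
apply/cvgrPdist_lt => e e0; have [N hN] := unif e e0.
rewrite near_withinE; exists ([set n | (N < n)%N], [set n | (N < n)%N]) => /=.
  by split; exists N.+1.
by move=> [s t] [/= s0 t0] cst; rewrite distrC; exact: hN.
Qed.
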